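(* Let $a\in\mathcal{S}'(\mathbb{R}^{2d})$ and $\tau_1,\tau_2\in[0,1]$. Then for every $f,g\in\mathcal{S}(\mathbb{R}^d)$ $$W_{\tau_1}(Op_{\tau_2}(a)f,g)=Op_{\tau_2}(b)\,W_{\tau_1}(f,g),$$ where $$b=\mu(N_{\tau_2}^{T})\left[\left(\mu(N_{\tau_2}^{-T})\sigma\right)\circ\mathbf{A}_{\tau_1}^{-1}\right]\in\mathcal{S}'(\mathbb{R}^{4d}).$$ Here $\sigma(r,y,\rho,\eta)=a(r,\rho)\otimes1_{(y,\eta)}$, and the operators $\mu(N_\tau^{-T})$, $\mu(N_\tau^{T})$ and the linear map $\mathbf{A}_\tau^{-1}$ are those specified in the context. In particular, for $\tau_2=1/2$, writing $Op_w=Op_{1/2}$, $$W_{\tau_1}(Op_w(a)f,g)=Op_w(b)\,W_{\tau_1}(f,g),\qquad b(x,\xi,u,v)=\sigma(\mathbf{A}_{\tau_1}^{-1}(x,\xi,u,v))=a\left(x-\tau_1v,\ \xi+(1-\tau_1)u\right).$$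
   Context: Cross-$\tau$-Wigner distribution: $W_\tau(f,g)(x,\xi)=\int_{\mathbb{R}^d}e^{-2\pi i t\cdot\xi}f(x+\tau t)\overline{g(x-(1-\tau)t)}\,dt$, extended to tempered distributions as the partial Fourier transform in the second variable of $f\otimes\bar g$ composed with $(x,t)\mapsto(x+\tau t,x-(1-\tau)t)$. $\tau$-quantization on $\mathbb{R}^n$ of $\sigma\in\mathcal{S}'(\mathbb{R}^{2n})$: $Op_\tau(\sigma)F(X)=\int_{\mathbb{R}^{2n}}e^{2\pi i(X-Y)\cdot\zeta}\sigma((1-\tau)X+\tau Y,\zeta)F(Y)\,dY\,d\zeta$, understood in the distributional sense as an operator $\mathcal{S}(\mathbb{R}^n)\to\mathcal{S}'(\mathbb{R}^n)$. It is used with $n=d$ for $a$, and with $n=2d$, $X=(x,\xi)$, $\zeta=(u,v)$, for $b$ ($u,v$ dual to $x,\xi$). $1_{(y,\eta)}$ denotes the constant function $1$ of $(y,\eta)\in\mathbb{R}^{2d}$, so $\sigma\in\mathcal{S}'(\mathbb{R}^{4d})$; $(\rho,\eta)$ are dual to $(r,y)$. The invertible linear map $\mathbf{A}_\tau^{-1}:\mathbb{R}^{4d}\to\mathbb{R}^{4d}$, $(x,\xi,u,v)\mapsto(r,y,\rho,\eta)$, is $$\mathbf{A}_\tau^{-1}(x,\xi,u,v)=\left(x-\tau v,\ x+(1-\tau)v,\ \xi+(1-\tau)u,\ -\xi+\tau u\right).$$ For $\tau\in[0,1]$, $\mu(N_\tau^{-T})$ is the (metaplectic) Fourier multiplier on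 $\mathcal{S}'(\mathbb{R}^{4d})$ given by $\mu(N_\tau^{-T})F=\mathcal{F}^{-1}\left(e^{2\pi i(\tau-1/2)\omega_1\cdot\omega_2}\,\mathcal{F}F\right)$, with $(\omega_1,\omega_2)\in\mathbb{R}^{2d}\times\mathbb{R}^{2d}$ the Fourier variables and $\mathcal{F}F(\omega)=\int F(X)e^{-2\pi iX\cdot\omega}dX$; it is the metaplectic operator of the inverse transpose of $N_\tau=\begin{pmatrix} I & 0 \\ C_\tau & I \end{pmatrix}$, $C_\tau=(\tau-\frac12)\begin{pmatrix} 0 & I \\ I & 0 \end{pmatrix}$, where $I$ and $0$ denote identity and zero blocks. $\mu(N_\tau^{T})$ is its inverse, $\mu(N_\tau^{T})F=\mathcal{F}^{-1}\left(e^{-2\pi i(\tau-1/2)\omega_1\cdot\omega_2}\,\mathcal{F}F\right)$. *)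

(* Defs.v *)
From HB Require Import structures.
From mathcomp Require Import all_boot all_order all_algebra.
From mathcomp Require Import complex.
From mathcomp Require Import all_classical all_reals all_analysis.

Set Implicit Arguments.
Unset Strict Implicit.
Unset Printing Implicit Defensive.

Import Order.TTheory GRing.Theory Num.Theory.
Import numFieldNormedType.Exports.

Local Open Scope ring_scope.
Local Open Scope complex_scope.
Local Open Scope classical_set_scope.

(* R^n is 'rV[R]_n and R^n x R^m is 'rV[R]_(n + m), with (x, y) written
   row_mx x y.  Complex-valued functions are differentiated and integrated
   through their real and imaginary parts. *)

Definition cfun (R : realType) (n : nat) : Type := 'rV[R]_n -> R[i].

(* The Lebesgue integral over R^n written as an iterated integral.  It is only
   used for integrands that are Schwartz, possibly after multiplication by a
   bounded continuous function, for which this is the Lebesgue integral by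
   Fubini. *)
Fixpoint integral_Rn (R : realType) (n : nat) : ('rV[R]_n -> R) -> R :=
  match n with
  | 0 => fun f => f 0
  | n'.+1 => fun f =>
      \int[lebesgue_measure]_t
        integral_Rn (fun x : 'rV[R]_n' => f (row_mx t%:M x : 'rV[R]_(1 + n')))
  end.

Definition cintegral (R : realType) (n : nat) (f : cfun R n) : R[i] :=
  integral_Rn (fun x => complex.Re (f x)) +i*
  integral_Rn (fun x => complex.Im (f x)).

Definition dotp (R : realType) (n : nat) (x y : 'rV[R]_n) : R :=
  \sum_(i < n) x 0 i * y 0 i.

Definition expi (R : realType) (t : R) : R[i] := cos t +i* sin t.

Definition pderiv (R : realType) (n : nat) (s : seq 'I_n) (f : 'rV[R]_n -> R) :
    'rV[R]_n -> R :=
  foldr (fun i g x => 'D_(delta_mx 0 i) g x) f s.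

Definition smooth (R : realType) (n : nat) (f : 'rV[R]_n -> R) : Prop :=
  forall (s : seq 'I_n) (x : 'rV[R]_n), differentiable (pderiv s f) x.

Definition cpderiv (R : realType) (n : nat) (s : seq 'I_n) (f : cfun R n) :
    cfun R n :=
  fun x => pderiv s (fun y => complex.Re (f y)) x +i*
           pderiv s (fun y => complex.Im (f y)) x.

Definition weighted_deriv (R : realType) (n N : nat) (s : seq 'I_n)
    (f : cfun R n) (x : 'rV[R]_n) : R :=
  (1 + `|x|) ^+ N * Normc.normc (cpderiv s f x).

Definition schwartz (R : realType) (n : nat) (f : cfun R n) : Prop :=
  [/\ smooth (fun x => complex.Re (f x)),
      smooth (fun x => complex.Im (f x)) &
      forall (N : nat) (s : seq 'I_n),
        exists M : R, forall x, weighted_deriv N s f x <= M].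

Definition schwartz_norm (R : realType) (n N : nat) (f : cfun R n) : R :=
  sup [set r | exists (s : seq 'I_n) (x : 'rV[R]_n),
         (size s <= N)%N /\ r = weighted_deriv N s f x].

(* A distribution is carried by a functional on all functions, of which only
   the values at Schwartz functions are meaningful: membership in S'(R^n) is
   [tempered] and equality in S'(R^n) is [eq_distr].  The duality pairing is
   bilinear. *)
Definition distr (R : realType) (n : nat) : Type := cfun R n -> R[i].

Definition tempered (R : realType) (n : nat) (T : distr R n) : Prop :=
  (forall (c : R[i]) (phi psi : cfun R n), schwartz phi -> schwartz psi ->
     T (fun x => c * phi x + psi x) = c * T phi + T psi) /\
  (exists (N : nat) (C : R), forall phi : cfun R n, schwartz phi ->
     Normc.normc (T phi) <= C * schwartz_norm N phi).

Definition eq_distr (R : realType) (n : nat) (T U : distr R n) : Prop :=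
  forall phi : cfun R n, schwartz phi -> T phi = U phi.

Definition distr_of_fun (R : realType) (n : nat) (f : cfun R n) : distr R n :=
  fun phi => cintegral (fun x => f x * phi x).

Definition distr_conj (R : realType) (n : nat) (T : distr R n) : distr R n :=
  fun phi => (T (fun x => (phi x)^*%R))^*%R.

Definition distr_mul (R : realType) (n : nat) (m : cfun R n) (T : distr R n) :
    distr R n :=
  fun phi => T (fun x => m x * phi x).

Definition tensor (R : realType) (n m : nat) (T : distr R n) (U : distr R m) :
    distr R (n + m) :=
  fun phi => T (fun x => U (fun y => phi (row_mx x y))).

(* T o L, meaningful only for an invertible linear map L. *)
Definition distr_comp (R : realType) (n : nat) (T : distr R n)
    (L : 'rV[R]_n -> 'rV[R]_n) : distr R n :=
  let A := lin1_mx L in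
  fun phi => (`|\det A|^-1)%:C * T (fun y => phi (y *m invmx A)).

Definition fourier (R : realType) (n : nat) (f : cfun R n) : cfun R n :=
  fun w => cintegral (fun x => expi (- (2 * pi * dotp x w)) * f x).

Definition ifourier (R : realType) (n : nat) (f : cfun R n) : cfun R n :=
  fun x => cintegral (fun w => expi (2 * pi * dotp x w) * f w).

Definition fourier2 (R : realType) (n m : nat) (f : cfun R (n + m)) :
    cfun R (n + m) :=
  fun z => fourier (fun t => f (row_mx (lsubmx z) t)) (rsubmx z).

Definition ifourier2 (R : realType) (n m : nat) (f : cfun R (n + m)) :
    cfun R (n + m) :=
  fun z => ifourier (fun w => f (row_mx (lsubmx z) w)) (rsubmx z).

Definition distr_fourier (R : realType) (n : nat) (T : distr R n) :
    distr R n := fun phi => T (fourier phi).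

Definition distr_ifourier (R : realType) (n : nat) (T : distr R n) :
    distr R n := fun phi => T (ifourier phi).

Definition distr_fourier2 (R : realType) (n m : nat) (T : distr R (n + m)) :
    distr R (n + m) := fun phi => T (fourier2 phi).

Definition distr_ifourier2 (R : realType) (n m : nat) (T : distr R (n + m)) :
    distr R (n + m) := fun phi => T (ifourier2 phi).

Definition wigner (R : realType) (d : nat) (tau : R) (f g : cfun R d) :
    cfun R (d + d) :=
  fun z => let x := lsubmx z in let xi := rsubmx z in
    cintegral (fun t => expi (- (2 * pi * dotp t xi)) *
      f (x + tau *: t) * (g (x - (1 - tau) *: t))^*%R).

Definition wigner_map (R : realType) (d : nat) (tau : R)
    (z : 'rV[R]_(d + d)) : 'rV[R]_(d + d) :=
  let x := lsubmx z in let t := rsubmx z in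
  row_mx (x + tau *: t) (x - (1 - tau) *: t).

Definition distr_wigner (R : realType) (d : nat) (tau : R) (T U : distr R d) :
    distr R (d + d) :=
  distr_fourier2 (distr_comp (tensor T (distr_conj U)) (@wigner_map R d tau)).

Definition op_map (R : realType) (n : nat) (tau : R)
    (z : 'rV[R]_(n + n)) : 'rV[R]_(n + n) :=
  let X := lsubmx z in let Y := rsubmx z in
  row_mx ((1 - tau) *: X + tau *: Y) (X - Y).

(* The Schwartz kernel
     k(X, Y) = int e^{2 pi i (X - Y) . zeta} sigma((1-tau) X + tau Y, zeta) dzeta
   is the inverse partial Fourier transform of sigma in its second variable,
   composed with (X, Y) |-> ((1-tau) X + tau Y, X - Y); Op_tau(sigma) F is the
   functional phi |-> <k, phi (x) F>. *)
Definition op_kernel (R : realType) (n : nat) (tau : R)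
    (sigma : distr R (n + n)) : distr R (n + n) :=
  distr_comp (distr_ifourier2 sigma) (@op_map R n tau).

Definition Op (R : realType) (n : nat) (tau : R) (sigma : distr R (n + n))
    (F : cfun R n) : distr R n :=
  fun phi => op_kernel tau sigma (fun z => phi (lsubmx z) * F (rsubmx z)).

Definition N_mult (R : realType) (n : nat) (c : R) : cfun R (n + n) :=
  fun w => expi (2 * pi * c * dotp (lsubmx w) (rsubmx w)).

(* The metaplectic operators mu(N_tau^{-T}) and mu(N_tau^T), as Fourier
   multipliers. *)
Definition mu_NinvT (R : realType) (n : nat) (tau : R) (T : distr R (n + n)) :
    distr R (n + n) :=
  distr_ifourier (distr_mul (@N_mult R n (tau - 1 / 2)) (distr_fourier T)).

Definition mu_NT (R : realType) (n : nat) (tau : R) (T : distr R (n + n)) :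
    distr R (n + n) :=
  distr_ifourier (distr_mul (@N_mult R n (- (tau - 1 / 2))) (distr_fourier T)).

Definition A_inv (R : realType) (d : nat) (tau : R)
    (z : 'rV[R]_((d + d) + (d + d))) : 'rV[R]_((d + d) + (d + d)) :=
  let x := lsubmx (lsubmx z) in let xi := rsubmx (lsubmx z) in
  let u := lsubmx (rsubmx z) in let v := rsubmx (rsubmx z) in
  row_mx (row_mx (x - tau *: v) (x + (1 - tau) *: v))
         (row_mx (xi + (1 - tau) *: u) (- xi + tau *: u)).

Definition swap_mid (R : realType) (d : nat)
    (z : 'rV[R]_((d + d) + (d + d))) : 'rV[R]_((d + d) + (d + d)) :=
  let r := lsubmx (lsubmx z) in let y := rsubmx (lsubmx z) in
  let rho := lsubmx (rsubmx z) in let eta := rsubmx (rsubmx z) in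
  row_mx (row_mx r rho) (row_mx y eta).

Definition distr1 (R : realType) (n : nat) : distr R n :=
  distr_of_fun (fun=> 1).

(* a(r, rho) (x) 1_{(y, eta)}, with the variables in the order (r, y, rho, eta). *)
Definition sigma_of (R : realType) (d : nat) (a : distr R (d + d)) :
    distr R ((d + d) + (d + d)) :=
  distr_comp (tensor a (@distr1 R (d + d))) (@swap_mid R d).

Definition symbol_b (R : realType) (d : nat) (tau1 tau2 : R)
    (a : distr R (d + d)) : distr R ((d + d) + (d + d)) :=
  mu_NT tau2 (distr_comp (mu_NinvT tau2 (sigma_of a)) (@A_inv R d tau1)).

Definition shear (R : realType) (d : nat) (tau : R)
    (z : 'rV[R]_((d + d) + (d + d))) : 'rV[R]_((d + d) + (d + d)) :=
  let x := lsubmx (lsubmx z) in let xi := rsubmx (lsubmx z) in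
  let u := lsubmx (rsubmx z) in let v := rsubmx (rsubmx z) in
  row_mx (row_mx (x - tau *: v) (xi + (1 - tau) *: u)) (row_mx u v).

(* The distribution a(x - tau v, xi + (1-tau) u) in the variables
   (x, xi, u, v): a (x) 1_{(u, v)} composed with the shear above. *)
Definition a_sheared (R : realType) (d : nat) (tau : R)
    (a : distr R (d + d)) : distr R ((d + d) + (d + d)) :=
  distr_comp (tensor a (@distr1 R (d + d))) (@shear R d tau).

(* Main.v *)
From HB Require Import structures.
Require Import Defs.
From mathcomp Require Import all_boot all_order all_algebra.
From mathcomp Require Import complex ring lra.
From mathcomp Require Import all_classical all_reals all_analysis.
From mathcomp Require Import measurable_realfun.

(** Unfolding the definitions, [symbol_b] acts by [b phi = a (Theta phi)], where
    the operator Theta ([symbol_transpose]) on test functions is made of Fourier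
    multipliers, a linear change of variables, and the integration over the
    variables (y, eta) on which sigma does not depend.  All the linear maps
    involved are products of involutions, so their determinants have absolute
    value 1 and no Jacobian appears.  The symbol b is tempered because Theta is
    continuous on the Schwartz space.  Both sides of the intertwining relation
    are the value of a at a test function, and these two functions are equal
    pointwise ([symbol_transpose_bwigner]).

    The distribution Op_tau(sigma) F pairs sigma with the bilinear Wigner
    transform B_tau(phi, F), the inverse partial Fourier transform of
    [phi (x + tau t) F (x - (1 - tau) t)] in t ([bwigner], [OpE]).  Three facts
    about it give the equality.
    - The multiplier with phase [2 pi c w1.w2] acts on an inverse partial Fourier
      transform as the shear [(S, T) -> (S + c T, T)] ([fmult_ifourier2]), hence
      it maps B_tau to B_(tau + c) ([fmult_bwigner]).  The multipliers in the
      definition of b therefore pass from the tau-quantization to the Weyl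
      quantization and back.
    - The Weyl transform B_(1/2) is covariant: a partial Fourier transform can be
      moved from one function to the other ([bwigner_fourier2]), and a linear
      change of variables in both functions undone ([bwigner_wigner_map]), at the
      cost of a linear map of phase space.  The Wigner
      distribution W_tau(f, g) is obtained from f and g by one such change of
      variables and one partial Fourier transform, and the resulting map of phase
      space is [A_inv tau] ([bwigner_A_inv]).
    - Integrating B_tau over a position y and its frequency eta is a Fourier
      inversion, which leaves an ordinary pairing in y ([cintegral_ifourier2]).
      The pairing with the conjugate of g is what the left-hand side contains.

    For tau2 = 1/2 the multipliers are trivial, and a translation of the
    variables (y, eta) identifies the two forms of the symbol.

    The analytic part rests on two devices.  Fubini and affine substitution are
    proved for iterated integrals of continuous functions dominated by a product
    of one-variable weights, which covers all the integrands that occur.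
    Continuity of an operator on the Schwartz space is reduced to a sup bound as
    soon as the operator exchanges derivatives and coordinate multiplications
    with operators already known to be continuous
    ([schwartz_continuous_intertwine]); affine pullbacks, chirps and partial
    Fourier transforms are all of this kind.  Fourier inversion is proved by
    Gaussian regularization ([cintegral_fourier]). *)

Set Implicit Arguments.
Unset Strict Implicit.
Unset Printing Implicit Defensive.

Import Order.TTheory GRing.Theory Num.Theory.
Import numFieldNormedType.Exports.

Local Open Scope classical_set_scope.
Local Open Scope ring_scope.

(** * Integrals of dominated continuous functions on the line *)

Lemma continuous2_comp (S T U V : topologicalType) (h : T -> U -> V)
    (f : S -> T) (g : S -> U) :
  continuous (fun p : T * U => h p.1 p.2) -> continuous f -> continuous g ->
  continuous (fun x => h (f x) (g x)).
Proof.
move=> ch cf cg x; apply: (@continuous2_cvg _ _ _ _ (nbhs x)); last 2 first.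
- exact: cf.
- exact: cg.
- exact: (ch (f x, g x)).
Qed.

Section OneDim.
Context {R : realType}.
Local Notation mu := (@lebesgue_measure R).
Implicit Types (f g : R -> R) (t s C : R).

Definition cauchy t : R := (1 + t ^+ 2)^-1.
(** Two Cauchy factors: one makes the tails of an integral uniformly small,
    the other one keeps them integrable. *)
Definition wt t : R := cauchy t * cauchy t.

Lemma onesqr_gt0 t : 0 < 1 + t ^+ 2.
Proof. by rewrite ltr_pwDl// sqr_ge0. Qed.

Lemma cauchy_gt0 t : 0 < cauchy t.
Proof. by rewrite invr_gt0 onesqr_gt0. Qed.

Lemma cauchy_le1 t : cauchy t <= 1.
Proof. by rewrite invf_le1 ?onesqr_gt0// lerDl sqr_ge0. Qed.

Lemma wt_gt0 t : 0 < wt t.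
Proof. by rewrite mulr_gt0// cauchy_gt0. Qed.

Lemma wt_le_cauchy t : wt t <= cauchy t.
Proof. by rewrite /wt ger_pMl ?cauchy_gt0// cauchy_le1. Qed.

Lemma continuous_cauchy : continuous cauchy.
Proof. exact: continuous_oneDsqrV. Qed.

Lemma integrable_cauchy : mu.-integrable setT (EFin \o cauchy).
Proof.
apply/integrableP; split.
  apply/measurable_EFinP; apply: continuous_measurable_fun.
  exact: continuous_cauchy.
rewrite (_ : (fun _ => _) = fun t => (cauchy t)%:E); last first.
  by apply/funext => t /=; rewrite ger0_norm// ltW// cauchy_gt0.
rewrite ge0_symfun_integralT//=.
- rewrite (_ : [set x | _] = `[0, +oo[%classic); last first.
    by apply/seteqP; split => x/=; rewrite in_itv/= andbT.
  by rewrite integral0y_oneDsqr -EFinM ltry.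
- by move=> x; rewrite ltW// cauchy_gt0.
- exact: continuous_cauchy.
- by move=> x/=; rewrite /cauchy sqrrN.
Qed.

Definition dominated f := continuous f /\ exists C, forall t, `|f t| <= C * cauchy t.

Lemma integrable_dominated f : dominated f -> mu.-integrable setT (EFin \o f).
Proof.
move=> [cf [C fC]].
apply: (@le_integrable _ _ _ mu _ measurableT _ (fun t => (C%:E * (EFin \o cauchy) t)%E)) => //.
- by apply/measurable_EFinP; apply: continuous_measurable_fun.
- move=> t _ /=; rewrite lee_fin (le_trans (fC t))// ler_norm//.
- by apply: integrableZl => //; exact: integrable_cauchy.
Qed.

Lemma integrableZ_cauchy (C : R) : mu.-integrable setT (EFin \o (fun t => C * cauchy t)).
Proof. by apply: (@integrableZl _ _ _ mu _ measurableT C (EFin \o cauchy)); exact: integrable_cauchy. Qed.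

Definition cauchy_mass : R := \int[mu]_t cauchy t.

Lemma cauchy_mass_ge0 : 0 <= cauchy_mass.
Proof. by apply: Rintegral_ge0 => t _; rewrite ltW// cauchy_gt0. Qed.

Lemma norm_integral_le f C : continuous f -> (forall t, `|f t| <= C * cauchy t) ->
  `|\int[mu]_t f t| <= C * cauchy_mass.
Proof.
move=> cf fC; have df : dominated f by split=> //; exists C.
apply: le_trans (le_normr_Rintegral _ (integrable_dominated df)) _ => //.
rewrite -RintegralZl//; last exact: integrable_cauchy.
apply: le_Rintegral => //.
- apply: integrable_dominated; split.
    by move=> t; apply: continuous_comp; [exact: cf|exact: norm_continuous].
  by exists C => t; rewrite normr_id.
- exact: integrableZ_cauchy.
Qed.

Lemma dominated_wt f C : continuous f -> (forall t, `|f t| <= C * wt t) ->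
  dominated f.
Proof.
move=> cf fC; split => //; exists C => t; apply: (le_trans (fC t)).
have C0 : 0 <= C.
  by have := le_trans (normr_ge0 _) (fC 0); rewrite pmulr_lge0// wt_gt0.
by rewrite ler_wpM2l// wt_le_cauchy.
Qed.

Lemma norm_integral_wt f C : continuous f -> (forall t, `|f t| <= C * wt t) ->
  `|\int[mu]_t f t| <= C * cauchy_mass.
Proof.
move=> cf fC; apply: norm_integral_le => // t; apply: (le_trans (fC t)).
have C0 : 0 <= C.
  by have := le_trans (normr_ge0 _) (fC 0); rewrite pmulr_lge0// wt_gt0.
by rewrite ler_wpM2l// wt_le_cauchy.
Qed.

Lemma integralD_dom f g : dominated f -> dominated g ->
  \int[mu]_t (f t + g t) = \int[mu]_t f t + \int[mu]_t g t.
Proof.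
by move=> df dg; apply: RintegralD => //; exact: integrable_dominated.
Qed.

Lemma integralZ_dom (c : R) f : dominated f ->
  \int[mu]_t (c * f t) = c * \int[mu]_t f t.
Proof. by move=> df; apply: RintegralZl => //; exact: integrable_dominated. Qed.

(** For [y] near [x] the integrands are uniformly close on a given compact
    interval; outside of a large one, a single Cauchy factor of [wt] is
    already small. Hence the difference of the integrands is at most [d *
    cauchy t] for all [t]. *)
Lemma continuous_integral (T : topologicalType) (F : T -> R -> R) C :
  continuous (fun p : T * R => F p.1 p.2) ->
  (forall x t, `|F x t| <= C * wt t) ->
  continuous (fun x => \int[mu]_t F x t).
Proof.
move=> cF FC x.
have C0 : 0 <= C.
  by have := le_trans (normr_ge0 _) (FC x 0); rewrite pmulr_lge0// wt_gt0.
have cFx y : continuous (F y).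
  apply: (continuous2_comp cF); first by move=> ?; exact: cvg_cst.
  by move=> ?; exact: cvg_id.
apply/cvgrPdist_le => /= e e0.
pose d := e / (cauchy_mass + 1).
have m1 : 0 < cauchy_mass + 1 by rewrite ltr_wpDl// cauchy_mass_ge0.
have d0 : 0 < d by rewrite divr_gt0.
suff H : \forall y \near x, forall t, `|F x t - F y t| <= d * cauchy t.
  near=> y.
  rewrite -RintegralB//; last 2 first.
  - by apply: integrable_dominated; exact: dominated_wt (cFx x) (FC x).
  - by apply: integrable_dominated; exact: dominated_wt (cFx y) (FC y).
  have H1 : `|\int[mu]_t (F x t - F y t)| <= d * cauchy_mass.
    apply: norm_integral_le; last by near: y.
    by move=> t; apply: cvgB; exact: cFx.
  apply: (le_trans H1); rewrite /d mulrAC ler_pdivrMr// ler_pM2l//.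
  by rewrite lerDl.
pose B := 2 * C / d + 1.
have B'0 : 0 <= 2 * C / d by apply: divr_ge0; [rewrite mulr_ge0|exact: ltW].
have B0 : 0 < B by rewrite ltr_wpDl.
have cpt : compact `[- B, B] by exact: segment_compact.
have := (compact_near_coveringP `[- B, B]).1 cpt T (nbhs x)
  (fun y t => `|F x t - F y t| <= d * cauchy B).
have dB : 0 < d * cauchy B by rewrite mulr_gt0// cauchy_gt0.
move=> /(_ _) K.
have {}K : \forall y \near x,
   `[- B, B] `<=` (fun t => `|F x t - F y t| <= d * cauchy B).
  apply: K => t _.
  have h1 : (fun p : R * T => F x p.1 - F p.2 p.1) @ (t, x) --> F x t - F x t.
    apply: cvgB.
      by apply: (cvg_comp _ _ (@cvg_fst _ _ (nbhs t) (nbhs x) _)); exact: cFx.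
    apply: (@continuous2_cvg _ _ _ _ (nbhs (t, x)) _ snd fst F x t); first exact: (cF (x, t)).
      exact: cvg_snd.
    exact: cvg_fst.
  move: h1; rewrite subrr => /cvgr0Pnorm_le /(_ _ dB) h1.
  exact: h1.
near=> y => t.
have [tB|tB] := leP `|t| B.
  have : `|F x t - F y t| <= d * cauchy B.
    have Ky : `[- B, B] `<=` (fun t => `|F x t - F y t| <= d * cauchy B).
      by near: y.
    by apply: Ky; rewrite /= in_itv/= -ler_norml.
  move=> /le_trans; apply; rewrite ler_pM2l// lef_pV2 ?posrE ?onesqr_gt0//.
  by rewrite lerD2l -ler_sqrt ?sqr_ge0// !sqrtr_sqr (gtr0_norm B0).
apply: (@le_trans _ _ (2 * C * wt t)).
  apply: (le_trans (ler_normB _ _)).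
  by have := FC x t; have := FC y t; lra.
rewrite /wt mulrA ler_pM2r ?cauchy_gt0//.
rewrite ler_pdivrMr ?onesqr_gt0// (mulrC d) -ler_pdivrMr//.
have : B <= t ^+ 2.
  apply: (@le_trans _ _ `|t|); first exact: ltW.
  rewrite -real_normK ?num_real// expr2 ler_peMl//.
  apply: le_trans (ltW tB); by rewrite /B lerDr.
by rewrite /B; lra.
Unshelve. all: by end_near. Qed.

(** Rectangles with rational end points form a countable base of the plane, so
    the product sigma-algebra contains all the open sets. *)
Lemma measurable_open_prod (U : set (R * R)) : open U -> measurable U.
Proof.
move=> oU.
pose rect (q : rat * rat * (rat * rat)) : set (R * R) :=
  `]ratr q.1.1, ratr q.1.2[%classic `*` `]ratr q.2.1, ratr q.2.2[%classic.
rewrite (_ : U = \bigcup_(q in [set q | rect q `<=` U]) rect q); last first.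
  apply/seteqP; split=> [[s t] Ust|p [q /= qU]]; last exact: qU.
  have /= := oU _ Ust.
  rewrite -nbhs_ballE => -[e /= e0 eU].
  have [a1 /[!in_itv]/= /andP[a1l a1r]] : exists q : rat, ratr q \in `]s - e, s[.
    by apply: rat_in_itvoo; rewrite ltrBlDr ltrDl.
  have [a2 /[!in_itv]/= /andP[a2l a2r]] : exists q : rat, ratr q \in `]s, s + e[.
    by apply: rat_in_itvoo; rewrite ltrDl.
  have [b1 /[!in_itv]/= /andP[b1l b1r]] : exists q : rat, ratr q \in `]t - e, t[.
    by apply: rat_in_itvoo; rewrite ltrBlDr ltrDl.
  have [b2 /[!in_itv]/= /andP[b2l b2r]] : exists q : rat, ratr q \in `]t, t + e[.
    by apply: rat_in_itvoo; rewrite ltrDl.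
  exists ((a1, a2), (b1, b2)) => /=; last first.
    by rewrite /rect; split; rewrite /= in_itv/= ?a1r ?a2l ?b1r ?b2l.
  move=> [x y] [/= /[!in_itv]/= /andP[? ?] /andP[? ?]].
  apply: eU; split; rewrite /ball/= ltr_norml; lra.
rewrite bigcup_mkcond; apply: countable_bigcupT_measurable => [|q].
  exact: countableP.
case: ifPn => // _; apply: measurableX; exact: measurable_itv.
Qed.

Lemma measurable_continuous_prod (F : R * R -> R) : continuous F ->
  measurable_fun setT F.
Proof.
move=> /continuousP cF; apply: (measurability _ (RGenOpens.measurableE R)) => //.
move=> _ [_ [a [b ->] <-]]; rewrite setTI.
apply: measurable_open_prod; exact/cF/interval_open.
Qed.

Lemma integral_swap (F : R -> R -> R) C :
  continuous (fun p : R * R => F p.1 p.2) ->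
  (forall s t, `|F s t| <= C * (wt s * wt t)) ->
  \int[mu]_s \int[mu]_t F s t = \int[mu]_t \int[mu]_s F s t.
Proof.
move=> cF FC.
have C0 : 0 <= C.
  by have := le_trans (normr_ge0 _) (FC 0 0); rewrite pmulr_lge0// mulr_gt0// wt_gt0.
have cF1 s : continuous (F s).
  apply: (continuous2_comp cF); first by move=> ?; exact: cvg_cst.
  by move=> ?; exact: cvg_id.
have cF2 t : continuous (F^~ t).
  apply: (continuous2_comp cF); first by move=> ?; exact: cvg_id.
  by move=> ?; exact: cvg_cst.
have cG : continuous (fun p : R * R => F p.2 p.1).
  by apply: (continuous2_comp cF) => ?; [exact: cvg_snd|exact: cvg_fst].
have FCs s t : `|F s t| <= (C * wt s) * wt t by rewrite -mulrA; exact: FC.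
have FCt s t : `|F s t| <= (C * wt t) * wt s by rewrite mulrAC -mulrA; exact: FC.
have d1 s : dominated (F s) by apply: dominated_wt; [exact: cF1|exact: FCs].
have d2 t : dominated (F^~ t) by apply: dominated_wt; [exact: cF2|move=> s; exact: FCt].
have fin1 s : (\int[mu]_t (F s t)%:E = (\int[mu]_t F s t)%:E)%E.
  by rewrite /Rintegral fineK//; apply: integrable_fin_num => //; exact: integrable_dominated (d1 s).
have fin2 t : (\int[mu]_s (F s t)%:E = (\int[mu]_s F s t)%:E)%E.
  by rewrite /Rintegral fineK//; apply: integrable_fin_num => //; exact: integrable_dominated (d2 t).
have mF : measurable_fun [set: measurableTypeR R * measurableTypeR R] (EFin \o (fun p : R * R => F p.1 p.2)).
  by apply/measurable_EFinP; exact: measurable_continuous_prod.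
have intF : (mu \x mu)%E.-integrable setT (EFin \o (fun p : R * R => F p.1 p.2)).
  apply/(integrable12ltyP _ _ mF) => /=.
  apply: (@le_lt_trans _ _ (\int[mu]_s (C * cauchy_mass * cauchy s)%:E)%E); last first.
    by have /integrableP[_] := integrableZ_cauchy (C * cauchy_mass);
      under eq_integral do rewrite /= ger0_norm ?mulr_ge0// ?cauchy_mass_ge0// ?ltW// ?cauchy_gt0//.
  apply: ge0_le_integral => //=.
  - by move=> s _; apply: integral_ge0.
  - have /= := @measurable_fun_fubini_tonelli_F _ _ _ _ _ mu (abse \o (EFin \o (fun p : measurableTypeR R * measurableTypeR R => F p.1 p.2))).
    by apply => //; exact: measurableT_comp.
  - by apply/measurable_EFinP; have /integrableP[/measurable_EFinP] := integrableZ_cauchy (C * cauchy_mass).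
  - move=> s _.
    have H : dominated (fun t => `|F s t|).
      case: (d1 s) => cs [D Ds]; split; last by exists D => t; rewrite normr_id.
      by move=> t; apply: continuous_comp; [exact: cs|exact: norm_continuous].
    rewrite -[leLHS]fineK; last by apply: integrable_fin_num => //; exact: integrable_dominated H.
    rewrite lee_fin -/(Rintegral mu setT (fun t => `|F s t|)).
    apply: (le_trans (ler_norm _)).
    apply: (@le_trans _ _ (C * wt s * cauchy_mass)).
      by apply: norm_integral_wt; [exact: H.1|move=> t; rewrite normr_id; exact: FCs].
    by rewrite mulrAC ler_wpM2l ?wt_le_cauchy// mulr_ge0// cauchy_mass_ge0.
have := Fubini intF => /=.
under eq_integral do rewrite fin1.
under [in X in _ = X]eq_integral do rewrite fin2.
by rewrite /Rintegral => ->.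
Qed.

Lemma cauchy_affine (c a : R) : c != 0 ->
  exists K, forall t, cauchy (c * t + a) <= K * cauchy t.
Proof.
move=> c0; exists (1 + 2 * (1 + a ^+ 2) / c ^+ 2) => t.
have c2 : 0 < c ^+ 2 by rewrite exprn_even_gt0.
rewrite /cauchy ler_pdivlMr ?onesqr_gt0// mulrC ler_pdivrMr ?onesqr_gt0//.
set s := c * t + a; have -> : t = (s - a) / c by rewrite /s addrK mulrC mulKf.
rewrite expr_div_n -(ler_pM2r c2) mulrDl mul1r divfK ?gt_eqF//.
have -> : (1 + 2 * (1 + a ^+ 2) / c ^+ 2) * (1 + s ^+ 2) * c ^+ 2 =
    (c ^+ 2 + 2 * (1 + a ^+ 2)) * (1 + s ^+ 2) by field.
have h1 : 0 <= (s + a) ^+ 2 by exact: sqr_ge0.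
have h2 : 0 <= c ^+ 2 * s ^+ 2 by rewrite mulr_ge0 ?sqr_ge0.
have h3 : 0 <= a ^+ 2 * s ^+ 2 by rewrite mulr_ge0 ?sqr_ge0.
nra.
Qed.

Lemma integral_affine_ge0 f (c a : R) : 0 < c -> continuous f ->
  (forall t, 0 <= f t) ->
  (\int[mu]_t (f t)%:E = \int[mu]_t (c * f (c * t + a))%:E)%E.
Proof.
move=> c0 cf f0.
pose F t := c * t + a.
have dF (x : R) : is_derive x 1 F c.
  rewrite /F; apply: is_derive_eq.
  by rewrite addr0 /GRing.scale/= mulr1.
have F1 : (F^`())%classic = cst c by apply/funext => x; rewrite derive1E derive_val.
rewrite (@increasing_ge0_integration_by_substitutionT _ F f)//.
- by apply: eq_integral => t _; rewrite /= F1 /= mulrC.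
- by move=> x y xy; rewrite /F ltrD2r ltr_pM2l.
- by rewrite F1; exact: cst_continuous.
- by rewrite F1; exact: is_cvg_cst.
- by rewrite F1; exact: is_cvg_cst.
- apply/cvgrNyPle => A; near=> x.
  rewrite /F -lerBrDr mulrC -ler_pdivlMr//; near: x;
  exact: nbhs_ninfty_le.
- apply/cvgryPge => A; near=> x.
  rewrite /F -lerBlDr mulrC -ler_pdivrMr//; near: x;
  exact: nbhs_pinfty_ge.
Unshelve. all: by end_near. Qed.

Lemma integral_opp_ge0 f : continuous f -> (forall t, 0 <= f t) ->
  (\int[mu]_t (f t)%:E = \int[mu]_t (f (- t))%:E)%E.
Proof.
move=> cf f0.
have mN : measurable_fun setT (-%R : measurableTypeR R -> measurableTypeR R).
  by apply: continuous_measurable_fun; exact: opp_continuous.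
have := @ge0_integral_pushforward _ _ _ _ R _ mN mu setT (EFin \o f).
rewrite preimage_setT => <-//; last 2 first.
- by apply/measurable_EFinP; exact: continuous_measurable_fun.
- by move=> t _ /=; rewrite lee_fin.
by apply: eq_measure_integral => //= A mA _; exact/esym/lebesgue_measureN.
Qed.

Lemma dominated_affine f (c a : R) : c != 0 -> dominated f ->
  dominated (fun t => f (c * t + a)).
Proof.
move=> c0 [cf [C fC]]; split.
  move=> t; apply: continuous_comp; last exact: cf.
  by apply: cvgD; [apply: cvgM; [exact: cvg_cst|exact: cvg_id]|exact: cvg_cst].
have C0 : 0 <= C.
  by have := le_trans (normr_ge0 _) (fC 0); rewrite pmulr_lge0// cauchy_gt0.
have [K HK] := cauchy_affine a c0.
exists (C * K) => t; rewrite (le_trans (fC _))// -mulrA.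
by rewrite ler_wpM2l.
Qed.

(** Substitution in extended-real integrals of nonnegative functions, applied
    to a decomposition of [f] into a difference of two dominated nonnegative
    functions. *)
Lemma integral_affine f (c a : R) : c != 0 -> dominated f ->
  \int[mu]_t f (c * t + a) = `|c|^-1 * \int[mu]_t f t.
Proof.
move=> c0 df.
have H (g : R -> R) : continuous g -> (forall t, 0 <= g t) ->
    \int[mu]_t g (c * t + a) = `|c|^-1 * \int[mu]_t g t.
  move=> cg g0; rewrite /Rintegral.
  have cgc : continuous (fun t => g (c * t + a)).
    move=> t; apply: continuous_comp; last exact: cg.
    by apply: cvgD; [apply: cvgM; [exact: cvg_cst|exact: cvg_id]|exact: cvg_cst].
  have -> : (\int[mu]_t (g t)%:E = `|c|%:E * \int[mu]_t (g (c * t + a))%:E)%E.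
    rewrite -ge0_integralZl//=; last 2 first.
    - by apply/measurable_EFinP; exact: continuous_measurable_fun.
    - by move=> t _; rewrite lee_fin.
    have [c_gt0|c_le0] := ltP 0 c.
      by rewrite (gtr0_norm c_gt0) (integral_affine_ge0 a c_gt0).
    have c_lt0 : c < 0 by rewrite lt_neqAle c0.
    rewrite (ltr0_norm c_lt0) (@integral_affine_ge0 _ (- c) a) ?oppr_gt0//.
    rewrite integral_opp_ge0.
    + by apply: eq_integral => t _; rewrite mulrNN.
    + move=> t; apply: cvgM; first exact: cvg_cst.
      apply: continuous_comp; last exact: cg.
      by apply: cvgD; [apply: cvgM; [exact: cvg_cst|exact: cvg_id]|exact: cvg_cst].
    + by move=> t; rewrite mulr_ge0// oppr_ge0.
  case: (\int[mu]_t (g (c * t + a))%:E)%E => [r| |].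
  - by rewrite -EFinM /= mulKf// normr_eq0.
  - by rewrite mulr_infty/= gtr0_sg ?normr_gt0// mul1e mulr0.
  - by rewrite mulr_infty/= gtr0_sg ?normr_gt0// mul1e mulr0.
pose fp t := Num.max (f t) 0; pose fm t := fp t - f t.
have fE t : f t = fp t - fm t by rewrite /fm opprB addrC subrK.
have fple t : `|fp t| <= `|f t|.
  by rewrite /fp; case: (leP 0 (f t)) => ft; rewrite ?normr0.
have fp0 t : 0 <= fp t by rewrite /fp le_max lexx orbT.
have fm0 t : 0 <= fm t by rewrite /fm /fp subr_ge0 le_max lexx.
case: df => cf [C fC].
have cfp : continuous fp.
  by move=> t; apply: continuous_max; [exact: cf|exact: cst_continuous].
have cfm : continuous fm by move=> t; apply: cvgB; [exact: cfp|exact: cf].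
have fpC t : `|fp t| <= C * cauchy t by exact: le_trans (fC t).
have fmC t : `|fm t| <= (C + C) * cauchy t.
  by rewrite (le_trans (ler_normB _ _))// mulrDl lerD.
have dfp : dominated fp by split => //; exists C.
have dfm : dominated fm by split => //; exists (C + C).
have E (c' a' : R) : c' != 0 -> \int[mu]_t f (c' * t + a') =
    \int[mu]_t fp (c' * t + a') - \int[mu]_t fm (c' * t + a').
  move=> c'0; rewrite -RintegralB//; last 2 first.
  - exact/integrable_dominated/dominated_affine.
  - exact/integrable_dominated/dominated_affine.
  by apply: eq_Rintegral => t _; exact: fE.
have := E 1 0 (oner_neq0 _).
under eq_Rintegral do rewrite mul1r addr0.
under [in X in _ = X - _ -> _]eq_Rintegral do rewrite mul1r addr0.
under [in X in _ = _ - X -> _]eq_Rintegral do rewrite mul1r addr0.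
by move=> ->; rewrite E// mulrBr !H.
Qed.

End OneDim.

Ltac le_ring := rewrite le_eqVlt; apply/orP; left; apply/eqP; ring.

(** * Iterated integrals: continuity, Fubini, affine substitution *)

Section Continuity.
Context {S T U V : topologicalType}.

Lemma cts_fst : continuous (fun p : T * U => p.1).
Proof. by move=> p; exact: cvg_fst. Qed.

Lemma cts_snd : continuous (fun p : T * U => p.2).
Proof. by move=> p; exact: cvg_snd. Qed.

Lemma cts_cst (a : T) : continuous (fun _ : S => a).
Proof. by move=> p; exact: cvg_cst. Qed.

Lemma cts_id : continuous (fun x : S => x).
Proof. by move=> p; exact: cvg_id. Qed.

Lemma cts_comp (f : S -> T) (g : T -> U) :
  continuous f -> continuous g -> continuous (fun x => g (f x)).
Proof. by move=> cf cg x; apply: continuous_comp; [exact: cf|exact: cg]. Qed.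

End Continuity.

Section IteratedIntegral.
Context {R : realType}.
Local Notation mu := (@lebesgue_measure R).

Definition rV_cons n (t : R) (y : 'rV[R]_n) : 'rV[R]_n.+1 :=
  (row_mx t%:M y : 'rV[R]_(1 + n)).

Lemma rV_cons0 n t (y : 'rV[R]_n) : rV_cons t y 0 ord0 = t.
Proof.
rewrite (_ : ord0 = lshift n (ord0 : 'I_1)); last exact: val_inj.
by etransitivity; [exact: (row_mxEl (t%:M : 'M[R]_1) y 0 ord0)|rewrite mxE].
Qed.

Lemma rV_consS n t (y : 'rV[R]_n) i : rV_cons t y 0 (lift ord0 i) = y 0 i.
Proof.
rewrite (_ : lift ord0 i = rshift 1 i); last exact: val_inj.
exact: (row_mxEr (t%:M : 'M[R]_1) y 0 i).
Qed.

Lemma continuous_rV (T : topologicalType) n (f : T -> 'rV[R]_n) :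
  (forall i, continuous (fun x => f x 0 i)) -> continuous f.
Proof.
move=> cf x; apply/cvg_ballP => e e0.
have H : \forall y \near x, forall j : 'I_n, ball (f x 0 j) e (f y 0 j).
  by apply: filter_forall => j; have /cvg_ballP/(_ _ e0) := cf j x.
by apply: filterS H => y Hy; split => // i j; rewrite (ord1 i).
Qed.

Lemma continuous_rV_cons n : continuous (fun p : R * 'rV[R]_n => rV_cons p.1 p.2).
Proof.
apply: continuous_rV => i; have [j ->|->] := unliftP ord0 i.
  rewrite (_ : (fun _ => _) = (fun p : R * 'rV[R]_n => p.2 0 j)); last first.
    by apply/funext => p; rewrite rV_consS.
  apply: (@cts_comp _ _ _ snd (fun v : 'rV[R]_n => v 0 j) cts_snd).
  exact: coord_continuous.
rewrite (_ : (fun _ => _) = fst); last by apply/funext => p; rewrite rV_cons0.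
exact: cts_fst.
Qed.

Lemma continuous_slice n (f : 'rV[R]_n.+1 -> R) t : continuous f ->
  continuous (fun y => f (rV_cons t y)).
Proof.
move=> cf; apply: (cts_comp _ cf).
exact: (continuous2_comp (@continuous_rV_cons n) (@cts_cst _ _ t) cts_id).
Qed.

Definition wtn n (y : 'rV[R]_n) : R := \prod_(i < n) wt (y 0 i).

Lemma wtn_gt0 n (y : 'rV[R]_n) : 0 < wtn y.
Proof. by apply: prodr_gt0 => i _; exact: wt_gt0. Qed.

Lemma wtn_cons n t (y : 'rV[R]_n) : wtn (rV_cons t y) = wt t * wtn y.
Proof.
rewrite /wtn big_ord_recl rV_cons0; congr (_ * _).
by apply: eq_bigr => i _; rewrite rV_consS.
Qed.

Lemma wt_ge0 (t : R) : 0 <= wt t. Proof. exact/ltW/wt_gt0. Qed.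

Lemma wt_le1 (t : R) : wt t <= 1.
Proof. by rewrite (le_trans (wt_le_cauchy _))// cauchy_le1. Qed.

Lemma wtn_ge0 n (y : 'rV[R]_n) : 0 <= wtn y. Proof. exact/ltW/wtn_gt0. Qed.

Lemma wtn_le1 n (y : 'rV[R]_n) : wtn y <= 1.
Proof. by apply: prodr_ile1 => i _; rewrite wt_ge0 wt_le1. Qed.

Lemma le_shrink (C a b : R) : 0 <= C -> 0 <= b -> a <= 1 -> C * a * b <= C * b.
Proof. by move=> C0 b0 a1; rewrite ler_wpM2r// ler_piMr. Qed.

Definition dominated_n n (f : 'rV[R]_n -> R) :=
  continuous f /\ exists C, forall y, `|f y| <= C * wtn y.

Lemma wtn_coef_ge0 n (f : 'rV[R]_n -> R) C :
  (forall y, `|f y| <= C * wtn y) -> 0 <= C.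
Proof.
by move=> /(_ 0) /(le_trans (normr_ge0 _)); rewrite pmulr_lge0// wtn_gt0.
Qed.

(** The two parts need each other in the induction on the dimension: the outer
    integral is bounded only if the inner one is continuous, and the
    continuity of the outer one requires a uniform bound on the inner one. *)
Lemma continuous_integral_Rn_norm n :
  (forall (f : 'rV[R]_n -> R) C, continuous f -> (forall y, `|f y| <= C * wtn y) ->
    `|integral_Rn f| <= C * cauchy_mass ^+ n) /\
  (forall (T : topologicalType) (F : T -> 'rV[R]_n -> R) C,
    continuous (fun p : T * 'rV[R]_n => F p.1 p.2) ->
    (forall x y, `|F x y| <= C * wtn y) ->
    continuous (fun x => integral_Rn (F x))).
Proof.
elim: n => [|n [IHn IHc]]; split.
- by move=> f C _ /(_ 0); rewrite /wtn big_ord0 expr0.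
- move=> T F C cF _ /=.
  by apply: (continuous2_comp cF) => x; [exact: cvg_id|exact: cvg_cst].
- move=> f C cf fC /=.
  have C0 := wtn_coef_ge0 fC.
  have cfc : continuous (fun p : R * 'rV[R]_n => f (rV_cons p.1 p.2)).
    move=> p; apply: continuous_comp; last exact: cf.
    exact: continuous_rV_cons.
  have b t y : `|f (rV_cons t y)| <= C * wt t * wtn y.
    by rewrite -mulrA -wtn_cons.
  rewrite exprSr mulrA.
  apply: norm_integral_wt => [|t].
    apply: (IHc _ (fun t y => f (rV_cons t y)) C) => // t y.
    by rewrite (le_trans (b t y))// le_shrink ?wtn_ge0 ?wt_le1.
  rewrite mulrAC; apply: IHn => //.
  exact: continuous_slice.
  exact: b.
- move=> T F C cF FC /=.
  have C0 x := wtn_coef_ge0 (FC x).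
  pose G (p : T * R) (y : 'rV[R]_n) := F p.1 (rV_cons p.2 y).
  have cG : continuous (fun p : (T * R) * 'rV[R]_n => G p.1 p.2).
    apply: (continuous2_comp cF) => p.
      by apply: continuous_comp; [exact: cvg_fst|exact: cvg_fst].
    move: p; apply: (continuous2_comp (@continuous_rV_cons n)) => p.
      by apply: continuous_comp; [exact: cvg_fst|exact: cvg_snd].
    exact: cvg_snd.
  have b x t y : `|G (x, t) y| <= C * wt t * wtn y.
    by rewrite -mulrA -wtn_cons; exact: FC.
  apply: (@continuous_integral _ _ (fun x t => integral_Rn (G (x, t))) (C * cauchy_mass ^+ n)).
    rewrite (_ : (fun _ => _) = fun p => integral_Rn (G p)); last first.
      by apply/funext => -[x t].
    apply: (IHc _ G C) => // -[x t] y; rewrite (le_trans (b x t y))//.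
    by rewrite le_shrink ?(C0 x) ?wtn_ge0 ?wt_le1.
  move=> x t; rewrite mulrAC; apply: IHn => // y.
  exact: (continuous2_comp cG (@cts_cst _ _ (x, t)) cts_id).
Qed.

Lemma norm_integral_Rn n (f : 'rV[R]_n -> R) C : continuous f ->
  (forall y, `|f y| <= C * wtn y) -> `|integral_Rn f| <= C * cauchy_mass ^+ n.
Proof. exact: (continuous_integral_Rn_norm n).1. Qed.

Lemma continuous_integral_Rn n (T : topologicalType) (F : T -> 'rV[R]_n -> R) C :
  continuous (fun p : T * 'rV[R]_n => F p.1 p.2) ->
  (forall x y, `|F x y| <= C * wtn y) ->
  continuous (fun x => integral_Rn (F x)).
Proof. exact: (continuous_integral_Rn_norm n).2. Qed.

Lemma bound_slice n (f : 'rV[R]_n.+1 -> R) C : (forall y, `|f y| <= C * wtn y) ->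
  forall t y, `|f (rV_cons t y)| <= C * wt t * wtn y.
Proof. by move=> fC t y; rewrite -mulrA -wtn_cons. Qed.

Lemma dominated_slice n (f : 'rV[R]_n.+1 -> R) t : dominated_n f ->
  dominated_n (fun y => f (rV_cons t y)).
Proof.
move=> [cf [C fC]]; split; first exact: continuous_slice.
by exists (C * wt t) => y; exact: bound_slice.
Qed.

Lemma dominated_inner n (f : 'rV[R]_n.+1 -> R) : dominated_n f ->
  dominated (fun t => integral_Rn (fun y => f (rV_cons t y))).
Proof.
move=> [cf [C fC]].
have C0 := wtn_coef_ge0 fC.
apply: (@dominated_wt _ _ (C * cauchy_mass ^+ n)) => [|t].
  apply: (@continuous_integral_Rn _ _ _ C) => [|t y].
    move=> p; apply: continuous_comp; last exact: cf.
    exact: continuous_rV_cons.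
  by rewrite (le_trans (bound_slice fC t y))// le_shrink ?wtn_ge0 ?wt_le1.
rewrite mulrAC; apply: norm_integral_Rn; first exact: continuous_slice.
by move=> y; exact: bound_slice.
Qed.

Lemma integral_RnD n (f g : 'rV[R]_n -> R) : dominated_n f -> dominated_n g ->
  integral_Rn (fun y => f y + g y) = integral_Rn f + integral_Rn g.
Proof.
elim: n f g => // n IHn f g df dg /=.
under eq_Rintegral => t _ do
  rewrite (IHn _ _ (dominated_slice t df) (dominated_slice t dg)).
exact: (integralD_dom (dominated_inner df) (dominated_inner dg)).
Qed.

Lemma integral_RnZ n (c : R) (f : 'rV[R]_n -> R) : dominated_n f ->
  integral_Rn (fun y => c * f y) = c * integral_Rn f.
Proof.
elim: n f => // n IHn f df /=.
under eq_Rintegral => t _ do rewrite (IHn _ (dominated_slice t df)).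
exact: (integralZ_dom c (dominated_inner df)).
Qed.

Lemma integral_Rn_cat m n (f : 'rV[R]_(m + n) -> R) :
  integral_Rn f =
  integral_Rn (fun x : 'rV[R]_m => integral_Rn (fun y : 'rV[R]_n => f (row_mx x y))).
Proof.
elim: m f => [|m IHm] f /=.
  congr integral_Rn; apply/funext => y; congr f.
  apply/rowP => i; rewrite -[LHS](row_mxEr (0 : 'rV_0) y 0 i).
  by congr (row_mx _ _ 0 _); exact: val_inj.
apply: eq_Rintegral => t _; rewrite (IHm (fun x => f (rV_cons t x))).
congr integral_Rn; apply/funext => x; congr integral_Rn; apply/funext => y.
congr f; apply/rowP => i.
have [j ->|->] := unliftP ord0 (i : 'I_(m + n).+1).
  rewrite rV_consS; case: (split_ordP j) => k ->.
    rewrite row_mxEl (_ : lift _ _ = lshift n (lift ord0 k : 'I_m.+1)); last exact: val_inj.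
    by rewrite row_mxEl rV_consS.
  rewrite row_mxEr (_ : lift _ _ = rshift m.+1 k); last exact: val_inj.
  by rewrite row_mxEr.
rewrite rV_cons0 (_ : ord0 = lshift n (ord0 : 'I_m.+1)); last exact: val_inj.
by rewrite row_mxEl rV_cons0.
Qed.

Lemma integral_Rn_affine n (f : 'rV[R]_n -> R) (c : R) (a : 'rV[R]_n) :
  c != 0 -> dominated_n f ->
  integral_Rn (fun y => f (c *: y + a)) = (`|c|^-1) ^+ n * integral_Rn f.
Proof.
move=> c0; elim: n f a => [|n IHn] f a df.
  by rewrite expr0 mul1r /=; congr f; apply/rowP => -[].
rewrite /=.
pose a' : 'rV[R]_n := \row_i a 0 (lift ord0 i).
have E t y : c *: rV_cons t y + a = rV_cons (c * t + a 0 ord0) (c *: y + a').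
  apply/rowP => i; have [j ->|->] := unliftP ord0 i.
    by rewrite [LHS]mxE [X in X + _]mxE !rV_consS !mxE.
  by rewrite [LHS]mxE [X in X + _]mxE !rV_cons0.
under eq_Rintegral => t _.
  rewrite (_ : (fun _ => _) = fun y => f (rV_cons (c * t + a 0 ord0) (c *: y + a'))); last first.
    by apply/funext => y; rewrite -E.
  rewrite (IHn (fun y => f (rV_cons (c * t + a 0 ord0) y))); last exact: dominated_slice.
  over.
have dI := dominated_inner df.
rewrite integralZ_dom; last exact: dominated_affine dI.
by rewrite (integral_affine _ c0 dI) mulrA exprSr.
Qed.

Lemma integral_Rn_swap1 n (F : R -> 'rV[R]_n -> R) C :
  continuous (fun p : R * 'rV[R]_n => F p.1 p.2) ->
  (forall t y, `|F t y| <= C * (wt t * wtn y)) ->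
  \int[mu]_t integral_Rn (F t) = integral_Rn (fun y => \int[mu]_t F t y).
Proof.
elim: n F C => // n IHn F C cF FC /=.
have C0 : 0 <= C.
  by have := le_trans (normr_ge0 _) (FC 0 0); rewrite pmulr_lge0// mulr_gt0// ?wt_gt0// wtn_gt0.
pose G (p : R * R) (y : 'rV[R]_n) := F p.1 (rV_cons p.2 y).
have cG : continuous (fun p : (R * R) * 'rV[R]_n => G p.1 p.2).
  apply: (continuous2_comp cF) => p.
    by apply: continuous_comp; [exact: cvg_fst|exact: cvg_fst].
  move: p; apply: (continuous2_comp (@continuous_rV_cons n)) => p.
    by apply: continuous_comp; [exact: cvg_fst|exact: cvg_snd].
  exact: cvg_snd.
have b s t y : `|G (s, t) y| <= C * (wt s * wt t) * wtn y.
  by rewrite -mulrA -(mulrA (wt s)) -wtn_cons; exact: FC.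
rewrite (@integral_swap _ (fun s t => integral_Rn (G (s, t))) (C * cauchy_mass ^+ n)); last 2 first.
- rewrite (_ : (fun _ => _) = fun p => integral_Rn (G p)); last first.
    by apply/funext => -[x t].
  apply: (@continuous_integral_Rn _ _ G C) => // -[s t] y.
  by rewrite (le_trans (b s t y))// le_shrink ?wtn_ge0// mulr_ile1 ?wt_ge0 ?wt_le1.
- move=> s t; rewrite mulrAC; apply: norm_integral_Rn => // y.
  exact: (continuous2_comp cG (@cts_cst _ _ (s, t)) cts_id).
have IH (t : R) : \int[mu]_s integral_Rn (G (s, t)) =
    integral_Rn (fun y => \int[mu]_s G (s, t) y).
  apply: (IHn (fun s y => G (s, t) y) (C * wt t)).
    apply: (continuous2_comp cF cts_fst).
    exact: (continuous2_comp (@continuous_rV_cons n) (@cts_cst _ _ t) cts_snd).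
  move=> s y; rewrite (le_trans (b s t y))//.
  by le_ring.
by apply: eq_Rintegral => t _; exact: IH.
Qed.

(** Induction on [m], moving the first coordinate of [x] through the integral
    over [y] with [integral_Rn_swap1]. *)
Lemma integral_Rn_swap m n (F : 'rV[R]_m -> 'rV[R]_n -> R) C :
  continuous (fun p : 'rV[R]_m * 'rV[R]_n => F p.1 p.2) ->
  (forall x y, `|F x y| <= C * (wtn x * wtn y)) ->
  integral_Rn (fun x => integral_Rn (F x)) =
  integral_Rn (fun y => integral_Rn (F^~ y)).
Proof.
elim: m F C => // m IHm F C cF FC /=.
have C0 : 0 <= C.
  by have := le_trans (normr_ge0 _) (FC 0 0); rewrite pmulr_lge0// mulr_gt0// wtn_gt0.
have cF3 : continuous (fun q : (R * 'rV[R]_n) * 'rV[R]_m => F (rV_cons q.1.1 q.2) q.1.2).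
  apply: (continuous2_comp cF) => q.
    move: q; apply: (continuous2_comp (@continuous_rV_cons m)) => q.
      by apply: continuous_comp; [exact: cvg_fst|exact: cvg_fst].
    exact: cvg_snd.
  by apply: continuous_comp; [exact: cvg_fst|exact: cvg_snd].
have b t x y : `|F (rV_cons t x) y| <= C * wt t * (wtn x * wtn y).
  by rewrite mulrA -(mulrA C) -wtn_cons -mulrA; exact: FC.
under eq_Rintegral => t _.
  rewrite (IHm (fun x y => F (rV_cons t x) y) (C * wt t))//.
    over.
  apply: (continuous2_comp cF _ cts_snd).
  exact: (continuous2_comp (@continuous_rV_cons m) (@cts_cst _ _ t) cts_fst).
pose G t (y : 'rV[R]_n) := integral_Rn (fun x : 'rV[R]_m => F (rV_cons t x) y).
rewrite (@integral_Rn_swap1 _ G (C * cauchy_mass ^+ m))//.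
- rewrite (_ : (fun _ => _) = (fun p => integral_Rn (fun x : 'rV[R]_m => F (rV_cons p.1 x) p.2)))//.
  apply: (@continuous_integral_Rn _ _ (fun p x => F (rV_cons p.1 x) p.2) C) => // -[t y] x /=.
  rewrite (le_trans (b t x y))//.
  have -> : C * wt t * (wtn x * wtn y) = C * (wt t * wtn y) * wtn x by ring.
  by rewrite le_shrink ?wtn_ge0// mulr_ile1 ?wt_ge0 ?wt_le1 ?wtn_ge0 ?wtn_le1.
- move=> t y; rewrite mulrAC; apply: norm_integral_Rn.
    exact: (@continuous2_comp _ _ _ _ (fun q x => F (rV_cons q.1 x) q.2)
      _ _ cF3 (@cts_cst _ _ (t, y)) cts_id).
  move=> x; rewrite (le_trans (b t x y))//.
  by rewrite -!mulrA (mulrC (wtn y)).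
Qed.

End IteratedIntegral.

(** * Calculus of complex-valued functions *)

Local Open Scope complex_scope.
Local Notation Re := (@complex.Re _).
Local Notation Im := (@complex.Im _).
Local Notation normc := Normc.normc.

Section ComplexFacts.
Context {R : realType}.
Implicit Types x y z : R[i].

Lemma cReD x y : Re (x + y) = Re x + Re y. Proof. by case: x; case: y. Qed.
Lemma cImD x y : Im (x + y) = Im x + Im y. Proof. by case: x; case: y. Qed.
Lemma cReN x : Re (- x) = - Re x. Proof. by case: x. Qed.
Lemma cImN x : Im (- x) = - Im x. Proof. by case: x. Qed.
Lemma cReM x y : Re (x * y) = Re x * Re y - Im x * Im y.
Proof. by case: x; case: y. Qed.
Lemma cImM x y : Im (x * y) = Re x * Im y + Im x * Re y.
Proof. by case: x => a b; case: y => c d. Qed.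
Lemma eqC x y : Re x = Re y -> Im x = Im y -> x = y.
Proof. by case: x; case: y => a b c d /= -> ->. Qed.

Lemma normc_ge0 x : 0 <= normc x. Proof. by case: x => a b; exact: sqrtr_ge0. Qed.

Lemma normRe_le x : `|Re x| <= normc x.
Proof.
case: x => a b /=; rewrite -sqrtr_sqr; apply: ler_wsqrtr.
by rewrite lerDl sqr_ge0.
Qed.

Lemma normIm_le x : `|Im x| <= normc x.
Proof.
case: x => a b /=; rewrite -sqrtr_sqr; apply: ler_wsqrtr.
by rewrite lerDr sqr_ge0.
Qed.

Lemma normc_le x : normc x <= `|Re x| + `|Im x|.
Proof.
case: x => a b /=; rewrite -[leRHS]ger0_norm ?addr_ge0// -sqrtr_sqr.
apply: ler_wsqrtr; rewrite sqrrD !real_normK ?num_real//.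
by rewrite addrAC lerDl mulrn_wge0// mulr_ge0.
Qed.

Lemma normc_real (a : R) : normc a%:C = `|a|.
Proof. by rewrite /= expr0n /= addr0 sqrtr_sqr. Qed.

Lemma normc_expi (t : R) : normc (expi t) = 1.
Proof. by rewrite /= cos2Dsin2 sqrtr1. Qed.

Lemma expiD (s t : R) : expi (s + t) = expi s * expi t.
Proof. by apply: eqC; rewrite ?cReM ?cImM /= ?cosD ?sinD// addrC. Qed.

Lemma expi0 : expi 0 = 1 :> R[i].
Proof. by rewrite /expi cos0 sin0. Qed.

Lemma normc_sum (I : Type) (r : seq I) (F : I -> R[i]) :
  normc (\sum_(i <- r) F i) <= \sum_(i <- r) normc (F i).
Proof.
elim: r => [|i r IH]; first by rewrite !big_nil Normc.normc0.
by rewrite !big_cons (le_trans (le_normcD _ _))// lerD2l.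
Qed.

End ComplexFacts.

Section Derivatives.
Context {R : realType}.

Definition cdiff n (f : cfun R n) (x : 'rV[R]_n) :=
  differentiable (fun y => Re (f y)) x /\ differentiable (fun y => Im (f y)) x.

Definition cderive n (v : 'rV[R]_n) (f : cfun R n) : cfun R n :=
  fun x => 'D_v (fun y => Re (f y)) x +i* 'D_v (fun y => Im (f y)) x.

Definition cD n (i : 'I_n) (f : cfun R n) : cfun R n := cderive (delta_mx 0 i) f.

Lemma cpderivE n (s : seq 'I_n) (f : cfun R n) : cpderiv s f = foldr (@cD n) f s.
Proof.
apply/funext => x; elim: s x => [|i s IHs] x /=.
  by rewrite /cpderiv /=; case: (f x).
rewrite /cpderiv /=; congr (_ +i* _).
  congr ('D__ _ _); apply/funext => y; rewrite -IHs //.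
congr ('D__ _ _); apply/funext => y; rewrite -IHs //.
Qed.

Lemma derD n (f g : 'rV[R]_n -> R) v x : differentiable f x -> differentiable g x ->
  'D_v (fun y => f y + g y) x = 'D_v f x + 'D_v g x.
Proof.
by move=> df dg; apply: (@deriveD _ _ _ f g x v); exact: diff_derivable.
Qed.

Lemma derB n (f g : 'rV[R]_n -> R) v x : differentiable f x -> differentiable g x ->
  'D_v (fun y => f y - g y) x = 'D_v f x - 'D_v g x.
Proof.
by move=> df dg; apply: (@deriveB _ _ _ f g x v); exact: diff_derivable.
Qed.

Lemma derM n (f g : 'rV[R]_n -> R) v x : differentiable f x -> differentiable g x ->
  'D_v (fun y => f y * g y) x = 'D_v f x * g x + f x * 'D_v g x.
Proof.
move=> df dg; rewrite [LHS](@deriveM _ _ f g x v); [|exact: diff_derivable..].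
by rewrite /GRing.scale/= addrC; congr (_ + _); rewrite mulrC.
Qed.

Lemma difD n (f g : 'rV[R]_n -> R) x : differentiable f x -> differentiable g x ->
  differentiable (fun y => f y + g y) x.
Proof. exact: differentiableD. Qed.

Lemma difB n (f g : 'rV[R]_n -> R) x : differentiable f x -> differentiable g x ->
  differentiable (fun y => f y - g y) x.
Proof. exact: differentiableB. Qed.

Lemma difM n (f g : 'rV[R]_n -> R) x : differentiable f x -> differentiable g x ->
  differentiable (fun y => f y * g y) x.
Proof. exact: differentiableM. Qed.

Lemma cdiffD n (f g : cfun R n) x : cdiff f x -> cdiff g x ->
  cdiff (fun y => f y + g y) x.
Proof.
move=> [f1 f2] [g1 g2]; split.
  under eq_fun do rewrite cReD; exact: difD.
under eq_fun do rewrite cImD; exact: difD.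
Qed.

Lemma cdiffM n (f g : cfun R n) x : cdiff f x -> cdiff g x ->
  cdiff (fun y => f y * g y) x.
Proof.
move=> [f1 f2] [g1 g2]; split.
  under eq_fun do rewrite cReM.
  by apply: difB; apply: difM.
under eq_fun do rewrite cImM.
by apply: difD; apply: difM.
Qed.

Lemma cdiff_cst n (c : R[i]) x : cdiff (fun _ : 'rV[R]_n => c) x.
Proof. by split; exact: differentiable_cst. Qed.

Lemma cdiff_real n (q : 'rV[R]_n -> R) x : differentiable q x ->
  cdiff (fun y => (q y)%:C) x.
Proof. by move=> dq; split => //=; exact: differentiable_cst. Qed.

Lemma cdiff_sum n (I : Type) (r : seq I) (F : I -> cfun R n) x :
  (forall i, cdiff (F i) x) -> cdiff (fun y => \sum_(i <- r) F i y) x.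
Proof.
move=> dF; elim: r => [|i r IH].
  under eq_fun do rewrite big_nil; exact: cdiff_cst.
by under eq_fun do rewrite big_cons; exact: cdiffD.
Qed.

Lemma cderiveD n v (f g : cfun R n) x : cdiff f x -> cdiff g x ->
  cderive v (fun y => f y + g y) x = cderive v f x + cderive v g x.
Proof.
move=> [f1 f2] [g1 g2]; apply: eqC; rewrite ?cReD ?cImD /=.
  under eq_fun do rewrite cReD.
  exact: derD.
under eq_fun do rewrite cImD.
exact: derD.
Qed.

Lemma cderiveM n v (f g : cfun R n) x : cdiff f x -> cdiff g x ->
  cderive v (fun y => f y * g y) x = cderive v f x * g x + f x * cderive v g x.
Proof.
move=> [f1 f2] [g1 g2].
apply: eqC; rewrite ?cReD ?cImD ?cReM ?cImM /=.
  under eq_fun do rewrite cReM.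
  by rewrite derB ?derM//; [ring|exact: difM..].
under eq_fun do rewrite cImM.
by rewrite derD ?derM//; [ring|exact: difM..].
Qed.

Lemma cderive_cst n v (c : R[i]) (x : 'rV[R]_n) : cderive v (fun _ => c) x = 0.
Proof. by rewrite /cderive !derive_cst. Qed.

Lemma cderive_real n v (q : 'rV[R]_n -> R) x :
  cderive v (fun y => (q y)%:C) x = ('D_v q x)%:C.
Proof. by rewrite /cderive /= derive_cst. Qed.

Lemma cderiveZ n v (c : R[i]) (f : cfun R n) x : cdiff f x ->
  cderive v (fun y => c * f y) x = c * cderive v f x.
Proof.
move=> df; rewrite (@cderiveM _ v (fun=> c) f x (cdiff_cst c x) df).
by rewrite cderive_cst mul0r add0r.
Qed.

Lemma cderive_sum n v (I : Type) (r : seq I) (F : I -> cfun R n) x :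
  (forall i, cdiff (F i) x) ->
  cderive v (fun y => \sum_(i <- r) F i y) x = \sum_(i <- r) cderive v (F i) x.
Proof.
move=> dF; elim: r => [|i r IH].
  by under [in LHS]eq_fun do rewrite big_nil; rewrite cderive_cst big_nil.
under [in LHS]eq_fun do rewrite big_cons.
by rewrite cderiveD ?IH ?big_cons//; exact: cdiff_sum.
Qed.

Lemma derive_coord n (i : 'I_n) (v x : 'rV[R]_n) :
  'D_v (fun y : 'rV[R]_n => y 0 i) x = v 0 i.
Proof.
rewrite deriveE; last exact: differentiable_coord.
have @f : {linear 'rV[R]_n -> R}.
  by exists (fun N : 'rV[R]_n => N 0 i); do 2![eexists]; do ?[constructor];
     rewrite ?mxE// => ? *; rewrite ?mxE//; move=> ?; rewrite !mxE.
rewrite (_ : (fun _ => _) = f)// diff_lin//; exact: coord_continuous.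
Qed.

Lemma derive_dir n (f : 'rV[R]_n -> R) v x : differentiable f x ->
  'D_v f x = \sum_i v 0 i * 'D_(delta_mx 0 i) f x.
Proof.
move=> df; rewrite deriveE// {1}(row_sum_delta v) linear_sum.
by apply: eq_bigr => i _; rewrite linearZ /= deriveE.
Qed.

Lemma cderive_dir n (f : cfun R n) v x : cdiff f x ->
  cderive v f x = \sum_i (v 0 i)%:C * cD i f x.
Proof.
move=> [f1 f2]; rewrite /cderive !derive_dir//.
apply: eqC => /=.
  by rewrite (big_morph _ (@cReD R) (erefl _)); apply: eq_bigr => i _;
    rewrite cReM /= mul0r subr0.
by rewrite (big_morph _ (@cImD R) (erefl _)); apply: eq_bigr => i _;
  rewrite cImM /= mul0r addr0.
Qed.

End Derivatives.

(** * Schwartz functions and continuous operators on them *)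

Section Schwartz.
Context {R : realType}.

Definition cDs n (s : seq 'I_n) (f : cfun R n) : cfun R n := foldr (@cD R n) f s.

Lemma cDs_rcons n (s : seq 'I_n) i (f : cfun R n) :
  cDs (rcons s i) f = cDs s (cD i f).
Proof. by rewrite /cDs foldr_rcons. Qed.

Lemma weighted_derivE n N s (f : cfun R n) x :
  weighted_deriv N s f x = (1 + `|x|) ^+ N * normc (cDs s f x).
Proof. by rewrite /weighted_deriv cpderivE. Qed.

Lemma weighted_deriv_ge0 n N s (f : cfun R n) x : 0 <= weighted_deriv N s f x.
Proof. by rewrite mulr_ge0 ?normc_ge0// exprn_ge0// addr_ge0. Qed.

Lemma Re_cDs n s (f : cfun R n) :
  (fun y => Re (cDs s f y)) = pderiv s (fun y => Re (f y)).
Proof. by apply/funext => y; rewrite /cDs -cpderivE. Qed.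

Lemma Im_cDs n s (f : cfun R n) :
  (fun y => Im (cDs s f y)) = pderiv s (fun y => Im (f y)).
Proof. by apply/funext => y; rewrite /cDs -cpderivE. Qed.

Lemma schwartz_cdiff n (f : cfun R n) s x : schwartz f -> cdiff (cDs s f) x.
Proof. by case=> sR sI _; split; rewrite ?Re_cDs ?Im_cDs; [exact: sR|exact: sI]. Qed.

Lemma schwartz_cdiff0 n (f : cfun R n) x : schwartz f -> cdiff f x.
Proof. by move=> /(schwartz_cdiff [::] x). Qed.

Lemma schwartzI n (f : cfun R n) : (forall s x, cdiff (cDs s f) x) ->
  (forall N s, exists M, forall x, weighted_deriv N s f x <= M) -> schwartz f.
Proof.
move=> df bf; split => //.
  by move=> s x; rewrite -Re_cDs; have [] := df s x.
by move=> s x; rewrite -Im_cDs; have [] := df s x.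
Qed.

Lemma schwartz_cD n (f : cfun R n) i : schwartz f -> schwartz (cD i f).
Proof.
move=> sf; apply: schwartzI => [s x|N s].
  by rewrite -cDs_rcons; exact: schwartz_cdiff.
have [_ _ /(_ N (rcons s i)) [M HM]] := sf.
by exists M => x; have := HM x; rewrite !weighted_derivE cDs_rcons.
Qed.

Lemma norm_coord n (x : 'rV[R]_n) i : `|x 0 i| <= `|x|.
Proof.
rewrite [leRHS](mx_normrE x).
exact: (le_bigmax 0 (fun ij : 'I_1 * 'I_n => `|x ij.1 ij.2|) (0, i)).
Qed.

Lemma norm_le_sum n (x : 'rV[R]_n) : `|x| <= \sum_i `|x 0 i|.
Proof.
rewrite [leLHS](mx_normrE x); apply: bigmax_le => [|[i j] _ /=].
  by apply: sumr_ge0 => i _; exact: normr_ge0.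
by rewrite (ord1 i) (bigD1 j)//= lerDl; apply: sumr_ge0 => k _; exact: normr_ge0.
Qed.

Lemma onenorm_gt0 n (x : 'rV[R]_n) : 0 < 1 + `|x|.
Proof. by rewrite ltr_pwDl. Qed.

Lemma onenorm_ge1 n (x : 'rV[R]_n) : 1 <= 1 + `|x|.
Proof. by rewrite lerDl. Qed.

Definition cX n (i : 'I_n) (f : cfun R n) : cfun R n :=
  fun x => (x 0 i)%:C * f x.

(** One power of the weight is traded for multiplications by the coordinates;
    by induction, weighted bounds follow from plain bounds on functions
    multiplied by coordinates. *)
Lemma weight_succ n N (g : cfun R n) x :
  (1 + `|x|) ^+ N.+1 * normc (g x) <=
  (1 + `|x|) ^+ N * normc (g x) +
  \sum_i (1 + `|x|) ^+ N * normc (cX i g x).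
Proof.
rewrite exprSr mulrDr mulr1 mulrDl lerD2l -mulr_sumr -mulrA.
rewrite ler_wpM2l// ?exprn_ge0// ?addr_ge0//.
apply: le_trans (ler_wpM2r (normc_ge0 _) (norm_le_sum x)) _.
rewrite mulr_suml; apply: ler_sum => i _.
by rewrite /cX Normc.normcM normc_real.
Qed.

(** The weights of the seminorms are produced by multiplications by
    coordinates, and iterated derivatives stay in the class: only plain
    boundedness is left to check. *)
Lemma schwartz_family n (P : cfun R n -> Prop) :
  (forall f x, P f -> cdiff f x) ->
  (forall f i, P f -> P (cD i f)) ->
  (forall f i, P f -> P (cX i f)) ->
  (forall f, P f -> exists M, forall x, normc (f x) <= M) ->
  forall f, P f -> schwartz f.
Proof.
move=> Pd PD PX Pb f Pf.
have PDs s g : P g -> P (cDs s g) by move=> Pg; elim: s => // i s IH; exact: PD.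
apply: schwartzI => [s x|N s]; first exact/Pd/PDs.
suff : exists M, forall x, (1 + `|x|) ^+ N * normc (cDs s f x) <= M.
  by move=> [M HM]; exists M => x; rewrite weighted_derivE.
have {PDs Pf} := PDs s f Pf; move: (cDs s f) => g Pg.
elim: N g Pg => [|N IHN] g Pg.
  by have [M HM] := Pb _ Pg; exists M => x; rewrite expr0 mul1r.
have [M0 HM0] := IHN _ Pg.
have /fin_all_exists [M HM] : forall i, exists M, forall x,
    (1 + `|x|) ^+ N * normc (cX i g x) <= M.
  by move=> i; exact/IHN/PX.
exists (M0 + \sum_i M i) => x; rewrite (le_trans (weight_succ _ _ _))//.
by rewrite lerD// ler_sum.
Qed.

(** There are finitely many multi-indices of length at most [k]; the induction
    splits off the derivative that is taken first. *)
Lemma schwartz_norm_bounded n N k (f : cfun R n) : schwartz f ->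
  exists M, forall s x, (size s <= k)%N -> weighted_deriv N s f x <= M.
Proof.
elim: k f => [|k IHk] f sf.
  have [_ _ /(_ N [::]) [M HM]] := sf.
  by exists M => s x; rewrite leqn0 size_eq0 => /eqP ->.
have [_ _ /(_ N [::]) [M0 HM0]] := sf.
have /fin_all_exists [M HM] : forall i, exists M, forall s x, (size s <= k)%N ->
    weighted_deriv N s (cD i f) x <= M.
  by move=> i; apply: IHk; exact: schwartz_cD.
exists (`|M0| + \sum_i `|M i|) => s x; case/lastP: s => [|s i].
  move=> _; rewrite (le_trans (HM0 x))// (le_trans (ler_norm _))// lerDl.
  exact: sumr_ge0.
rewrite size_rcons ltnS => sk.
rewrite weighted_derivE cDs_rcons -weighted_derivE (le_trans (HM i s x sk))//.
rewrite (le_trans (ler_norm _))// (bigD1 i)//= addrCA lerDl addr_ge0//.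
exact: sumr_ge0.
Qed.

Lemma schwartz_norm_ub n N s (f : cfun R n) x : schwartz f -> (size s <= N)%N ->
  weighted_deriv N s f x <= schwartz_norm N f.
Proof.
move=> sf sN; apply: sup_upper_bound; last by exists s, x.
split; first by exists (weighted_deriv N s f x); exists s, x.
have [M HM] := schwartz_norm_bounded N N sf.
by exists M => _ [s' [x' [s'N ->]]]; exact: HM.
Qed.

Lemma schwartz_norm_le n N (f : cfun R n) M :
  (forall s x, (size s <= N)%N -> weighted_deriv N s f x <= M) ->
  schwartz_norm N f <= M.
Proof.
move=> HM; apply: ge_sup.
  by exists (weighted_deriv N [::] f 0); exists [::], 0.
by move=> _ [s' [x' [s'N ->]]]; exact: HM.
Qed.

Lemma schwartz_norm_ge0 n N (f : cfun R n) : schwartz f -> 0 <= schwartz_norm N f.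
Proof.
move=> sf; apply: le_trans (schwartz_norm_ub 0 sf (leq0n N : (size [::] <= N)%N)).
exact: weighted_deriv_ge0.
Qed.

Lemma weighted_deriv_mono n N N' s (f : cfun R n) x : (N <= N')%N ->
  weighted_deriv N s f x <= weighted_deriv N' s f x.
Proof.
by move=> NN'; rewrite ler_wpM2r ?normc_ge0// ler_weXn2l// onenorm_ge1.
Qed.

Lemma schwartz_norm_mono n N N' (f : cfun R n) : schwartz f -> (N <= N')%N ->
  schwartz_norm N f <= schwartz_norm N' f.
Proof.
move=> sf NN'; apply: schwartz_norm_le => s x sN.
apply: (le_trans (weighted_deriv_mono s f x NN')).
by apply: schwartz_norm_ub => //; exact: leq_trans NN'.
Qed.

(** The parameter [x] ranges over multi-indices, points, or pairs of these.
    Uniformity in [x] lets a supremum over [x] be bounded by a single seminorm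
    of [f]. *)
Definition seminorm_bounded n (X : Type) (P : X -> Prop) (q : cfun R n -> X -> R) :=
  exists N C, 0 <= C /\ forall f x, schwartz f -> P x -> q f x <= C * schwartz_norm N f.

Lemma seminorm_boundedD n X P (q1 q2 : cfun R n -> X -> R) :
  seminorm_bounded P q1 -> seminorm_bounded P q2 ->
  seminorm_bounded P (fun f x => q1 f x + q2 f x).
Proof.
move=> [N1 [C1 [C10 H1]]] [N2 [C2 [C20 H2]]]; exists (N1 + N2)%N, (C1 + C2).
split => [|f x sf Px]; first exact: addr_ge0.
rewrite mulrDl lerD//.
  rewrite (le_trans (H1 f x sf Px))// ler_wpM2l// schwartz_norm_mono// leq_addr//.
by rewrite (le_trans (H2 f x sf Px))// ler_wpM2l// schwartz_norm_mono// leq_addl.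
Qed.

Lemma seminorm_bounded0 n X (P : X -> Prop) :
  seminorm_bounded P (fun (f : cfun R n) x => 0).
Proof. by exists 0%N, 0; split => // f x _ _; rewrite mul0r. Qed.

Lemma seminorm_bounded_sum n X P (I : Type) (r : seq I) (q : I -> cfun R n -> X -> R) :
  (forall i, seminorm_bounded P (q i)) ->
  seminorm_bounded P (fun f x => \sum_(i <- r) q i f x).
Proof.
move=> Hq; elim: r => [|i r IH].
  have [N [C [C0 H]]] := @seminorm_bounded0 n X P.
  by exists N, C; split => // f x sf Px; rewrite big_nil; exact: H sf Px.
have [N [C [C0 H]]] := seminorm_boundedD (Hq i) IH.
by exists N, C; split => // f x sf Px; rewrite big_cons; exact: H.
Qed.

Lemma seminorm_bounded_le n X P (q1 q2 : cfun R n -> X -> R) :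
  (forall f x, schwartz f -> P x -> q1 f x <= q2 f x) ->
  seminorm_bounded P q2 -> seminorm_bounded P q1.
Proof.
move=> H12 [N [C [C0 H]]]; exists N, C; split => // f x sf Px.
exact: (le_trans (H12 f x sf Px) (H f x sf Px)).
Qed.

Definition schwartz_linear n m (T : cfun R n -> cfun R m) :=
  forall c f g, schwartz f -> schwartz g ->
    T (fun x => c * f x + g x) = (fun x => c * T f x + T g x).

Definition schwartz_continuous n m (T : cfun R n -> cfun R m) :=
  [/\ schwartz_linear T, forall f, schwartz f -> schwartz (T f) &
   forall N, seminorm_bounded (fun _ : unit => True) (fun f _ => schwartz_norm N (T f))].

(** As in [schwartz_family], stability under [cD] and [cX] reduces all the
    seminorm estimates to one sup bound for each operator of the family. *)
Lemma schwartz_op_family n m (F : (cfun R n -> cfun R m) -> Prop) :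
  (forall T, F T -> schwartz_linear T) ->
  (forall T f x, F T -> schwartz f -> cdiff (T f) x) ->
  (forall T i, F T -> exists2 T', F T' & forall f, schwartz f -> cD i (T f) = T' f) ->
  (forall T i, F T -> exists2 T', F T' & forall f, schwartz f -> cX i (T f) = T' f) ->
  (forall T, F T -> seminorm_bounded (fun=> True) (fun f x => normc (T f x))) ->
  forall T, F T -> schwartz_continuous T.
Proof.
move=> Fl Fd FD FX Fb T0 FT0.
have FS T f : F T -> schwartz f -> schwartz (T f).
  move=> FT sf.
  apply: (@schwartz_family _ (fun g => exists2 T, F T & exists2 f, schwartz f & g = T f)).
  - by move=> _ x [T' FT' [h sh ->]]; exact: Fd.
  - move=> _ i [T' FT' [h sh ->]]; have [T'' FT'' H] := FD _ i FT'.
    by exists T'' => //; exists h => //; exact: H.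
  - move=> _ i [T' FT' [h sh ->]]; have [T'' FT'' H] := FX _ i FT'.
    by exists T'' => //; exists h => //; exact: H.
  - move=> _ [T' FT' [h sh ->]]; have [N [C [C0 H]]] := Fb _ FT'.
    by exists (C * schwartz_norm N h) => x; exact: H.
  - by exists T => //; exists f.
have FN N : forall T, F T -> seminorm_bounded (fun=> True)
    (fun f x => (1 + `|x|) ^+ N * normc (T f x)).
  elim: N => [|N IHN] T FT.
    apply: seminorm_bounded_le (Fb _ FT) => f x sf _.
    by rewrite expr0 mul1r.
  apply: (seminorm_bounded_le (q2 := fun f x =>
    (1 + `|x|) ^+ N * normc (T f x) +
    \sum_i (1 + `|x|) ^+ N * normc (cX i (T f) x))).
    by move=> f x sf _; exact: weight_succ.
  apply: seminorm_boundedD; first exact: IHN.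
  apply: seminorm_bounded_sum => i; have [T' FT' H] := FX _ i FT.
  apply: seminorm_bounded_le (IHN _ FT') => f x sf _.
  by rewrite H.
have FNk N k : forall T, F T ->
    seminorm_bounded (fun sx : seq 'I_m * 'rV[R]_m => size sx.1 <= k)%N
    (fun f sx => weighted_deriv N sx.1 (T f) sx.2).
  elim: k => [|k IHk] T FT.
    have [M [C [C0 H]]] := FN N _ FT.
    exists M, C; split => // f [s x] sf /=; rewrite leqn0 size_eq0 => /eqP ->.
    by rewrite weighted_derivE; exact: H.
  have H (i : 'I_m) : seminorm_bounded (fun sx : seq 'I_m * 'rV[R]_m => size sx.1 <= k)%N
      (fun f sx => weighted_deriv N sx.1 (cD i (T f)) sx.2).
    have [T' FT' E] := FD _ i FT.
    by apply: seminorm_bounded_le (IHk _ FT') => f x sf _; rewrite E.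
  have [M0 [C0 [C00 H0]]] := FN N _ FT.
  have [M1 [C1 [C10 H1]]] := seminorm_bounded_sum (index_enum 'I_m) H.
  exists (M0 + M1)%N, (C0 + C1); split; first exact: addr_ge0.
  move=> f [s x] sf /=; case/lastP: s => [_|s i].
    rewrite weighted_derivE (le_trans (H0 f x sf _))//.
    rewrite ler_pM ?schwartz_norm_ge0 ?lerDl//.
    by rewrite schwartz_norm_mono// leq_addr.
  rewrite size_rcons ltnS => sk.
  rewrite weighted_derivE cDs_rcons -weighted_derivE.
  apply: (@le_trans _ _ (C1 * schwartz_norm M1 f)); last first.
    rewrite ler_pM ?schwartz_norm_ge0 ?lerDr//.
    by rewrite schwartz_norm_mono// leq_addl.
  apply: le_trans (H1 f (s, x) sf sk) => /=.
  rewrite (bigD1 i)//= lerDl sumr_ge0// => j _; exact: weighted_deriv_ge0.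
split; [exact: Fl|by move=> f; exact: FS|move=> N].
have [M [C [C0 H]]] := FNk N N _ FT0.
exists M, C; split => // f _ sf _; apply: schwartz_norm_le => s x sN.
exact: (H f (s, x) sf sN).
Qed.

End Schwartz.

(** * Derivatives, coordinates, affine pullbacks, chirps, tensor products *)

Section Operators.
Context {R : realType}.

Lemma cDs_lin n s (c : R[i]) (f g : cfun R n) : schwartz f -> schwartz g ->
  cDs s (fun x => c * f x + g x) = (fun x => c * cDs s f x + cDs s g x).
Proof.
move=> sf sg; elim: s => // i s IHs.
rewrite {1}/cDs /= -/(cDs s _) IHs; apply/funext => x.
rewrite /cD cderiveD ?cderiveZ//; try exact: schwartz_cdiff.
by apply: cdiffM; [exact: cdiff_cst|exact: schwartz_cdiff].
Qed.

Lemma weighted_deriv_lin n N s (c : R[i]) (f g : cfun R n) x :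
  schwartz f -> schwartz g ->
  weighted_deriv N s (fun x => c * f x + g x) x <=
  normc c * weighted_deriv N s f x + weighted_deriv N s g x.
Proof.
move=> sf sg; rewrite !weighted_derivE cDs_lin// mulrCA -mulrDr.
rewrite ler_wpM2l ?exprn_ge0 ?(ltW (onenorm_gt0 _))//.
by rewrite -Normc.normcM; exact: le_normcD.
Qed.

Lemma schwartz_lin n (c : R[i]) (f g : cfun R n) : schwartz f -> schwartz g ->
  schwartz (fun x => c * f x + g x).
Proof.
move=> sf sg; apply: schwartzI => [s x|N s].
  rewrite cDs_lin//; apply: cdiffD; last exact: schwartz_cdiff.
  by apply: cdiffM; [exact: cdiff_cst|exact: schwartz_cdiff].
have [_ _ /(_ N s) [M1 H1]] := sf; have [_ _ /(_ N s) [M2 H2]] := sg.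
exists (normc c * M1 + M2) => x; rewrite (le_trans (weighted_deriv_lin _ _ _ _ _ _))//.
by rewrite lerD// ler_wpM2l// normc_ge0.
Qed.

Lemma schwartz_norm_lin n N (c : R[i]) (f g : cfun R n) : schwartz f -> schwartz g ->
  schwartz_norm N (fun x => c * f x + g x) <=
  normc c * schwartz_norm N f + schwartz_norm N g.
Proof.
move=> sf sg; apply: schwartz_norm_le => s x sN.
rewrite (le_trans (weighted_deriv_lin _ _ _ _ _ _))//.
by rewrite lerD ?ler_wpM2l ?normc_ge0// schwartz_norm_ub.
Qed.

Lemma schwartz0 n : schwartz (fun _ : 'rV[R]_n => 0).
Proof.
apply: (@schwartz_family _ _ (fun f => f = (fun=> 0))) => //.
- by move=> f x ->; exact: cdiff_cst.
- by move=> f i ->; apply/funext => x; rewrite /cD cderive_cst.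
- by move=> f i ->; apply/funext => x; rewrite /cX mulr0.
- by move=> f ->; exists 0 => x; rewrite Normc.normc0.
Qed.

Lemma schwartzD n (f g : cfun R n) : schwartz f -> schwartz g ->
  schwartz (fun x => f x + g x).
Proof.
move=> sf sg; have := schwartz_lin 1 sf sg.
by under eq_fun do rewrite mul1r.
Qed.

Lemma schwartzZ n c (f : cfun R n) : schwartz f -> schwartz (fun x => c * f x).
Proof.
move=> sf; have := schwartz_lin c sf (schwartz0 n).
by under eq_fun do rewrite addr0.
Qed.

Lemma schwartz_sum n (I : Type) (r : seq I) (F : I -> cfun R n) :
  (forall i, schwartz (F i)) -> schwartz (fun x => \sum_(i <- r) F i x).
Proof.
move=> sF; elim: r => [|i r IH].
  by under eq_fun do rewrite big_nil; exact: schwartz0.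
by under eq_fun do rewrite big_cons; exact: schwartzD.
Qed.

Lemma schwartz_continuous_id n : schwartz_continuous (@id (cfun R n)).
Proof.
split => // N; exists N, 1; split => // f _ sf _; by rewrite mul1r.
Qed.

Lemma schwartz_continuous_comp n m p (T : cfun R n -> cfun R m) (S : cfun R m -> cfun R p) :
  schwartz_continuous T -> schwartz_continuous S ->
  schwartz_continuous (fun f => S (T f)).
Proof.
move=> [Tl TS TN] [Sl SS SN]; split.
- by move=> c f g sf sg; rewrite Tl// Sl//; exact: TS.
- by move=> f sf; exact/SS/TS.
- move=> N; have [N1 [C1 [C10 H1]]] := SN N; have [N2 [C2 [C20 H2]]] := TN N1.
  exists N2, (C1 * C2); split; first exact: mulr_ge0.
  move=> f x sf _; rewrite (le_trans (H1 _ tt (TS _ sf) _))//.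
  by rewrite -mulrA ler_wpM2l// (H2 _ tt).
Qed.

Lemma schwartz_continuous_lin n m c (T S : cfun R n -> cfun R m) :
  schwartz_continuous T -> schwartz_continuous S ->
  schwartz_continuous (fun f x => c * T f x + S f x).
Proof.
move=> [Tl TS TN] [Sl SS SN]; split.
- by move=> k f g sf sg; apply/funext => x; rewrite Tl// Sl//; ring.
- by move=> f sf; apply: schwartz_lin; [exact: TS|exact: SS].
- move=> N; have [N1 [C1 [C10 H1]]] := TN N; have [N2 [C2 [C20 H2]]] := SN N.
  have HT : seminorm_bounded (fun _ : unit => True)
      (fun (f : cfun R n) _ => normc c * schwartz_norm N (T f)).
    exists N1, (normc c * C1); split; first by rewrite mulr_ge0 ?normc_ge0.
    by move=> f x sf _; rewrite -mulrA ler_wpM2l ?normc_ge0// (H1 _ tt).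
  have HS : seminorm_bounded (fun _ : unit => True)
      (fun (f : cfun R n) _ => schwartz_norm N (S f)) by exists N2, C2.
  apply: seminorm_bounded_le (seminorm_boundedD HT HS) => f x sf _ /=.
  by apply: schwartz_norm_lin; [exact: TS|exact: SS].
Qed.

Lemma schwartz_continuous0 n m :
  schwartz_continuous (fun (f : cfun R n) (_ : 'rV[R]_m) => 0).
Proof.
split.
- by move=> c f g _ _; apply/funext => x; rewrite mulr0 addr0.
- by move=> f _; exact: schwartz0.
- move=> N; exists 0%N, 0; split => // f _ sf _; rewrite mul0r.
  apply: schwartz_norm_le => s x _; rewrite weighted_derivE.
  rewrite (_ : cDs s _ = fun=> 0) ?Normc.normc0 ?mulr0//.
  elim: s => // i s IH; rewrite {1}/cDs /= -/(cDs s _) IH.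
  by apply/funext => y; rewrite /cD cderive_cst.
Qed.

Lemma schwartz_continuousZ n m c (T : cfun R n -> cfun R m) :
  schwartz_continuous T -> schwartz_continuous (fun f x => c * T f x).
Proof.
move=> cT; have := schwartz_continuous_lin c cT (schwartz_continuous0 n m).
by under [X in schwartz_continuous X -> _]eq_fun do under eq_fun do rewrite addr0.
Qed.

Lemma schwartz_continuousD n m (T S : cfun R n -> cfun R m) :
  schwartz_continuous T -> schwartz_continuous S ->
  schwartz_continuous (fun f x => T f x + S f x).
Proof.
move=> cT cS; have := schwartz_continuous_lin 1 cT cS.
by under [X in schwartz_continuous X -> _]eq_fun do under eq_fun do rewrite mul1r.
Qed.

Lemma schwartz_continuous_sum n m (I : Type) (r : seq I)
    (T : I -> cfun R n -> cfun R m) : (forall i, schwartz_continuous (T i)) ->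
  schwartz_continuous (fun f x => \sum_(i <- r) T i f x).
Proof.
move=> cT; elim: r => [|i r IH].
  under [X in schwartz_continuous X]eq_fun do under eq_fun do rewrite big_nil.
  exact: schwartz_continuous0.
under [X in schwartz_continuous X]eq_fun do under eq_fun do rewrite big_cons.
exact: schwartz_continuousD.
Qed.

Lemma schwartz_continuous_cD n (i : 'I_n) : schwartz_continuous (@cD R n i).
Proof.
split.
- by move=> c f g sf sg; have := cDs_lin [:: i] c sf sg.
- by move=> f; exact: schwartz_cD.
- move=> N; exists N.+1, 1; split => // f _ sf _; rewrite mul1r.
  apply: schwartz_norm_le => s x sN; rewrite weighted_derivE -cDs_rcons -weighted_derivE.
  apply: (le_trans (weighted_deriv_mono _ f x (leqnSn N))).
  by apply: schwartz_norm_ub; rewrite ?size_rcons.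
Qed.

Lemma cdiff_coord n (i : 'I_n) (x : 'rV[R]_n) : cdiff (fun y => (y 0 i)%:C) x.
Proof. by apply: cdiff_real; exact: differentiable_coord. Qed.

(** Leibniz rule with a factor of degree one: each derivative contributes at
    most one extra term. The bound on the number of terms gives the constant
    of [cX_bound]. *)
Lemma cDs_cX n (i : 'I_n) (s : seq 'I_n) : exists l : seq (seq 'I_n),
  [/\ (size l <= size s)%N, forall s', s' \in l -> (size s' <= size s)%N &
   forall f : cfun R n, schwartz f -> cDs s (cX i f) =
     fun x => (x 0 i)%:C * cDs s f x + \sum_(s' <- l) cDs s' f x].
Proof.
elim: s => [|j s [l [ls lS E]]].
  by exists [::]; split => // f sf; apply/funext => x; rewrite big_nil addr0.
exists ((if i == j then [:: s] else [::]) ++ map (cons j) l); split.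
- by rewrite size_cat size_map /=; case: eqP => _ //=; exact: leqW.
- move=> s'; rewrite mem_cat => /orP[|/mapP[s'' s''l ->]]; last exact: lS.
  by case: eqP => // _; rewrite inE => /eqP -> /=; exact: leqnSn.
move=> f sf; rewrite {1}/cDs /= -/(cDs s _) E//; apply/funext => x.
have dl : cdiff (fun y => \sum_(s' <- l) cDs s' f y) x.
  by apply: cdiff_sum => s'; exact: schwartz_cdiff.
rewrite /cD cderiveD//; last by apply: cdiffM; [exact: cdiff_coord|exact: schwartz_cdiff].
rewrite cderiveM; [|exact: cdiff_coord|exact: schwartz_cdiff].
rewrite cderive_sum; last by move=> s'; exact: schwartz_cdiff.
rewrite cderive_real derive_coord mxE eqxx /= big_cat big_map /=.
rewrite [X in X + _]addrC -addrA; congr (_ + (_ + _)).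
by rewrite eq_sym; case: eqP => _; rewrite ?big_seq1 ?big_nil ?mul1r ?mul0r.
Qed.

Lemma cX_bound n N (i : 'I_n) s (f : cfun R n) x : schwartz f -> (size s <= N)%N ->
  weighted_deriv N s (cX i f) x <= N.+1%:R * schwartz_norm N.+1 f.
Proof.
move=> sf sN; have [l [ls lS E]] := cDs_cX i s.
rewrite weighted_derivE E//.
have w0 : 0 <= (1 + `|x|) ^+ N by rewrite exprn_ge0// (ltW (onenorm_gt0 _)).
rewrite (le_trans (ler_wpM2l w0 (le_normcD _ _)))// mulrDr.
rewrite -natr1 mulrDl mul1r [leRHS]addrC lerD//.
  rewrite Normc.normcM normc_real.
  apply: (@le_trans _ _ (weighted_deriv N.+1 s f x)); last first.
    by apply: schwartz_norm_ub => //; exact: leqW.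
  rewrite weighted_derivE exprSr -mulrA ler_wpM2l// ler_wpM2r ?normc_ge0//.
  by rewrite (le_trans (norm_coord _ _))// lerDr.
apply: (le_trans (ler_wpM2l w0 (normc_sum _ _))).
rewrite mulr_sumr; apply: (@le_trans _ _ (\sum_(s' <- l) schwartz_norm N.+1 f)).
  rewrite big_seq [leRHS]big_seq; apply: ler_sum => s' s'l.
  rewrite -weighted_derivE (le_trans (weighted_deriv_mono _ _ _ (leqnSn N)))//.
  apply: schwartz_norm_ub => //; apply: leqW; apply: leq_trans sN; exact: lS.
rewrite big_const_seq count_predT iter_addr_0 -[leLHS]mulr_natl.
apply: ler_wpM2r; first exact: schwartz_norm_ge0.
by rewrite ler_nat; exact: leq_trans sN.
Qed.

Lemma schwartz_continuous_cX n (i : 'I_n) : schwartz_continuous (@cX R n i).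
Proof.
split.
- by move=> c f g sf sg; apply/funext => x; rewrite /cX mulrDr mulrCA.
- move=> f sf; apply: schwartzI => [s x|N s].
    have [l [_ _ ->//]] := cDs_cX i s.
    apply: cdiffD; last by apply: cdiff_sum => s'; exact: schwartz_cdiff.
    by apply: cdiffM; [exact: cdiff_coord|exact: schwartz_cdiff].
  exists ((N + size s).+1%:R * schwartz_norm (N + size s).+1 f) => x.
  apply: (le_trans (weighted_deriv_mono _ _ _ (leq_addr (size s) N))).
  by apply: cX_bound => //; exact: leq_addl.
- move=> N; exists N.+1, N.+1%:R; split; first exact: ler0n.
  by move=> f _ sf _; apply: schwartz_norm_le => s x sN; exact: cX_bound.
Qed.

(** The operators [T \o L], with [L] continuous, form a family to which
    [schwartz_op_family] applies. *)
Lemma schwartz_continuous_intertwine n m (T : cfun R n -> cfun R m) :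
  schwartz_linear T ->
  (forall f x, schwartz f -> cdiff (T f) x) ->
  (forall i, exists2 L, schwartz_continuous L &
     forall f, schwartz f -> cD i (T f) = T (L f)) ->
  (forall i, exists2 L, schwartz_continuous L &
     forall f, schwartz f -> cX i (T f) = T (L f)) ->
  seminorm_bounded (fun=> True) (fun f x => normc (T f x)) ->
  schwartz_continuous T.
Proof.
move=> Tl Td TD TX Tb.
apply: (@schwartz_op_family _ _ _
  (fun S => exists2 L, schwartz_continuous L & S = fun f => T (L f))).
- by move=> _ [L [Ll LS _] ->] c f g sf sg; rewrite Ll// Tl//; exact: LS.
- by move=> _ f x [L [_ LS _] ->] sf; apply: Td; exact: LS.
- move=> _ i [L cL ->]; have [L' cL' E] := TD i.
  exists (fun f => T (L' (L f))).
    by exists (fun f => L' (L f)) => //; exact: schwartz_continuous_comp.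
  by move=> f sf; rewrite E//; case: cL => _ + _; apply.
- move=> _ i [L cL ->]; have [L' cL' E] := TX i.
  exists (fun f => T (L' (L f))).
    by exists (fun f => L' (L f)) => //; exact: schwartz_continuous_comp.
  by move=> f sf; rewrite E//; case: cL => _ + _; apply.
- move=> _ [L [Ll LS LN] ->]; have [N [C [C0 H]]] := Tb.
  have [N' [C' [C'0 H']]] := LN N.
  exists N', (C * C'); split; first exact: mulr_ge0.
  move=> f x sf _; rewrite (le_trans (H _ _ (LS _ sf) _))//.
  by rewrite -mulrA ler_wpM2l// (H' _ tt).
- by exists id; [exact: schwartz_continuous_id|].
Qed.

Definition affun n (l : 'rV[R]_n -> R) :=
  exists (w : 'I_n -> R) b, forall x, l x = \sum_k w k * x 0 k + b.

Lemma schwartz_continuous_affun n (l : 'rV[R]_n -> R) : affun l ->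
  schwartz_continuous (fun (f : cfun R n) x => (l x)%:C * f x).
Proof.
move=> [w [b E]].
rewrite (_ : (fun _ => _) = (fun (f : cfun R n) x =>
    (\sum_k (w k)%:C * cX k f x) + b%:C * f x)).
  apply: schwartz_continuousD; last first.
    exact/schwartz_continuousZ/schwartz_continuous_id.
  apply: schwartz_continuous_sum => k.
  exact/schwartz_continuousZ/schwartz_continuous_cX.
apply/funext => f; apply/funext => x; rewrite E rmorphD rmorph_sum mulrDl mulr_suml.
by congr (_ + _); apply: eq_bigr => k _; rewrite rmorphM -mulrA.
Qed.

Lemma affun_cst n (c : R) : affun (fun _ : 'rV[R]_n => c).
Proof.
exists (fun=> 0), c => x; rewrite big1 ?add0r// => k _.
by rewrite mul0r.
Qed.

Lemma affunD n (l1 l2 : 'rV[R]_n -> R) : affun l1 -> affun l2 ->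
  affun (fun x => l1 x + l2 x).
Proof.
move=> [w1 [b1 E1]] [w2 [b2 E2]]; exists (fun k => w1 k + w2 k), (b1 + b2) => x.
rewrite E1 E2 addrACA -big_split; congr (_ + _).
by apply: eq_bigr => k _; rewrite mulrDl.
Qed.

Lemma affunZ n (c : R) (l : 'rV[R]_n -> R) : affun l -> affun (fun x => c * l x).
Proof.
move=> [w [b E]]; exists (fun k => c * w k), (c * b) => x.
rewrite E mulrDr mulr_sumr; congr (_ + _).
by apply: eq_bigr => k _; rewrite mulrA.
Qed.

Lemma difsum n (I : Type) (r : seq I) (F : I -> 'rV[R]_n -> R) x :
  (forall i, differentiable (F i) x) ->
  differentiable (fun y => \sum_(i <- r) F i y) x.
Proof.
move=> dF; elim: r => [|i r IH].
  by under eq_fun do rewrite big_nil; exact: differentiable_cst.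
by under eq_fun do rewrite big_cons; exact: difD.
Qed.

Lemma dersum n v (I : Type) (r : seq I) (F : I -> 'rV[R]_n -> R) x :
  (forall i, differentiable (F i) x) ->
  'D_v (fun y => \sum_(i <- r) F i y) x = \sum_(i <- r) 'D_v (F i) x.
Proof.
move=> dF; elim: r => [|i r IH].
  by under [in LHS]eq_fun do rewrite big_nil; rewrite derive_cst big_nil.
under [in LHS]eq_fun do rewrite big_cons.
by rewrite derD ?IH ?big_cons//; exact: difsum.
Qed.

Lemma differentiable_affun n (l : 'rV[R]_n -> R) x : affun l -> differentiable l x.
Proof.
move=> [w [b E]]; rewrite (_ : l = fun x => \sum_k w k * x 0 k + b); last exact/funext.
apply: difD; last exact: differentiable_cst.
apply: difsum => k; apply: difM; first exact: differentiable_cst.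
exact: differentiable_coord.
Qed.

Lemma derive_affun n (l : 'rV[R]_n -> R) v : affun l ->
  exists c, forall x, 'D_v l x = c.
Proof.
move=> [w [b E]]; exists (\sum_k w k * v 0 k) => x.
rewrite (_ : l = fun x => \sum_k w k * x 0 k + b); last exact/funext.
have dk k : differentiable (fun y : 'rV[R]_n => w k * y 0 k) x.
  apply: difM; first exact: differentiable_cst.
  exact: differentiable_coord.
etransitivity.
  exact: (derD v (difsum (index_enum _) dk) (differentiable_cst b x)).
rewrite derive_cst addr0 dersum//; apply: eq_bigr => k _.
rewrite derM ?derive_cst ?mul0r ?add0r ?derive_coord//.
exact: differentiable_coord.
Qed.

(** Quadratic phases, through the property that matters: a derivative of the
    chirp multiplies it by an affine function. *)
Definition quad n (q : 'rV[R]_n -> R) :=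
  (forall x, differentiable q x) /\ forall i, affun (fun x => 'D_(delta_mx 0 i) q x).

Lemma quadM n (l1 l2 : 'rV[R]_n -> R) : affun l1 -> affun l2 ->
  quad (fun x => l1 x * l2 x).
Proof.
move=> a1 a2; split => [x|i].
  by apply: difM; exact: differentiable_affun.
have [c1 E1] := derive_affun (delta_mx 0 i) a1.
have [c2 E2] := derive_affun (delta_mx 0 i) a2.
under eq_fun => x do rewrite (derM _ (differentiable_affun x a1) (differentiable_affun x a2)) E1 E2.
apply: affunD; first exact: affunZ.
by under eq_fun do rewrite mulrC; exact: affunZ.
Qed.

Lemma quadD n (q1 q2 : 'rV[R]_n -> R) : quad q1 -> quad q2 ->
  quad (fun x => q1 x + q2 x).
Proof.
move=> [d1 a1] [d2 a2]; split => [x|i]; first exact: difD.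
by under eq_fun => x do rewrite (derD _ (d1 x) (d2 x)); exact: affunD.
Qed.

Lemma quad_cst n (c : R) : quad (fun _ : 'rV[R]_n => c).
Proof.
split => [x|i]; first exact: differentiable_cst.
by under eq_fun do rewrite derive_cst; exact: affun_cst.
Qed.

Lemma quadZ n (c : R) (q : 'rV[R]_n -> R) : quad q -> quad (fun x => c * q x).
Proof.
move=> [d a]; split => [x|i].
  by apply: difM; [exact: differentiable_cst|exact: d].
under eq_fun => x do rewrite (derM _ (differentiable_cst c x) (d x)) derive_cst mul0r add0r.
exact: affunZ.
Qed.

Lemma quad_sum n (I : Type) (r : seq I) (F : I -> 'rV[R]_n -> R) :
  (forall i, quad (F i)) -> quad (fun y => \sum_(i <- r) F i y).
Proof.
move=> dF; elim: r => [|i r IH].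
  by under eq_fun do rewrite big_nil; exact: quad_cst.
by under eq_fun do rewrite big_cons; exact: quadD.
Qed.

Definition affmap n m (B : 'rV[R]_n -> 'rV[R]_m) :=
  exists M b, forall x, B x = x *m M + b.

Lemma affmap_coord n m (B : 'rV[R]_n -> 'rV[R]_m) k : affmap B ->
  affun (fun x => B x 0 k).
Proof.
move=> [M [b E]]; exists (fun j => M j k), (b 0 k) => x.
rewrite E !mxE; congr (_ + _); apply: eq_bigr => j _; exact: mulrC.
Qed.

Lemma affmap_id n : affmap (fun x : 'rV[R]_n => x).
Proof. by exists 1%:M, 0 => x; rewrite mulmx1 addr0. Qed.

Lemma affmap_cst n m (b : 'rV[R]_m) : affmap (fun x : 'rV[R]_n => b).
Proof. by exists 0, b => x; rewrite mulmx0 add0r. Qed.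

Lemma affmapD n m (A B : 'rV[R]_n -> 'rV[R]_m) : affmap A -> affmap B ->
  affmap (fun x => A x + B x).
Proof.
move=> [M [b E]] [M' [b' E']]; exists (M + M'), (b + b') => x.
by rewrite E E' mulmxDr addrACA.
Qed.

Lemma affmapZ n m c (A : 'rV[R]_n -> 'rV[R]_m) : affmap A ->
  affmap (fun x => c *: A x).
Proof.
by move=> [M [b E]]; exists (c *: M), (c *: b) => x; rewrite E scalerDr scalemxAr.
Qed.

Lemma affmapN n m (A : 'rV[R]_n -> 'rV[R]_m) : affmap A -> affmap (fun x => - A x).
Proof.
by move=> [M [b E]]; exists (- M), (- b) => x; rewrite E mulmxN opprD.
Qed.

Lemma affmap_row n m p (A : 'rV[R]_n -> 'rV[R]_m) (B : 'rV[R]_n -> 'rV[R]_p) :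
  affmap A -> affmap B -> affmap (fun x => row_mx (A x) (B x)).
Proof.
move=> [M [b E]] [M' [b' E']]; exists (row_mx M M'), (row_mx b b') => x.
by rewrite E E' mul_mx_row add_row_mx.
Qed.

Lemma affmap_lsub n m p (A : 'rV[R]_n -> 'rV[R]_(m + p)) : affmap A ->
  affmap (fun x => lsubmx (A x)).
Proof.
move=> [M [b E]]; exists (lsubmx M), (lsubmx b) => x.
by rewrite E linearD mulmx_lsub.
Qed.

Lemma affmap_rsub n m p (A : 'rV[R]_n -> 'rV[R]_(m + p)) : affmap A ->
  affmap (fun x => rsubmx (A x)).
Proof.
move=> [M [b E]]; exists (rsubmx M), (rsubmx b) => x.
by rewrite E linearD mulmx_rsub.
Qed.

Lemma quad_dotp n m (A B : 'rV[R]_n -> 'rV[R]_m) : affmap A -> affmap B ->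
  quad (fun x => dotp (A x) (B x)).
Proof.
move=> aA aB; apply: quad_sum => k.
by apply: quadM; exact: affmap_coord.
Qed.

Lemma continuous_mulmxr n m (M : 'M[R]_(n, m)) : continuous (mulmxr M : 'rV[R]_n -> 'rV[R]_m).
Proof.
apply: continuous_rV => i x.
apply: (@differentiable_continuous _ _ _ x (fun x : 'rV[R]_n => mulmxr M x 0 i)).
rewrite (_ : (fun _ => _) = fun x : 'rV[R]_n => \sum_k x 0 k * M k i); last first.
  by apply/funext => y; rewrite mxE.
apply: difsum => k; apply: difM; last exact: differentiable_cst.
exact: differentiable_coord.
Qed.

Lemma differentiable_pull n m (f : 'rV[R]_m -> R) (M : 'M[R]_(n, m)) b x :
  differentiable f (x *m M + b) -> differentiable (fun y => f (y *m M + b)) x.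
Proof.
move=> df; apply: (@differentiable_comp _ _ _ _ (fun y : 'rV[R]_n => y *m M + b) f) => //.
apply: (@differentiableD _ _ _ (mulmxr M) (cst b)); last exact: differentiable_cst.
by apply: linear_differentiable; exact: continuous_mulmxr.
Qed.

Lemma cdiff_pull n m (B : 'rV[R]_n -> 'rV[R]_m) (f : cfun R m) x :
  affmap B -> cdiff f (B x) -> cdiff (fun y => f (B y)) x.
Proof.
move=> [M [b E]]; rewrite E => -[f1 f2]; split; under eq_fun do rewrite E.
  exact: (differentiable_pull f1).
exact: (differentiable_pull f2).
Qed.

(** Directional derivatives depend only on difference quotients, which relates
    functions defined on different spaces. *)
Lemma eq_derive_quotient (V W : normedModType R) (f : V -> R) (g : W -> R) v w x y :
  (forall h : R, f (h *: v + x) - f x = g (h *: w + y) - g y) ->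
  'D_v f x = 'D_w g y.
Proof.
move=> E; rewrite /derive.
have -> : (fun h : R => h^-1 *: ((f \o shift x) (h *: v) - f x)) =
    (fun h : R => h^-1 *: ((g \o shift y) (h *: w) - g y)); last by [].
by apply/funext => h; rewrite /= E.
Qed.

Lemma derive_pull n m (f : 'rV[R]_m -> R) (M : 'M[R]_(n, m)) b v x :
  'D_v (fun y => f (y *m M + b)) x = 'D_(v *m M) f (x *m M + b).
Proof.
by apply: eq_derive_quotient => h; rewrite mulmxDl -scalemxAl addrA.
Qed.

Definition pull n m (B : 'rV[R]_n -> 'rV[R]_m) (f : cfun R m) : cfun R n :=
  fun x => f (B x).

(** The left inverse [B'] writes the coordinates of [x] as affine functions of
    [B x], which transfers the decay of [f] to the pullback. Slices and
    restrictions to affine subspaces are instances. *)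
Lemma schwartz_continuous_pull n m (B : 'rV[R]_n -> 'rV[R]_m) (B' : 'rV[R]_m -> 'rV[R]_n) :
  affmap B -> affmap B' -> cancel B B' -> schwartz_continuous (pull B).
Proof.
move=> aB aB' BK; have cdp f x : schwartz f -> cdiff (pull B f) x.
  by move=> sf; apply: cdiff_pull => //; exact: schwartz_cdiff0.
have [M [b E]] := aB; have {aB} EB : B = fun x => x *m M + b by exact/funext.
rewrite EB in cdp *.
apply: schwartz_continuous_intertwine => //.
- move=> i; exists (fun f x => \sum_k (M i k)%:C * cD k f x).
    apply: schwartz_continuous_sum => k.
    exact/schwartz_continuousZ/schwartz_continuous_cD.
  move=> f sf; apply/funext => x; rewrite /pull.
  transitivity (cderive (delta_mx 0 i *m M) f (x *m M + b)).
    by rewrite /cD /cderive; congr (_ +i* _); exact: derive_pull.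
  rewrite cderive_dir; last exact: schwartz_cdiff0.
  by apply: eq_bigr => k _; rewrite -rowE mxE.
- move=> i; exists (fun f x => (B' x 0 i)%:C * f x).
    exact/schwartz_continuous_affun/affmap_coord.
  by move=> f sf; apply/funext => x; rewrite /cX /pull -E BK.
- exists 0%N, 1; split => // f x sf _; rewrite mul1r.
  apply: le_trans (schwartz_norm_ub (x *m M + b) sf (leq0n 0 : (size [::] <= 0)%N)).
  by rewrite weighted_derivE expr0 mul1r.
Qed.

Lemma schwartz_pull n m (B : 'rV[R]_n -> 'rV[R]_m) (B' : 'rV[R]_m -> 'rV[R]_n) f :
  affmap B -> affmap B' -> cancel B B' -> schwartz f -> schwartz (fun x => f (B x)).
Proof. by move=> aB aB' BK; have [_ + _] := schwartz_continuous_pull aB aB' BK; exact. Qed.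

Lemma schwartz_translate n (f : cfun R n) a : schwartz f -> schwartz (fun x => f (x + a)).
Proof.
apply: (@schwartz_pull _ _ (fun x => x + a) (fun x => x - a)).
- by apply: affmapD; [exact: affmap_id|exact: affmap_cst].
- by apply: affmapD; [exact: affmap_id|exact: affmap_cst].
- by move=> x; rewrite addrK.
Qed.

Lemma schwartz_dilate n (f : cfun R n) (e : R) : e != 0 -> schwartz f ->
  schwartz (fun x => f (e *: x)).
Proof.
move=> e0; apply: (@schwartz_pull _ _ ( *:%R e) ( *:%R e^-1)).
- by apply: affmapZ; exact: affmap_id.
- by apply: affmapZ; exact: affmap_id.
- by move=> x; rewrite scalerA mulVf ?scale1r.
Qed.

Lemma derive_chain n (g g' : R -> R) (q : 'rV[R]_n -> R) (v x : 'rV[R]_n) :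
  (forall t : R, is_derive t (1 : R) g (g' t)) -> differentiable q x ->
  differentiable (fun y => g (q y)) x /\ 'D_v (fun y => g (q y)) x = g' (q x) * 'D_v q x.
Proof.
move=> dg dq.
have dgq : differentiable g (q x) by apply/derivable1_diffP; exact: (@ex_derive _ _ _ _ _ _ _ (dg _)).
have dc : differentiable (fun y => g (q y)) x by exact: (@differentiable_comp _ _ _ _ q g).
split => //; rewrite deriveE// (@diff_comp _ _ _ _ q g)//= deriv1E; last first.
  exact: (@ex_derive _ _ _ _ _ _ _ (dg _)).
rewrite derive1E (@derive_val _ _ _ _ _ _ _ (dg _)) deriveE//.
by rewrite /GRing.scale /= mulrC.
Qed.

Definition chirp n (q : 'rV[R]_n -> R) (f : cfun R n) : cfun R n :=
  fun x => expi (q x) * f x.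

Lemma cdiff_expi n (q : 'rV[R]_n -> R) x : differentiable q x ->
  cdiff (fun y => expi (q y)) x.
Proof.
move=> dq; split => /=.
  by have [] := derive_chain 0 (@is_derive_cos R) dq.
by have [] := derive_chain 0 (@is_derive_sin R) dq.
Qed.

Lemma cderive_expi n v (q : 'rV[R]_n -> R) x : differentiable q x ->
  cderive v (fun y => expi (q y)) x = (0 +i* 'D_v q x) * expi (q x).
Proof.
move=> dq; rewrite /cderive /=.
have [_ ->] := derive_chain v (@is_derive_cos R) dq.
have [_ ->] := derive_chain v (@is_derive_sin R) dq.
have E (a c s : R) : - s * a +i* (c * a) = (0 +i* a) * (c +i* s).
  by apply/eqP; rewrite eq_complex /=; apply/andP; split; apply/eqP; ring.
exact: E.
Qed.

Lemma cD_chirp n (q : 'rV[R]_n -> R) (f : cfun R n) i x : differentiable q x -> cdiff f x ->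
  cD i (chirp q f) x =
  expi (q x) * (('D_(delta_mx 0 i) q x)%:C * ('i * f x) + cD i f x).
Proof.
move=> dq df; rewrite /cD cderiveM//; last exact: cdiff_expi.
rewrite cderive_expi// mulrDr; congr (_ + _).
have E (a : R) : 0 +i* a = a%:C * 'i.
  by apply/eqP; rewrite eq_complex /=; apply/andP; split; apply/eqP; ring.
by rewrite E; ring.
Qed.

Lemma schwartz_continuous_chirp n (q : 'rV[R]_n -> R) : quad q ->
  schwartz_continuous (chirp q).
Proof.
move=> [dq aq]; apply: schwartz_continuous_intertwine.
- by move=> c f g _ _; apply/funext => x; rewrite /chirp; ring.
- move=> f x sf; apply: cdiffM; [exact: cdiff_expi|exact: schwartz_cdiff0].
- move=> i; exists (fun f x => ('D_(delta_mx 0 i) q x)%:C * ('i * f x) + cD i f x).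
    apply: schwartz_continuousD; last exact: schwartz_continuous_cD.
    apply: (schwartz_continuous_comp (T := fun (f : cfun R n) x => 'i * f x)
      (S := fun (f : cfun R n) x => ('D_(delta_mx 0 i) q x)%:C * f x)).
      exact/schwartz_continuousZ/schwartz_continuous_id.
    exact: schwartz_continuous_affun.
  by move=> f sf; apply/funext => x; rewrite cD_chirp//; exact: schwartz_cdiff0.
- move=> i; exists (@cX R n i); first exact: schwartz_continuous_cX.
  by move=> f sf; apply/funext => x; rewrite /cX /chirp; ring.
- exists 0%N, 1; split => // f x sf _; rewrite mul1r Normc.normcM normc_expi mul1r.
  apply: le_trans (schwartz_norm_ub x sf (leq0n 0 : (size [::] <= 0)%N)).
  by rewrite weighted_derivE expr0 mul1r.
Qed.

Lemma schwartz_chirp n (q : 'rV[R]_n -> R) f : quad q -> schwartz f ->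
  schwartz (fun x => expi (q x) * f x).
Proof. by move=> /schwartz_continuous_chirp[_ + _]; exact. Qed.

Lemma schwartz_bounded n (f : cfun R n) : schwartz f ->
  exists M, forall x, normc (f x) <= M.
Proof.
move=> [_ _ /(_ 0%N [::])[M HM]]; exists M => x.
by have := HM x; rewrite weighted_derivE expr0 mul1r.
Qed.

Definition ctensor n m (f : cfun R n) (g : cfun R m) : cfun R (n + m) :=
  fun z => f (lsubmx z) * g (rsubmx z).

Lemma derive_lsub n m (f : 'rV[R]_n -> R) v (z : 'rV[R]_(n + m)) :
  'D_v (fun z : 'rV[R]_(n + m) => f (lsubmx z)) z = 'D_(lsubmx v) f (lsubmx z).
Proof.
by apply: eq_derive_quotient => h; rewrite linearD linearZ.
Qed.

Lemma derive_rsub n m (f : 'rV[R]_m -> R) v (z : 'rV[R]_(n + m)) :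
  'D_v (fun z : 'rV[R]_(n + m) => f (rsubmx z)) z = 'D_(rsubmx v) f (rsubmx z).
Proof.
by apply: eq_derive_quotient => h; rewrite linearD linearZ.
Qed.

(** Each coordinate belongs to one of the two factors, so that tensor products
    form a class stable under derivatives and coordinate multiplications. *)
Lemma schwartz_tensor n m (f : cfun R n) (g : cfun R m) :
  schwartz f -> schwartz g -> schwartz (ctensor f g).
Proof.
move=> sf sg; apply: (@schwartz_family _ _ (fun h => exists f g,
  [/\ schwartz f, schwartz g & h = ctensor f g])); last by exists f, g.
- move=> _ x [f' [g' [sf' sg' ->]]]; apply: cdiffM.
    exact: (cdiff_pull (affmap_lsub (affmap_id _)) (schwartz_cdiff0 _ sf')).
  exact: (cdiff_pull (affmap_rsub (affmap_id _)) (schwartz_cdiff0 _ sg')).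
- move=> _ i [f' [g' [sf' sg' ->]]].
  have E : cD i (ctensor f' g') = fun z =>
      cderive (lsubmx (delta_mx 0 i)) f' (lsubmx z) * g' (rsubmx z) +
      f' (lsubmx z) * cderive (rsubmx (delta_mx 0 i)) g' (rsubmx z).
    apply/funext => z; rewrite /cD cderiveM; last 2 first.
      exact: (cdiff_pull (affmap_lsub (affmap_id _)) (schwartz_cdiff0 _ sf')).
      exact: (cdiff_pull (affmap_rsub (affmap_id _)) (schwartz_cdiff0 _ sg')).
    by rewrite /cderive; congr ((_ +i* _) * _ + _ * (_ +i* _));
      [exact: derive_lsub|exact: derive_lsub|exact: derive_rsub|exact: derive_rsub].
  case: (split_ordP i) => j ij; rewrite ij in E.
    exists (cD j f'), g'; split => //; first exact: schwartz_cD.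
    rewrite ij E; apply/funext => z.
    rewrite /ctensor /cD delta_mx_lshift row_mxKl row_mxKr.
    by rewrite /cderive !derive0 mulr0 addr0.
  exists f', (cD j g'); split => //; first exact: schwartz_cD.
  rewrite ij E; apply/funext => z.
  rewrite /ctensor /cD delta_mx_rshift row_mxKl row_mxKr.
  by rewrite /cderive !derive0 mul0r add0r.
- move=> _ i [f' [g' [sf' sg' ->]]].
  case: (split_ordP i) => j ->.
    exists (cX j f'), g'; split => //.
      by have [_ + _] := @schwartz_continuous_cX n j; exact.
    by apply/funext => z; rewrite /cX /ctensor mxE mulrA.
  exists f', (cX j g'); split => //.
    by have [_ + _] := @schwartz_continuous_cX m j; exact.
  by apply/funext => z; rewrite /cX /ctensor mxE mulrCA.
- move=> _ [f' [g' [/schwartz_bounded[M1 H1] /schwartz_bounded[M2 H2] ->]]].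
  exists (M1 * M2) => z; rewrite Normc.normcM.
  by rewrite ler_pM ?normc_ge0.
Qed.

End Operators.

Ltac affmap_tac := repeat first
  [ exact: affmap_id | exact: affmap_cst
  | apply: affmap_row | apply: affmapD | apply: affmapZ | apply: affmapN
  | apply: affmap_lsub | apply: affmap_rsub ].
Ltac row_ring := apply/rowP => ?; rewrite !mxE; ring.

(** * Taylor estimates *)

Section Taylor.
Context {R : realType}.

Lemma Re_lin (I : Type) (r : seq I) (a : I -> R) (c : I -> R[i]) :
  Re (\sum_(i <- r) (a i)%:C * c i) = \sum_(i <- r) a i * Re (c i).
Proof.
elim: r => [|i r IH]; first by rewrite !big_nil.
by rewrite !big_cons cReD cReM /= mul0r subr0 IH.
Qed.

Lemma Im_lin (I : Type) (r : seq I) (a : I -> R) (c : I -> R[i]) :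
  Im (\sum_(i <- r) (a i)%:C * c i) = \sum_(i <- r) a i * Im (c i).
Proof.
elim: r => [|i r IH]; first by rewrite !big_nil.
by rewrite !big_cons cImD cImM /= mul0r addr0 IH.
Qed.

Lemma mean_value_bound (p p1 : R -> R) (a b B : R) : a <= b ->
  (forall t : R, is_derive t (1 : R) p (p1 t)) ->
  (forall t, a <= t <= b -> `|p1 t| <= B) -> `|p b - p a| <= B * (b - a).
Proof.
rewrite le_eqVlt => /predU1P[->|ab] dp pB; first by rewrite !subrr normr0 mulr0.
have [c cab ->] : exists2 c, c \in `]a, b[%R & p b - p a = p1 c * (b - a).
  apply: MVT => //; apply: derivable_within_continuous => x _.
  exact: (@ex_derive _ _ _ _ _ _ _ (dp x)).
rewrite normrM (gtr0_norm (_ : 0 < b - a)) ?subr_gt0//.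
rewrite ler_pM2r ?subr_gt0//; apply: pB.
by move: cab; rewrite in_itv/= => /andP[/ltW -> /ltW ->].
Qed.

Lemma taylor2_bound (p p1 p2 : R -> R) (B : R) :
  (forall t : R, is_derive t (1 : R) p (p1 t)) ->
  (forall t : R, is_derive t (1 : R) p1 (p2 t)) ->
  (forall t, 0 <= t <= 1 -> `|p2 t| <= B) -> `|p 1 - p 0 - p1 0| <= B.
Proof.
move=> dp dp1 pB.
have B0 : 0 <= B by apply: le_trans (pB 0 _); rewrite ?lexx ?ler01.
pose r t := p t - p1 0 * t.
have dr (t : R) : is_derive t (1 : R) r (p1 t - p1 0).
  by rewrite /r; apply: is_derive_eq; rewrite /GRing.scale/=; ring.
have -> : p 1 - p 0 - p1 0 = r 1 - r 0 by rewrite /r mulr1 mulr0 subr0 addrAC.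
rewrite -[B]mulr1 -[X in B * X](subr0 1).
apply: (mean_value_bound ler01 dr) => t /andP[t0 t1].
apply: (@le_trans _ _ (B * (t - 0))); last by rewrite subr0 ler_piMr.
apply: (mean_value_bound t0 dp1) => s /andP[s0 st]; apply: pB.
by rewrite s0 (le_trans st t1).
Qed.

Lemma cos_bound (t : R) : `|cos t - 1| <= t ^+ 2.
Proof.
have := @taylor2_bound (fun s => cos (t * s)) (fun s => - t * sin (t * s))
  (fun s => - t ^+ 2 * cos (t * s)) (t ^+ 2).
rewrite mulr1 mulr0 cos0 sin0 mulr0 subr0; apply.
- move=> s; apply: is_derive_eq.
  by rewrite /GRing.scale/=; ring.
- move=> s; apply: is_derive_eq.
  by rewrite /GRing.scale/=; ring.
- move=> s _; rewrite normrM normrN (ger0_norm (sqr_ge0 t)) ler_piMr ?sqr_ge0//.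
  by rewrite ler_norml cos_geN1 cos_le1.
Qed.

Lemma sin_bound (t : R) : `|sin t - t| <= t ^+ 2.
Proof.
have := @taylor2_bound (fun s => sin (t * s)) (fun s => t * cos (t * s))
  (fun s => - t ^+ 2 * sin (t * s)) (t ^+ 2).
rewrite mulr1 mulr0 cos0 sin0 mulr1 subr0; apply.
- move=> s; apply: is_derive_eq.
  by rewrite /GRing.scale/=; ring.
- move=> s; apply: is_derive_eq.
  by rewrite /GRing.scale/=; ring.
- move=> s _; rewrite normrM normrN (ger0_norm (sqr_ge0 t)) ler_piMr ?sqr_ge0//.
  by rewrite ler_norml sin_geN1 sin_le1.
Qed.

Lemma expi_bound2 (t : R) : normc (expi t - 1 - t%:C * 'i) <= 2 * t ^+ 2.
Proof.
apply: (le_trans (normc_le _)); rewrite mulr_natl mulr2n; apply: lerD.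
  rewrite (_ : Re _ = cos t - 1) ?cos_bound//=.
  by rewrite mulr0 mul0r subr0 oppr0 addr0.
rewrite (_ : Im _ = sin t - t) ?sin_bound//=.
by rewrite mulr1 mul0r addr0 oppr0 addr0.
Qed.

Lemma is_derive_line n (g : 'rV[R]_n -> R) (z h : 'rV[R]_n) (t : R) :
  (forall x, differentiable g x) ->
  is_derive t (1 : R) (fun s => g (z + s *: h))
    (\sum_i h 0 i * 'D_(delta_mx 0 i) g (z + t *: h)).
Proof.
move=> dg.
have dl : differentiable (fun s : R => z + s *: h) t.
  have -> : (fun s : R => z + s *: h) = cst z + (fun s : R => s *: h) by [].
  by apply: differentiableD.
apply: DeriveDef.
  apply/derivable1_diffP.
  exact: (@differentiable_comp _ _ _ _ (fun s : R => z + s *: h) g).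
rewrite -derive_dir//; apply: eq_derive_quotient => k.
by rewrite [k%:A]mulr1 scalerDl addrCA.
Qed.

Lemma weight_shift n N (z h : 'rV[R]_n) : `|h| <= 1 ->
  (1 + `|z|) ^+ N <= 2 ^+ N * (1 + `|z + h|) ^+ N.
Proof.
move=> h1; rewrite -exprMn; apply: lerXn2r; rewrite ?nnegrE.
- by rewrite addr_ge0.
- by rewrite mulr_ge0// addr_ge0.
have : `|z| <= `|z + h| + 1.
  rewrite -{1}[z](addrK h) (le_trans (ler_normB _ _))// lerD2l//.
by have := normr_ge0 (z + h); lra.
Qed.

Lemma normZ_le1 n (t : R) (h : 'rV[R]_n) : 0 <= t <= 1 -> `|h| <= 1 -> `|t *: h| <= 1.
Proof.
move=> /andP[t0 t1] h1; rewrite normrZ ger0_norm//.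
by rewrite -[1]mulr1 ler_pM.
Qed.

Lemma real_taylor n N (g : 'rV[R]_n -> R) (M : 'I_n -> 'I_n -> R) :
  (forall x, differentiable g x) ->
  (forall i x, differentiable (fun y => 'D_(delta_mx 0 i) g y) x) ->
  (forall i j x, (1 + `|x|) ^+ N * `|'D_(delta_mx 0 j) (fun y => 'D_(delta_mx 0 i) g y) x| <= M i j) ->
  forall z h, `|h| <= 1 ->
   (1 + `|z|) ^+ N * `|g (z + h) - g z - \sum_i h 0 i * 'D_(delta_mx 0 i) g z|
    <= 2 ^+ N * (\sum_i \sum_j M i j) * `|h| ^+ 2.
Proof.
move=> dg d2g HM z h h1.
have w0 : 0 < (1 + `|z|) ^+ N by rewrite exprn_gt0// onenorm_gt0.
rewrite mulrC -ler_pdivlMr//.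
have := @taylor2_bound (fun t => g (z + t *: h))
  (fun t => \sum_i h 0 i * 'D_(delta_mx 0 i) g (z + t *: h))
  (fun t => \sum_i h 0 i * \sum_j h 0 j *
     'D_(delta_mx 0 j) (fun y => 'D_(delta_mx 0 i) g y) (z + t *: h)).
rewrite scale1r scale0r addr0; apply.
- by move=> t; exact: is_derive_line.
- move=> t.
  have := @is_derive_sum _ _ _ n (fun i (s : R) => h 0 i * 'D_(delta_mx 0 i) g (z + s *: h)) t (1 : R)
     (fun i => h 0 i * \sum_j h 0 j * 'D_(delta_mx 0 j) (fun y => 'D_(delta_mx 0 i) g y) (z + t *: h)).
  rewrite (_ : \sum_(i < n) (fun s : R => _) = (fun s : R => \sum_i h 0 i * 'D_(delta_mx 0 i) g (z + s *: h))); last first.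
    by apply/funext => s; rewrite fct_sumE.
  apply => i; apply: is_deriveZ; exact: is_derive_line.
- move=> t t01.
  apply: (le_trans (ler_norm_sum _ _ _)).
  rewrite ler_pdivlMr// mulr_suml.
  rewrite -mulrA mulr_suml mulr_sumr; apply: ler_sum => i _.
  rewrite normrM.
  apply: (@le_trans _ _ (`|h| * (\sum_j `|h| * `|'D_(delta_mx 0 j) (fun y => 'D_(delta_mx 0 i) g y) (z + t *: h)|) * (1 + `|z|) ^+ N)).
    rewrite ler_wpM2r ?(ltW w0)// ler_pM ?norm_coord//.
    apply: (le_trans (ler_norm_sum _ _ _)); apply: ler_sum => j _.
    by rewrite normrM ler_wpM2r// norm_coord.
  rewrite -mulr_sumr mulrA -expr2 -[leLHS]mulrA [leLHS]mulrC mulrA ler_wpM2r ?sqr_ge0//.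
  apply: (@le_trans _ _ (\sum_j 2 ^+ N * M i j)); last by rewrite mulr_sumr.
  rewrite mulr_suml; apply: ler_sum => j _.
  rewrite mulrC; apply: le_trans (ler_wpM2r (normr_ge0 _) (weight_shift N z (normZ_le1 t01 h1))) _.
  by rewrite -mulrA ler_wpM2l// exprn_ge0.
Qed.

Lemma weighted_Re n N s (f : cfun R n) x :
  (1 + `|x|) ^+ N * `|Re (cDs s f x)| <= weighted_deriv N s f x.
Proof.
by rewrite weighted_derivE ler_wpM2l ?normRe_le// exprn_ge0// (ltW (onenorm_gt0 _)).
Qed.

Lemma weighted_Im n N s (f : cfun R n) x :
  (1 + `|x|) ^+ N * `|Im (cDs s f x)| <= weighted_deriv N s f x.
Proof.
by rewrite weighted_derivE ler_wpM2l ?normIm_le// exprn_ge0// (ltW (onenorm_gt0 _)).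
Qed.

(** This estimate serves twice: for the differentiability of Fourier integrals
    ([fkernel_taylor]) and for the vanishing of integrals of derivatives
    ([cintegral_cD]). *)
Lemma schwartz_taylor n N (f : cfun R n) : schwartz f -> exists M, forall z h, `|h| <= 1 ->
  (1 + `|z|) ^+ N * normc (f (z + h) - f z - \sum_i (h 0 i)%:C * cD i f z) <= M * `|h| ^+ 2.
Proof.
move=> sf; have /fin_all_exists [M HM] : forall ij : 'I_n * 'I_n, exists M, forall x,
    weighted_deriv N [:: ij.2; ij.1] f x <= M.
  by move=> ij; have [_ _] := sf; exact.
pose K := 2 ^+ N * (\sum_i \sum_j M (i, j)).
exists (K + K) => z h h1; rewrite mulrDl.
have w0 : 0 <= (1 + `|z|) ^+ N by rewrite exprn_ge0// ltW// onenorm_gt0.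
apply: (le_trans (ler_wpM2l w0 (normc_le _))); rewrite mulrDr; apply: lerD.
  have := @real_taylor n N (fun x => Re (f x)) (fun i j => M (i, j)).
  rewrite cReD cReN cReD cReN Re_lin.
  apply => //.
  - by move=> x; have [] := schwartz_cdiff0 x sf.
  - by move=> i x; have [] := schwartz_cdiff [:: i] x sf.
  - by move=> i j x; rewrite (le_trans _ (HM (i, j) x))//; exact: (weighted_Re N [:: j; i]).
have := @real_taylor n N (fun x => Im (f x)) (fun i j => M (i, j)).
rewrite cImD cImN cImD cImN Im_lin.
apply => //.
- by move=> x; have [] := schwartz_cdiff0 x sf.
- by move=> i x; have [] := schwartz_cdiff [:: i] x sf.
- by move=> i j x; rewrite (le_trans _ (HM (i, j) x))//; exact: (weighted_Im N [:: j; i]).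
Qed.

Lemma schwartz_lip n N (f : cfun R n) : schwartz f -> exists M, forall z h, `|h| <= 1 ->
  (1 + `|z|) ^+ N * normc (f (z + h) - f z) <= M * `|h|.
Proof.
move=> sf; have [K HK] := schwartz_taylor N sf.
have /fin_all_exists [M HM] : forall i : 'I_n, exists M, forall x,
    weighted_deriv N [:: i] f x <= M.
  by move=> i; have [_ _] := sf; exact.
exists (`|K| + \sum_i M i) => z h h1; rewrite mulrDl.
have w0 : 0 <= (1 + `|z|) ^+ N by rewrite exprn_ge0// ltW// onenorm_gt0.
rewrite -[X in normc X](subrK (\sum_i (h 0 i)%:C * cD i f z)).
apply: (le_trans (ler_wpM2l w0 (le_normcD _ _))); rewrite mulrDr; apply: lerD.
  apply: (le_trans (HK z h h1)); apply: (@le_trans _ _ (`|K| * `|h| ^+ 2)).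
    by rewrite ler_wpM2r ?sqr_ge0 ?ler_norm.
  by rewrite ler_wpM2l// expr2 ler_piMr.
apply: (le_trans (ler_wpM2l w0 (normc_sum _ _))).
rewrite mulr_sumr mulr_suml; apply: ler_sum => i _.
rewrite Normc.normcM normc_real mulrCA [leRHS]mulrC.
have := HM i z; rewrite weighted_derivE => H.
by apply: ler_pM; rewrite ?mulr_ge0 ?normc_ge0 ?norm_coord.
Qed.

Lemma real_diff_criterion n (g : 'rV[R]_n -> R) (c : 'I_n -> R) M z :
  (forall h, `|h| <= 1 -> `|g (z + h) - g z - \sum_i h 0 i * c i| <= M * `|h| ^+ 2) ->
  differentiable g z /\ forall i, 'D_(delta_mx 0 i) g z = c i.
Proof.
move=> H.
pose L (h : 'rV[R]_n) : R := \sum_i h 0 i * c i.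
have Llin : linear L.
  move=> a u v; rewrite /L scaler_sumr -big_split; apply: eq_bigr => i _ /=.
  by rewrite !mxE /GRing.scale/=; ring.
pose LM := GRing.isLinear.Build _ _ _ _ _ Llin.
pose LL : {linear 'rV[R]_n -> R} := HB.pack L LM.
have cL : continuous LL.
  move=> x; apply: (@differentiable_continuous _ _ _ x L).
  apply: difsum => i; apply: difM; last exact: differentiable_cst.
  exact: differentiable_coord.
have E : (g \o shift z : 'rV[R]_n -> R) =
    cst (g z) + (LL : 'rV[R]_n -> R) +o_ (0 : 'rV[R]_n) id.
  apply/eqaddoP => e e0.
  have M0 : 0 < `|M| + 1 by rewrite ltr_wpDl.
  have : \forall h \near (0 : 'rV[R]_n), `|h| < Num.min 1 (e / (`|M| + 1)).
    by apply: nbhs0_lt; rewrite lt_min ltr01 divr_gt0.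
  apply: filterS => h; rewrite lt_min => /andP[/ltW h1 h2].
  change (`|g (h + z) - (g z + L h)| <= e * `|h|).
  rewrite opprD addrA (addrC h) (le_trans (H h h1))//.
  rewrite expr2 mulrA ler_wpM2r//.
  move: h2; rewrite ltr_pdivlMr// mulrC => /ltW h2; apply: le_trans h2.
  rewrite ler_wpM2r// (le_trans (ler_norm _))// lerDl.
  exact: ler01.
have dE := diff_unique cL E.
have dg : differentiable g z.
  by apply/diff_locallyP; rewrite dE.
split => // i; rewrite deriveE// dE /= /L (bigD1 i)//= mxE !eqxx mul1r.
by rewrite big1 ?addr0// => j /negPf ji; rewrite mxE ji andbF mul0r.
Qed.

(** A quadratic remainder identifies the differential. Applied to an integral
    depending on a parameter, it deduces differentiability from an estimate of
    the integrand. *)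
Lemma cdiff_criterion n (G : cfun R n) (c : 'I_n -> R[i]) M z :
  (forall h, `|h| <= 1 ->
     normc (G (z + h) - G z - \sum_i (h 0 i)%:C * c i) <= M * `|h| ^+ 2) ->
  cdiff G z /\ forall i, cD i G z = c i.
Proof.
move=> H.
have [d1 e1] : differentiable (fun x => Re (G x)) z /\
    forall i, 'D_(delta_mx 0 i) (fun x => Re (G x)) z = Re (c i).
  apply: (@real_diff_criterion _ _ _ M) => h h1; apply: le_trans (H h h1).
  apply: le_trans (normRe_le _).
  by rewrite cReD cReN cReD cReN Re_lin.
have [d2 e2] : differentiable (fun x => Im (G x)) z /\
    forall i, 'D_(delta_mx 0 i) (fun x => Im (G x)) z = Im (c i).
  apply: (@real_diff_criterion _ _ _ M) => h h1; apply: le_trans (H h h1).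
  apply: le_trans (normIm_le _).
  by rewrite cImD cImN cImD cImN Im_lin.
by split=> // i; rewrite /cD /cderive e1 e2; case: (c i).
Qed.

End Taylor.

(** * Integrals of complex-valued functions *)

Section ComplexIntegral.
Context {R : realType}.

Definition cdominated n (f : cfun R n) :=
  dominated_n (fun x => Re (f x)) /\ dominated_n (fun x => Im (f x)).

(** Each of the [n] factors of [wtn] costs four powers of [1 + `|y|]; this is
    the origin of the weight [4 * n] in all the integral estimates. *)
Lemma wtn_lower n (y : 'rV[R]_n) : 1 <= (1 + `|y|) ^+ (4 * n) * wtn y.
Proof.
rewrite exprM -[n in _ ^+ n]card_ord -prodr_const /wtn -big_split.
elim/big_ind: _ => // [a b a1 b1|i _ /=]; first exact: mulr_ege1.
rewrite /wt /cauchy -invfM.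
rewrite ler_pdivlMr ?mulr_gt0 ?onesqr_gt0// mul1r.
have h0 : 1 + y 0 i ^+ 2 <= (1 + `|y|) ^+ 2.
  rewrite sqrrD expr1n mul1r -addrA lerD2l.
  apply: (@le_trans _ _ (`|y| ^+ 2)); last by rewrite lerDr mulrn_wge0.
  rewrite -[leLHS]real_normK ?num_real//.
  by apply: lerXn2r; rewrite ?nnegrE ?norm_coord.
rewrite (_ : 4 = 2 * 2)%N// exprM expr2.
by apply: ler_pM => //; rewrite ltW// onesqr_gt0.
Qed.

Lemma weight_wtn n (f : R) (y : 'rV[R]_n) M : (1 + `|y|) ^+ (4 * n) * f <= M ->
  0 <= f -> f <= M * wtn y.
Proof.
move=> fM f0; apply: le_trans (ler_wpM2r (wtn_ge0 y) fM).
by rewrite mulrAC ler_peMl// wtn_lower.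
Qed.

Lemma continuous_cdiff n (f : cfun R n) : (forall x, cdiff f x) ->
  continuous (fun x => Re (f x)) /\ continuous (fun x => Im (f x)).
Proof.
by move=> df; split => x; have [d1 d2] := df x;
  [exact: (differentiable_continuous d1)|exact: (differentiable_continuous d2)].
Qed.

Lemma schwartz_wtn n (f : cfun R n) : schwartz f ->
  exists M, forall y, normc (f y) <= M * wtn y.
Proof.
move=> sf; have [_ _ /(_ (4 * n)%N [::])[M HM]] := sf.
exists M => y; apply: weight_wtn; last exact: normc_ge0.
by have := HM y; rewrite weighted_derivE.
Qed.

Lemma cdominated_intro n (f : cfun R n) C : (forall x, cdiff f x) ->
  (forall y, normc (f y) <= C * wtn y) -> cdominated f.
Proof.
move=> /continuous_cdiff[c1 c2] fC; split; split => //; exists C => y.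
  exact: le_trans (normRe_le _) (fC y).
exact: le_trans (normIm_le _) (fC y).
Qed.

Lemma schwartz_cdominated n (f : cfun R n) : schwartz f -> cdominated f.
Proof.
move=> sf; have [M HM] := schwartz_wtn sf.
by apply: cdominated_intro HM => x; exact: schwartz_cdiff0.
Qed.

Lemma dominated_nZ n (c : R) (f : 'rV[R]_n -> R) : dominated_n f ->
  dominated_n (fun x => c * f x).
Proof.
move=> [cf [C fC]]; split.
  exact: (@cts_comp _ _ _ f (fun t => c * t) cf (@mulrl_continuous _ c)).
by exists (`|c| * C) => y; rewrite normrM -mulrA ler_wpM2l.
Qed.

Lemma dominated_nD n (f g : 'rV[R]_n -> R) : dominated_n f -> dominated_n g ->
  dominated_n (fun x => f x + g x).
Proof.
move=> [cf [C fC]] [cg [D gD]]; split.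
  by move=> x; exact: (continuousD (cf x) (cg x)).
by exists (C + D) => y; rewrite (le_trans (ler_normD _ _))// mulrDl lerD.
Qed.

Lemma cintegralD n (f g : cfun R n) : cdominated f -> cdominated g ->
  cintegral (fun x => f x + g x) = cintegral f + cintegral g.
Proof.
move=> [f1 f2] [g1 g2]; rewrite /cintegral.
under eq_fun do rewrite cReD.
under [X in _ +i* integral_Rn X]eq_fun do rewrite cImD.
by rewrite !integral_RnD.
Qed.

Lemma cintegralZ n c (f : cfun R n) : cdominated f ->
  cintegral (fun x => c * f x) = c * cintegral f.
Proof.
move=> [f1 f2]; rewrite /cintegral.
under eq_fun do rewrite cReM.
under [X in _ +i* integral_Rn X]eq_fun do rewrite cImM.
have E1 : integral_Rn (fun x => Re c * Re (f x) - Im c * Im (f x)) =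
    Re c * integral_Rn (fun x => Re (f x)) - Im c * integral_Rn (fun x => Im (f x)).
  under eq_fun do rewrite -mulNr.
  by rewrite integral_RnD ?integral_RnZ ?mulNr//; exact: dominated_nZ.
have E2 : integral_Rn (fun x => Re c * Im (f x) + Im c * Re (f x)) =
    Re c * integral_Rn (fun x => Im (f x)) + Im c * integral_Rn (fun x => Re (f x)).
  by rewrite integral_RnD ?integral_RnZ//; exact: dominated_nZ.
rewrite E1 E2; case: c {E1 E2} => a b /=.
by apply/eqP; rewrite eq_complex /= !eqxx.
Qed.

Lemma cdominatedZ n c (f : cfun R n) : cdominated f -> cdominated (fun x => c * f x).
Proof.
move=> [f1 f2]; split.
  under eq_fun do rewrite cReM -mulNr.
  by apply: dominated_nD; exact: dominated_nZ.
under eq_fun do rewrite cImM.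
by apply: dominated_nD; exact: dominated_nZ.
Qed.

Lemma cintegral_lin n c (f g : cfun R n) : cdominated f -> cdominated g ->
  cintegral (fun x => c * f x + g x) = c * cintegral f + cintegral g.
Proof.
by move=> df dg; rewrite cintegralD ?cintegralZ//; exact: cdominatedZ.
Qed.

Lemma cintegral0 n : cintegral (fun _ : 'rV[R]_n => 0) = 0.
Proof.
have := @cintegralZ n 0 (fun=> 0) (schwartz_cdominated (@schwartz0 R n)).
by rewrite !mul0r.
Qed.

Lemma cintegral_sum n (I : Type) (r : seq I) (F : I -> cfun R n) :
  (forall i, schwartz (F i)) ->
  cintegral (fun x => \sum_(i <- r) F i x) = \sum_(i <- r) cintegral (F i).
Proof.
move=> sF; elim: r => [|i r IH].
  by under eq_fun do rewrite big_nil; rewrite cintegral0 big_nil.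
under eq_fun do rewrite big_cons.
rewrite cintegralD ?IH ?big_cons//; first exact: schwartz_cdominated.
exact/schwartz_cdominated/schwartz_sum.
Qed.

Lemma norm_cintegral n (f : cfun R n) C : cdominated f ->
  (forall y, normc (f y) <= C * wtn y) ->
  normc (cintegral f) <= 2 * cauchy_mass ^+ n * C.
Proof.
move=> [[c1 _] [c2 _]] fC; apply: (le_trans (normc_le _)) => /=.
rewrite -mulrA [_ * C]mulrC mulr_natl mulr2n; apply: lerD; apply: norm_integral_Rn => // y.
  exact: le_trans (normRe_le _) (fC y).
exact: le_trans (normIm_le _) (fC y).
Qed.

Lemma cintegral_affine n (f : cfun R n) (c : R) a : c != 0 -> cdominated f ->
  cintegral (fun y => f (c *: y + a)) = ((`|c|^-1) ^+ n)%:C * cintegral f.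
Proof.
move=> c0 [f1 f2]; rewrite /cintegral (integral_Rn_affine a c0 f1) (integral_Rn_affine a c0 f2).
by apply/eqP; rewrite eq_complex /= !mul0r subr0 addr0 !eqxx.
Qed.

Lemma cintegral_shift n (f : cfun R n) a : cdominated f ->
  cintegral (fun y => f (y + a)) = cintegral f.
Proof.
move=> df; have := @cintegral_affine n f 1 a (oner_neq0 _) df.
by under eq_fun do rewrite scale1r; rewrite normr1 invr1 expr1n mul1r.
Qed.

Lemma cintegral_opp n (f : cfun R n) a : cdominated f ->
  cintegral (fun y => f (a - y)) = cintegral f.
Proof.
have m10 : -1 != 0 :> R by rewrite oppr_eq0 oner_eq0.
move=> df; have := cintegral_affine a m10 df.
under eq_fun do rewrite scaleN1r addrC.
by rewrite normrN normr1 invr1 expr1n mul1r.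
Qed.

Lemma cintegral_cat m n (f : cfun R (m + n)) :
  cintegral f = cintegral (fun x : 'rV[R]_m => cintegral (fun y : 'rV[R]_n => f (row_mx x y))).
Proof.
by rewrite /cintegral; congr (_ +i* _); rewrite integral_Rn_cat.
Qed.

Lemma continuous_row_mx m n : continuous (fun p : 'rV[R]_m * 'rV[R]_n => row_mx p.1 p.2).
Proof.
apply: continuous_rV => i; case: (split_ordP i) => j ->.
  under eq_fun do rewrite row_mxEl.
  apply: (@cts_comp _ _ _ fst (fun v : 'rV[R]_m => v 0 j) cts_fst).
  exact: coord_continuous.
under eq_fun do rewrite row_mxEr.
apply: (@cts_comp _ _ _ snd (fun v : 'rV[R]_n => v 0 j) cts_snd).
exact: coord_continuous.
Qed.

Lemma wtn_row_mx m n (x : 'rV[R]_m) (y : 'rV[R]_n) : wtn (row_mx x y) = wtn x * wtn y.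
Proof.
rewrite /wtn big_split_ord; congr (_ * _); apply: eq_bigr => i _.
  by rewrite row_mxEl.
by rewrite row_mxEr.
Qed.

Lemma cintegral_swap m n (f : cfun R (m + n)) : cdominated f ->
  cintegral (fun x : 'rV[R]_m => cintegral (fun y : 'rV[R]_n => f (row_mx x y))) =
  cintegral (fun y : 'rV[R]_n => cintegral (fun x : 'rV[R]_m => f (row_mx x y))).
Proof.
move=> [[c1 [M1 b1]] [c2 [M2 b2]]]; rewrite /cintegral /=; congr (_ +i* _).
  apply: (@integral_Rn_swap _ _ _ (fun x y => Re (f (row_mx x y))) M1).
    by apply: (@cts_comp _ _ _ _ _ (@continuous_row_mx m n) c1).
  by move=> x y; rewrite -wtn_row_mx.
apply: (@integral_Rn_swap _ _ _ (fun x y => Im (f (row_mx x y))) M2).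
  by apply: (@cts_comp _ _ _ _ _ (@continuous_row_mx m n) c2).
by move=> x y; rewrite -wtn_row_mx.
Qed.

End ComplexIntegral.

(** * Differentiability of the partial Fourier transform *)

Section FourierOperator.
Context {R : realType}.

Lemma norm_row_mxl m n (x : 'rV[R]_m) (y : 'rV[R]_n) : `|x| <= `|row_mx x y|.
Proof.
rewrite [leLHS](mx_normrE x); apply: bigmax_le => // -[i j] _ /=.
by rewrite (ord1 i) -(row_mxEl x y) norm_coord.
Qed.

Lemma norm_row_mxr m n (x : 'rV[R]_m) (y : 'rV[R]_n) : `|y| <= `|row_mx x y|.
Proof.
rewrite [leLHS](mx_normrE y); apply: bigmax_le => // -[i j] _ /=.
by rewrite (ord1 i) -(row_mxEr x y) norm_coord.
Qed.

Lemma norm_row_mx0 m n (x : 'rV[R]_m) : `|row_mx x (0 : 'rV[R]_n)| <= `|x|.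
Proof.
rewrite [leLHS](mx_normrE (row_mx x 0)); apply: bigmax_le => // -[i j] _ /=.
rewrite (ord1 i); case: (split_ordP j) => k ->; first by rewrite row_mxEl norm_coord.
by rewrite row_mxEr mxE normr0.
Qed.

Lemma norm_lsubmx m n (h : 'rV[R]_(m + n)) : `|lsubmx h| <= `|h|.
Proof. by rewrite -{2}[h]hsubmxK norm_row_mxl. Qed.

Lemma norm_rsubmx m n (h : 'rV[R]_(m + n)) : `|rsubmx h| <= `|h|.
Proof. by rewrite -{2}[h]hsubmxK norm_row_mxr. Qed.

Lemma dotpC n (x y : 'rV[R]_n) : dotp x y = dotp y x.
Proof. by apply: eq_bigr => i _; exact: mulrC. Qed.

Lemma dotpDr n (x y z : 'rV[R]_n) : dotp x (y + z) = dotp x y + dotp x z.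
Proof. by rewrite /dotp -big_split; apply: eq_bigr => i _; rewrite mxE mulrDr. Qed.

Lemma dotpNr n (x y : 'rV[R]_n) : dotp x (- y) = - dotp x y.
Proof. by rewrite /dotp -sumrN; apply: eq_bigr => i _; rewrite mxE mulrN. Qed.

Lemma dotp_le n (x y : 'rV[R]_n) : `|dotp x y| <= n%:R * (`|x| * `|y|).
Proof.
apply: (le_trans (ler_norm_sum _ _ _)).
apply: (@le_trans _ _ (\sum_(i < n) `|x| * `|y|)).
  by apply: ler_sum => i _; rewrite normrM ler_pM// norm_coord.
by rewrite sumr_const card_ord mulr_natl.
Qed.

Lemma schwartz_slice m n (f : cfun R (m + n)) x : schwartz f ->
  schwartz (fun y : 'rV[R]_n => f (row_mx x y)).
Proof.
apply: (@schwartz_pull _ _ _ (fun y : 'rV[R]_n => row_mx x y) (fun z => rsubmx z)).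
- by affmap_tac.
- by affmap_tac.
- by move=> y; rewrite row_mxKr.
Qed.

Definition fkernel m n (f : cfun R (m + n)) (z : 'rV[R]_(m + n)) : cfun R n :=
  fun t => expi (- (2 * pi * dotp t (rsubmx z))) * f (row_mx (lsubmx z) t).

Lemma quad_phase n (c : R) (w : 'rV[R]_n) : quad (fun t => c * dotp t w).
Proof. by apply: quadZ; apply: quad_dotp; [exact: affmap_id|exact: affmap_cst]. Qed.

Lemma schwartz_fkernel m n (f : cfun R (m + n)) z : schwartz f -> schwartz (fkernel f z).
Proof.
move=> sf; apply: schwartz_chirp; last exact: schwartz_slice.
have := quad_phase (- (2 * pi)) (rsubmx z).
by under eq_fun do rewrite mulNr.
Qed.

Lemma fourier2E m n (f : cfun R (m + n)) z : fourier2 f z = cintegral (fkernel f z).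
Proof. by []. Qed.

Lemma fkernel_bound m n (f : cfun R (m + n)) (z : 'rV[R]_(m + n)) (y : 'rV[R]_n) : schwartz f ->
  normc (fkernel f z y) <= schwartz_norm (4 * n) f * wtn y.
Proof.
move=> sf; rewrite /fkernel Normc.normcM normc_expi mul1r.
apply: weight_wtn; last exact: normc_ge0.
apply: le_trans (schwartz_norm_ub (row_mx (lsubmx z) y) sf (leq0n _ : (size [::] <= 4 * n)%N)).
rewrite weighted_derivE ler_wpM2r ?normc_ge0//.
apply: lerXn2r; rewrite ?nnegrE ?addr_ge0// lerD2l.
exact: norm_row_mxr.
Qed.

Lemma fourier2_linear m n : schwartz_linear (@fourier2 R m n).
Proof.
move=> c f g sf sg; apply/funext => z; rewrite !fourier2E.
rewrite -cintegral_lin; [|exact/schwartz_cdominated/schwartz_fkernel..].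
by congr cintegral; apply/funext => y; rewrite /fkernel mulrDr mulrCA.
Qed.

(** A derivative in a parameter passes under the integral, and a derivative in
    a frequency becomes a multiplication by the dual coordinate. *)
Definition fourier2_deriv m n (i : 'I_(m + n)) (f : cfun R (m + n)) : cfun R (m + n) :=
  match fintype.split i with
  | inl _ => cD i f
  | inr _ => fun z => (- (2 * pi))%:C * 'i * cX i f z
  end.

Lemma schwartz_continuous_fourier2_deriv m n (i : 'I_(m + n)) :
  schwartz_continuous (fourier2_deriv i).
Proof.
rewrite /fourier2_deriv; case: (fintype.split i) => j; first exact: schwartz_continuous_cD.
exact/schwartz_continuousZ/schwartz_continuous_cX.
Qed.

(** The increment splits into the second-order remainder of the exponential, a
    product of two first-order increments, and the Taylor remainder of [f].
    Each part is quadratic in [h], and the powers of [`|w|] coming from the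
    exponential are absorbed by the decay of [f]. *)
Lemma fkernel_taylor m n (f : cfun R (m + n)) : schwartz f -> exists C, forall z h y,
  `|h| <= 1 ->
  normc (fkernel f (z + h) y - fkernel f z y -
    \sum_i (h 0 i)%:C * fkernel (fourier2_deriv i f) z y) <= C * `|h| ^+ 2 * wtn y.
Proof.
move=> sf.
have [M0 H0] : exists M, forall x, weighted_deriv (4 * n).+2 [::] f x <= M.
  by have [_ _] := sf; exact.
have [M1 H1] := schwartz_lip (4 * n).+2 sf.
have [M2 H2] := schwartz_taylor (4 * n) sf.
pose B := 2 * pi * n%:R : R.
have B0 : 0 <= B by rewrite !mulr_ge0// pi_ge0.
exists (2 * B ^+ 2 * (M0 + `|M1|) + B * `|M1| + `|M2|) => z h y h1.
set w := row_mx (lsubmx z) y; set k := row_mx (lsubmx h) (0 : 'rV[R]_n).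
have kh : `|k| <= `|h| by rewrite (le_trans (norm_row_mx0 _ _))// norm_lsubmx.
have k1 : `|k| <= 1 by exact: le_trans h1.
set th := - (2 * pi * dotp y (rsubmx h)).
have thB : `|th| <= B * (`|w| * `|h|).
  rewrite normrN normrM (ger0_norm (mulr_ge0 _ (pi_ge0 R)))//.
  rewrite (_ : B * (`|w| * `|h|) = 2 * pi * (n%:R * (`|w| * `|h|))); last by rewrite /B; ring.
  apply: ler_wpM2l; first by rewrite mulr_ge0// pi_ge0.
  rewrite (le_trans (dotp_le _ _))// ler_wpM2l// ler_pM ?norm_rsubmx//.
  exact: norm_row_mxr.
have -> : fkernel f (z + h) y - fkernel f z y -
    \sum_i (h 0 i)%:C * fkernel (fourier2_deriv i f) z y =
    expi (- (2 * pi * dotp y (rsubmx z))) *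
    ((expi th - 1 - th%:C * 'i) * f (w + k) + th%:C * 'i * (f (w + k) - f w) +
     (f (w + k) - f w - \sum_i (k 0 i)%:C * cD i f w)).
  have -> : fkernel f (z + h) y = expi (- (2 * pi * dotp y (rsubmx z))) * (expi th * f (w + k)).
    rewrite /fkernel mulrA -expiD linearD dotpDr mulrDr opprD linearD /=.
    by rewrite add_row_mx addr0.
  have -> : \sum_i (h 0 i)%:C * fkernel (fourier2_deriv i f) z y =
      expi (- (2 * pi * dotp y (rsubmx z))) *
      (th%:C * 'i * f w + \sum_i (k 0 i)%:C * cD i f w).
    rewrite big_split_ord /= addrC mulrDr; congr (_ + _).
      have -> : th%:C = \sum_j (- (2 * pi * (y 0 j * rsubmx h 0 j)))%:C.
        by rewrite /th /dotp mulr_sumr -sumrN (rmorph_sum (real_complex R)).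
      rewrite !mulr_suml mulr_sumr.
      apply: eq_bigr => j _; rewrite /fkernel /fourier2_deriv (unsplitK (inr j)).
      rewrite /cX row_mxEr mxE !(rmorphM, rmorphN) /=.
      by rewrite -/w; ring.
    rewrite big_split_ord /= [X in _ * (_ + X)]big1 ?addr0; last first.
      by move=> j _; rewrite row_mxEr mxE mul0r.
    rewrite mulr_sumr; apply: eq_bigr => j _.
    rewrite /fkernel /fourier2_deriv (unsplitK (inl j)) row_mxEl mxE.
    by rewrite -/w; ring.
  rewrite /fkernel -/w; ring.
rewrite Normc.normcM normc_expi mul1r.
apply: weight_wtn; last exact: normc_ge0.
have ywp (N : nat) : (1 + `|y|) ^+ N <= (1 + `|w|) ^+ N.
  by apply: lerXn2r; rewrite ?nnegrE ?addr_ge0// lerD2l norm_row_mxr.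
set W := (1 + `|w|) ^+ (4 * n).
have W0 : 0 <= W by rewrite exprn_ge0// addr_ge0.
apply: le_trans (ler_wpM2r (normc_ge0 _) (ywp _)) _; rewrite -/W.
have w1 : `|w| <= 1 + `|w| by rewrite lerDr.
have w0 : 0 <= 1 + `|w| by rewrite addr_ge0.
have S0 : 0 <= 2 * B ^+ 2 * `|h| ^+ 2.
  by apply: mulr_ge0; [apply: mulr_ge0|]; rewrite ?sqr_ge0.
have K0 : W * (1 + `|w|) ^+ 2 * normc (f (w + k)) <= M0 + `|M1|.
  have -> : f (w + k) = f w + (f (w + k) - f w) by rewrite [RHS]addrC subrK.
  rewrite -exprD addn2.
  apply: (@le_trans _ _ ((1 + `|w|) ^+ (4 * n).+2 * (normc (f w) + normc (f (w + k) - f w)))).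
    by rewrite ler_wpM2l ?exprn_ge0// le_normcD.
  rewrite mulrDr; apply: lerD.
    by have := H0 w; rewrite weighted_derivE.
  apply: (le_trans (H1 w k k1)); apply: (@le_trans _ _ (`|M1| * `|k|)).
    by rewrite ler_wpM2r// ler_norm.
  by rewrite ler_piMr.
have K1 : W * (1 + `|w|) * normc (f (w + k) - f w) <= `|M1| * `|h|.
  apply: (@le_trans _ _ ((1 + `|w|) ^+ (4 * n).+2 * normc (f (w + k) - f w))).
    rewrite ler_wpM2r ?normc_ge0// -exprSr ler_weXn2l// lerDl//.
  apply: (le_trans (H1 w k k1)); apply: (@le_trans _ _ (`|M1| * `|k|)).
    by rewrite ler_wpM2r// ler_norm.
  by rewrite ler_wpM2l.
have K2 : W * normc (f (w + k) - f w - \sum_i (k 0 i)%:C * cD i f w) <= `|M2| * `|h| ^+ 2.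
  apply: (le_trans (H2 w k k1)); apply: (@le_trans _ _ (`|M2| * `|k| ^+ 2)).
    by rewrite ler_wpM2r ?sqr_ge0// ler_norm.
  by rewrite ler_wpM2l// lerXn2r ?nnegrE.
apply: (@le_trans _ _ (W * (normc ((expi th - 1 - th%:C * 'i) * f (w + k)) +
  normc (th%:C * 'i * (f (w + k) - f w)) +
  normc (f (w + k) - f w - \sum_i (k 0 i)%:C * cD i f w)))).
  rewrite ler_wpM2l// (le_trans (le_normcD _ _))// lerD2r.
  exact: le_normcD.
rewrite 2!(mulrDr W) [leRHS]mulrDl [X in _ <= X + _]mulrDl.
apply: lerD => //; apply: lerD.
  rewrite Normc.normcM.
  apply: (@le_trans _ _ (W * (2 * (B * (`|w| * `|h|)) ^+ 2 * normc (f (w + k))))).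
    rewrite ler_wpM2l// ler_wpM2r ?normc_ge0// (le_trans (expi_bound2 _))//.
    rewrite ler_wpM2l// -[leLHS]real_normK ?num_real//.
    by apply: lerXn2r; rewrite ?nnegrE// mulr_ge0// mulr_ge0.
  apply: (@le_trans _ _ (2 * B ^+ 2 * `|h| ^+ 2 * (W * (1 + `|w|) ^+ 2 * normc (f (w + k))))).
    rewrite [leLHS](_ : _ = 2 * B ^+ 2 * `|h| ^+ 2 * (W * `|w| ^+ 2 * normc (f (w + k)))); last by ring.
    apply: ler_wpM2l => //; apply: ler_wpM2r; first exact: normc_ge0.
    by apply: ler_wpM2l => //; apply: lerXn2r; rewrite ?nnegrE.
  apply: (le_trans (ler_wpM2l _ K0)) => //.
  by le_ring.
rewrite Normc.normcM.
have -> : normc (th%:C * 'i) = `|th|.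
  by rewrite Normc.normcM normc_real /= expr0n add0r expr1n sqrtr1 mulr1.
apply: (@le_trans _ _ (B * `|h| * (W * (1 + `|w|) * normc (f (w + k) - f w)))).
  rewrite [leRHS](_ : _ = W * (B * ((1 + `|w|) * `|h|) * normc (f (w + k) - f w))); last by ring.
  apply: ler_wpM2l => //; apply: ler_wpM2r; first exact: normc_ge0.
  apply: (le_trans thB); apply: ler_wpM2l => //; exact: ler_wpM2r.
apply: (le_trans (ler_wpM2l _ K1)); first by rewrite mulr_ge0.
by le_ring.
Qed.

Lemma schwartzB n (f g : cfun R n) : schwartz f -> schwartz g ->
  schwartz (fun x => f x - g x).
Proof.
move=> sf sg; have := schwartz_lin (-1) sg sf.
by under eq_fun do rewrite mulN1r addrC.
Qed.

Lemma cintegralB n (f g : cfun R n) : schwartz f -> schwartz g ->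
  cintegral (fun x => f x - g x) = cintegral f - cintegral g.
Proof.
move=> sf sg; have := cintegral_lin (-1) (schwartz_cdominated sg) (schwartz_cdominated sf).
by under eq_fun do rewrite mulN1r addrC; rewrite mulN1r addrC.
Qed.

(** Integrating the estimate of [fkernel_taylor] gives the hypothesis of
    [cdiff_criterion]. *)
Lemma fourier2_cD m n (f : cfun R (m + n)) z : schwartz f ->
  cdiff (fourier2 f) z /\ forall i, cD i (fourier2 f) z = fourier2 (fourier2_deriv i f) z.
Proof.
move=> sf; have [C HC] := fkernel_taylor sf.
have sL i : schwartz (fourier2_deriv i f).
  by have [_ + _] := schwartz_continuous_fourier2_deriv i; exact.
apply: (@cdiff_criterion _ _ _ _ (2 * cauchy_mass ^+ n * C)) => h h1.
rewrite !fourier2E.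
under [X in _ - X]eq_bigr => i _ do
  rewrite -(cintegralZ (h 0 i)%:C (schwartz_cdominated (schwartz_fkernel z (sL i)))).
rewrite -cintegral_sum; last by move=> i; exact/schwartzZ/schwartz_fkernel.
rewrite -cintegralB; [|exact: schwartz_fkernel..].
rewrite -cintegralB; last 2 first.
- by apply: schwartzB; exact: schwartz_fkernel.
- by apply: schwartz_sum => i; exact/schwartzZ/schwartz_fkernel.
rewrite -[leRHS]mulrA; apply: norm_cintegral => [|y]; last exact: HC.
apply/schwartz_cdominated/schwartzB.
  by apply: schwartzB; exact: schwartz_fkernel.
by apply: schwartz_sum => i; exact/schwartzZ/schwartz_fkernel.
Qed.

End FourierOperator.

(** * Continuity of the Fourier transforms on the Schwartz space *)

Section FourierContinuity.
Context {R : realType}.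

Lemma le0_of_le_small (a K : R) : (forall e, 0 < e <= 1 -> a <= K * e) -> a <= 0.
Proof.
move=> H; rewrite leNgt; apply/negP => a0.
have K1 : 0 < `|K| + 1 by rewrite ltr_wpDl.
pose e := Num.min 1 (a / (2 * (`|K| + 1))).
have e0 : 0 < e by rewrite lt_min ltr01 divr_gt0// mulr_gt0.
have e1 : e <= a / (2 * (`|K| + 1)) by rewrite /e ge_min lexx orbT.
have := H e; rewrite e0 ge_min lexx => /(_ isT).
have : K * e <= (`|K| + 1) * e.
  by rewrite ler_pM2r// (le_trans (ler_norm _))// lerDl.
move: e1; rewrite ler_pdivlMr ?mulr_gt0// => e1 e2 e3.
have : e * (2 * (`|K| + 1)) = 2 * ((`|K| + 1) * e) by ring.
lra.
Qed.

Lemma normc_le0 (x : R[i]) : normc x <= 0 -> x = 0.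
Proof. by move=> x0; apply: Normc.eq0_normc; apply/eqP; rewrite eq_le x0 normc_ge0. Qed.

Lemma norm_delta n (j : 'I_n) : `|delta_mx 0 j : 'rV[R]_n| <= 1.
Proof.
rewrite [leLHS](mx_normrE (delta_mx 0 j)); apply: bigmax_le => // -[i k] _ /=.
by rewrite mxE; case: (_ && _); rewrite ?normr1 ?normr0.
Qed.

(** A translation by [e] in the direction [j] leaves the integral of [h]
    unchanged, so [e] times the integral of the derivative is at most the
    integrated Taylor remainder, of order [e ^+ 2]. *)
Lemma cintegral_cD n (h : cfun R n) j : schwartz h -> cintegral (cD j h) = 0.
Proof.
move=> sh; apply: normc_le0.
have [M HM] := schwartz_taylor (4 * n) sh.
apply: (@le0_of_le_small _ (2 * cauchy_mass ^+ n * `|M|)) => e /andP[e0 e1].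
pose v : 'rV[R]_n := e *: delta_mx 0 j.
have ve : `|v| <= e by rewrite normrZ gtr0_norm// ler_piMr ?norm_delta// ltW.
have v1 : `|v| <= 1 by exact: le_trans e1.
have sv := schwartz_translate v sh.
have sD := schwartz_cD j sh.
have E y : \sum_i (v 0 i)%:C * cD i h y = e%:C * cD j h y.
  rewrite (bigD1 j)//= !mxE !eqxx mulr1 big1 ?addr0// => i /negPf ij.
  by rewrite !mxE ij andbF mulr0 mul0r.
have : normc (cintegral (fun y => h (y + v) - h y - e%:C * cD j h y)) <=
    2 * cauchy_mass ^+ n * (`|M| * e ^+ 2).
  apply: norm_cintegral => [|y].
    by apply/schwartz_cdominated/schwartzB; [exact: schwartzB|exact: schwartzZ].
  apply: weight_wtn; last exact: normc_ge0.
  rewrite -E (le_trans (HM y v v1))//.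
  apply: (@le_trans _ _ (`|M| * `|v| ^+ 2)); first by rewrite ler_wpM2r ?sqr_ge0 ?ler_norm.
  apply: ler_wpM2l => //; apply: lerXn2r; rewrite ?nnegrE// ltW//.
rewrite cintegralB//; [|exact: schwartzB|exact: schwartzZ].
rewrite cintegralB// cintegral_shift; last exact: schwartz_cdominated.
rewrite subrr sub0r normcN cintegralZ; last exact: schwartz_cdominated.
rewrite Normc.normcM normc_real gtr0_norm// => H.
rewrite -(ler_pM2l e0); apply: (le_trans H).
by le_ring.
Qed.

Lemma cD_slice m n (f : cfun R (m + n)) x j t :
  cD j (fun y : 'rV[R]_n => f (row_mx x y)) t = cD (rshift m j) f (row_mx x t).
Proof.
have E (h : R) : row_mx x (h *: delta_mx 0 j + t) =
    h *: delta_mx 0 (rshift m j) + row_mx x t :> 'rV[R]_(m + n).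
  apply/rowP => i; case: (split_ordP i) => k ->;
    rewrite ?row_mxEl ?row_mxEr [RHS]mxE [X in _ = X + _]mxE [X in _ = _ * X + _]mxE.
    by rewrite row_mxEl eq_lrshift andbF mulr0 add0r.
  by rewrite row_mxEr eq_rshift !mxE.
by rewrite /cD /cderive; congr (_ +i* _); apply: eq_derive_quotient => h; rewrite E.
Qed.

Lemma pi2_neq0 : (2 * pi : R)%:C != 0.
Proof.
apply/eqP => /(congr1 (@complex.Re R)) /= /eqP; apply/negP.
by rewrite mulf_neq0 ?gt_eqF ?pi_gt0.
Qed.

Lemma derZ n (c : R) (f : 'rV[R]_n -> R) v x : differentiable f x ->
  'D_v (fun y => c * f y) x = c * 'D_v f x.
Proof.
move=> df; have := derM v (differentiable_cst c x) df.
by rewrite derive_cst mul0r add0r.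
Qed.

Lemma derive_dotp n j (w t : 'rV[R]_n) :
  'D_(delta_mx 0 j) (fun t => dotp t w) t = w 0 j.
Proof.
rewrite dersum => [|i]; last first.
  by apply: difM; [exact: differentiable_coord|exact: differentiable_cst].
rewrite (bigD1 j)//= big1 => [|i /negPf ij].
  rewrite addr0 derM; [|exact: differentiable_coord|exact: differentiable_cst].
  by rewrite derive_cst mulr0 addr0 derive_coord mxE !eqxx mul1r.
rewrite derM; [|exact: differentiable_coord|exact: differentiable_cst].
by rewrite derive_cst mulr0 addr0 derive_coord mxE ij andbF mul0r.
Qed.

(** Integration by parts: [cintegral_cD] applied to the kernel. *)
Lemma cX_fourier2 m n (f : cfun R (m + n)) j : schwartz f ->
  cX (rshift m j) (fourier2 f) =
  fourier2 (fun z => ((2 * pi)%:C^-1 * - 'i) * cD (rshift m j) f z).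
Proof.
move=> sf; apply/funext => z.
have sg : schwartz (fun y : 'rV[R]_n => f (row_mx (lsubmx z) y)) by exact: schwartz_slice.
have sfD := schwartz_cD (rshift m j) sf.
have E t : cD j (fkernel f z) t =
    (- (2 * pi * z 0 (rshift m j)))%:C * 'i * fkernel f z t +
    fkernel (cD (rshift m j) f) z t.
  rewrite /fkernel.
  have dq : differentiable (fun t : 'rV[R]_n => - (2 * pi * dotp t (rsubmx z))) t.
    have [+ _] := quad_phase (- (2 * pi)) (rsubmx z) => /(_ t).
    by under eq_fun do rewrite mulNr.
  have -> : cD j (fun t => expi (- (2 * pi * dotp t (rsubmx z))) * f (row_mx (lsubmx z) t)) t =
     cD j (chirp (fun t => - (2 * pi * dotp t (rsubmx z))) (fun t => f (row_mx (lsubmx z) t))) t by [].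
  rewrite (cD_chirp _ dq (schwartz_cdiff0 t sg)) cD_slice.
  have -> : 'D_(delta_mx 0 j) (fun t : 'rV[R]_n => - (2 * pi * dotp t (rsubmx z))) t =
      - (2 * pi * z 0 (rshift m j)).
    have dd : differentiable (fun t : 'rV[R]_n => dotp t (rsubmx z)) t.
      by have [+ _] := quad_dotp (affmap_id n) (affmap_cst n (rsubmx z)) => /(_ t).
    under eq_fun do rewrite -mulNr.
    by rewrite derZ// derive_dotp mxE mulNr.
  by ring.
have := cintegral_cD j (schwartz_fkernel z sf).
rewrite (_ : cD j (fkernel f z) = fun t => (- (2 * pi * z 0 (rshift m j)))%:C * 'i * fkernel f z t +
    fkernel (cD (rshift m j) f) z t); last exact/funext.
rewrite cintegral_lin; [|exact/schwartz_cdominated/schwartz_fkernel..].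
rewrite -!fourier2E => /eqP; rewrite addrC addr_eq0 => /eqP E2.
rewrite /cX.
have -> : fourier2 (fun z0 => (2 * pi)%:C^-1 * - 'i * cD (rshift m j) f z0) z =
    ((2 * pi)%:C^-1 * - 'i) * fourier2 (cD (rshift m j) f) z.
  rewrite !fourier2E -cintegralZ; last exact/schwartz_cdominated/schwartz_fkernel.
  by congr cintegral; apply/funext => t; rewrite /fkernel; ring.
rewrite E2 !(rmorphN, rmorphM (real_complex R)) /=.
have := pi2_neq0; rewrite (rmorphM (real_complex R)) => pi20.
have i2 : 'i * 'i = -1 :> R[i] by rewrite -expr2 sqr_i.
rewrite [RHS](_ : _ = - ('i * 'i) * ((2%:C * pi%:C)^-1 * (2%:C * pi%:C)) *
   ((z 0 (rshift m j))%:C * fourier2 f z)); last by ring.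
by rewrite i2 opprK mulVf// !mul1r.
Qed.

Lemma schwartz_continuous_fourier2 m n : schwartz_continuous (@fourier2 R m n).
Proof.
apply: schwartz_continuous_intertwine.
- exact: fourier2_linear.
- by move=> f z sf; have [] := fourier2_cD z sf.
- move=> i; exists (fourier2_deriv i); first exact: schwartz_continuous_fourier2_deriv.
  by move=> f sf; apply/funext => z; have [_] := fourier2_cD z sf; exact.
- move=> i; case: (split_ordP i) => j ->.
    exists (@cX R _ (lshift n j)); first exact: schwartz_continuous_cX.
    move=> f sf; apply/funext => z; rewrite /cX !fourier2E -cintegralZ; last first.
      exact/schwartz_cdominated/schwartz_fkernel.
    congr cintegral; apply/funext => t; rewrite /fkernel row_mxEl mxE; ring.
  exists (fun f z => ((2 * pi)%:C^-1 * - 'i) * cD (rshift m j) f z).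
    exact/schwartz_continuousZ/schwartz_continuous_cD.
  by move=> f sf; exact: cX_fourier2.
- exists (4 * n)%N, (2 * cauchy_mass ^+ n); split.
    by rewrite mulr_ge0// exprn_ge0// cauchy_mass_ge0.
  move=> f z sf _; rewrite fourier2E; apply: norm_cintegral.
    exact/schwartz_cdominated/schwartz_fkernel.
  by move=> y; exact: fkernel_bound.
Qed.

Lemma row_mx_0l n (x : 'rV[R]_0) (y : 'rV[R]_n) : row_mx x y = y :> 'rV[R]_(0 + n).
Proof.
apply/rowP => i; rewrite -[RHS](row_mxEr x y 0 i).
by congr (row_mx _ _ 0 _); exact: val_inj.
Qed.

(** With an empty block of parameters, the results on the partial transform
    become results on the full one. *)
Lemma fourier_fourier2 n (f : cfun R n) : fourier f = @fourier2 R 0 n f.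
Proof.
apply/funext => w; rewrite /fourier2 /fourier.
congr cintegral; apply/funext => t; congr (_ * _).
  congr (expi (- (_ * dotp _ _))); apply/rowP => i; rewrite mxE; congr (w 0 _).
  exact: val_inj.
by congr f; rewrite row_mx_0l.
Qed.

Lemma schwartz_continuous_fourier n : schwartz_continuous (@fourier R n).
Proof.
rewrite (_ : @fourier R n = @fourier2 R 0 n); first exact: (@schwartz_continuous_fourier2 0 n).
by apply/funext => f; exact: fourier_fourier2.
Qed.

Lemma schwartz_fourier n (f : cfun R n) : schwartz f -> schwartz (fourier f).
Proof. by have [_ + _] := schwartz_continuous_fourier n; exact. Qed.

Lemma dotpNl n (x y : 'rV[R]_n) : dotp (- x) y = - dotp x y.
Proof. by rewrite dotpC dotpNr dotpC. Qed.

Lemma ifourier_fourier n (f : cfun R n) x : ifourier f x = fourier f (- x).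
Proof.
by congr cintegral; apply/funext => w; rewrite dotpNr mulrN opprK dotpC.
Qed.

Lemma schwartz_continuous_opp n : schwartz_continuous (pull (@GRing.opp 'rV[R]_n)).
Proof.
apply: (schwartz_continuous_pull (B' := -%R)).
- by affmap_tac.
- by affmap_tac.
- exact: opprK.
Qed.

Lemma schwartz_continuous_ifourier n : schwartz_continuous (@ifourier R n).
Proof.
rewrite (_ : @ifourier R n = fun f => pull -%R (fourier f)).
  apply: schwartz_continuous_comp; first exact: schwartz_continuous_fourier.
  exact: schwartz_continuous_opp.
by apply/funext => f; apply/funext => x; exact: ifourier_fourier.
Qed.

End FourierContinuity.

(** * Gaussians and Fourier inversion *)

Section Inversion.
Context {R : realType}.

Definition sqnorm n (x : 'rV[R]_n) : R := dotp x x.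
Definition gaussR n (x : 'rV[R]_n) : R := expR (- (pi * sqnorm x)).
Definition gaussC n : cfun R n := fun x => (gaussR x)%:C.

(** Products of these polynomials with the Gaussian form the stable class to
    which [schwartz_family] is applied. *)
Inductive cpoly n : cfun R n -> Prop :=
| cpoly_cst c : cpoly (fun=> c)
| cpoly_X i p : cpoly p -> cpoly (cX i p)
| cpoly_add p q : cpoly p -> cpoly q -> cpoly (fun x => p x + q x).

Lemma cpoly_cdiff n (p : cfun R n) x : cpoly p -> cdiff p x.
Proof.
elim=> [c|i q _ IH|q r _ IH1 _ IH2].
- exact: cdiff_cst.
- by apply: cdiffM => //; exact: cdiff_coord.
- exact: cdiffD.
Qed.

Lemma cpolyZ n c (p : cfun R n) : cpoly p -> cpoly (fun x => c * p x).
Proof.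
elim=> [d|i q _ IH|q r _ IH1 _ IH2].
- exact: cpoly_cst.
- rewrite (_ : (fun _ => _) = cX i (fun x => c * q x)); first exact: cpoly_X.
  by apply/funext => x; rewrite /cX mulrCA.
- under eq_fun do rewrite mulrDr; exact: cpoly_add.
Qed.

Lemma cpoly_cD n i (p : cfun R n) : cpoly p -> cpoly (cD i p).
Proof.
elim=> [c|j q cq IH|q r cq IH1 cr IH2].
- rewrite (_ : cD i _ = fun=> 0); first exact: cpoly_cst.
  by apply/funext => x; rewrite /cD cderive_cst.
- rewrite (_ : cD i _ = fun x => ((delta_mx 0 i : 'rV[R]_n) 0 j)%:C * q x + cX j (cD i q) x).
    by apply: cpoly_add; [exact: cpolyZ|exact: cpoly_X].
  apply/funext => x; rewrite /cD cderiveM; [|exact: cdiff_coord|exact: cpoly_cdiff].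
  by rewrite cderive_real derive_coord.
- rewrite (_ : cD i _ = fun x => cD i q x + cD i r x); first exact: cpoly_add.
  by apply/funext => x; rewrite /cD cderiveD//; exact: cpoly_cdiff.
Qed.

Lemma cpoly_bound n (p : cfun R n) : cpoly p ->
  exists N C, 0 <= C /\ forall x, normc (p x) <= C * (1 + `|x|) ^+ N.
Proof.
elim=> [c|i q _ [N [C [C0 H]]]|q r _ [N1 [C1 [C10 H1]]] _ [N2 [C2 [C20 H2]]]].
- by exists 0%N, (normc c); rewrite normc_ge0; split => // x; rewrite expr0 mulr1.
- exists N.+1, C; split => // x; rewrite /cX Normc.normcM normc_real exprS mulrCA.
  by apply: ler_pM; rewrite ?normc_ge0// (le_trans (norm_coord _ _))// lerDr.
- exists (N1 + N2)%N, (C1 + C2); split => [|x]; first exact: addr_ge0.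
  rewrite (le_trans (le_normcD _ _))// mulrDl lerD//.
    rewrite (le_trans (H1 x))// ler_wpM2l// ler_weXn2l ?onenorm_ge1// leq_addr//.
  by rewrite (le_trans (H2 x))// ler_wpM2l// ler_weXn2l ?onenorm_ge1// leq_addl.
Qed.

Lemma sqnorm_ge n (x : 'rV[R]_n) : `|x| ^+ 2 <= sqnorm x.
Proof.
have s0 : 0 <= sqnorm x by apply: sumr_ge0 => i _; rewrite -expr2 sqr_ge0.
rewrite -[leRHS]sqr_sqrtr//; apply: lerXn2r; rewrite ?nnegrE ?sqrtr_ge0//.
rewrite [leLHS](mx_normrE x); apply: bigmax_le => [|[i j] _ /=]; first exact: sqrtr_ge0.
rewrite (ord1 i) -sqrtr_sqr; apply: ler_wsqrtr.
rewrite /sqnorm /dotp (bigD1 j)//= -expr2 lerDl sumr_ge0// => k _.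
by rewrite -expr2 sqr_ge0.
Qed.

(** With [r = `|x|]: [(1 + r) ^ N <= exp (N r)], the Gaussian is at most [exp
    (- r ^ 2)], and [N r - r ^ 2 <= N ^ 2]. *)
Lemma gauss_bound n N (x : 'rV[R]_n) :
  (1 + `|x|) ^+ N * gaussR x <= expR (N%:R ^+ 2).
Proof.
apply: (@le_trans _ _ (expR (N%:R * `|x|) * expR (- `|x| ^+ 2))).
  apply: ler_pM; rewrite ?expR_ge0 ?exprn_ge0 ?addr_ge0//.
    rewrite expRM_natl; apply: lerXn2r; rewrite ?nnegrE ?addr_ge0 ?expR_ge0//.
    exact: expR_ge1Dx.
  rewrite ler_expR lerN2 (le_trans (sqnorm_ge x))// ler_peMl//.
    by rewrite (le_trans _ (sqnorm_ge x))// sqr_ge0.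
  by rewrite (le_trans _ (pi_ge2 R))// ler1n.
rewrite -expRD ler_expR.
have := sqr_ge0 (N%:R - `|x|); have := sqr_ge0 (N%:R : R); have := sqr_ge0 (`|x|).
have : 0 <= N%:R * `|x| by rewrite mulr_ge0.
nra.
Qed.

Lemma differentiable_gaussR n (x : 'rV[R]_n) : differentiable (@gaussR n) x /\
  forall i, 'D_(delta_mx 0 i) (@gaussR n) x = - (2 * pi * x 0 i) * gaussR x.
Proof.
have dq : differentiable (fun y : 'rV[R]_n => - (pi * sqnorm y)) x.
  have Q : quad (fun y : 'rV[R]_n => - pi * sqnorm y).
    by apply: quadZ; apply: quad_dotp; exact: affmap_id.
  have [+ _] := Q => /(_ x).
  by under eq_fun do rewrite mulNr.
split; first by have [] := derive_chain 0 (@is_derive_expR R) dq.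
move=> i; have [_ ->] := derive_chain (delta_mx 0 i) (@is_derive_expR R) dq.
rewrite mulrC -/(gaussR x); congr (_ * _).
have dc k : differentiable (fun y : 'rV[R]_n => y 0 k * y 0 k) x.
  by apply: difM; exact: differentiable_coord.
have ds : differentiable (@sqnorm n) x by exact: difsum.
under eq_fun do rewrite -mulNr.
rewrite derZ// dersum// (bigD1 i)//= big1 => [|k /negPf ki].
  rewrite derM; [|exact: differentiable_coord..].
  by rewrite derive_coord mxE !eqxx mul1r mulr1 addr0; ring.
rewrite derM; [|exact: differentiable_coord..].
by rewrite derive_coord mxE ki andbF mul0r mulr0 addr0.
Qed.

Lemma cdiff_gaussC n (x : 'rV[R]_n) : cdiff (@gaussC n) x.
Proof. by apply: cdiff_real; have [] := differentiable_gaussR x. Qed.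

Lemma cD_gaussC n i (x : 'rV[R]_n) :
  cD i (@gaussC n) x = (- (2 * pi))%:C * cX i (@gaussC n) x.
Proof.
rewrite /cD cderive_real; have [_ ->] := differentiable_gaussR x.
by rewrite /cX /gaussC !(rmorphN, rmorphM (real_complex R)) /=; ring.
Qed.

Lemma schwartz_gaussC n : schwartz (@gaussC n).
Proof.
apply: (@schwartz_family _ _ (fun f => exists2 p, cpoly p & f = fun x => p x * gaussC x)).
- move=> _ x [p cp ->]; apply: cdiffM; first exact: cpoly_cdiff.
  exact: cdiff_gaussC.
- move=> _ i [p cp ->].
  exists (fun x => cD i p x + (- (2 * pi))%:C * cX i p x).
    by apply: cpoly_add; [exact: cpoly_cD|exact/cpolyZ/cpoly_X].
  apply/funext => x; rewrite /cD cderiveM; [|exact: cpoly_cdiff|exact: cdiff_gaussC].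
  rewrite -/(cD i (@gaussC n) x) cD_gaussC /cX; ring.
- move=> _ i [p cp ->]; exists (cX i p); first exact: cpoly_X.
  by apply/funext => x; rewrite /cX mulrA.
- move=> _ [p /cpoly_bound[N [C [C0 H]]] ->].
  exists (C * expR (N%:R ^+ 2)) => x; rewrite Normc.normcM normc_real.
  rewrite (ger0_norm (expR_ge0 _)).
  apply: le_trans (ler_wpM2r (expR_ge0 _) (H x)) _.
  by rewrite -mulrA ler_wpM2l// gauss_bound.
- by exists (fun=> 1); [exact: cpoly_cst|apply/funext => x; rewrite mul1r].
Qed.

Lemma gauss_integral1 : \int[@lebesgue_measure R]_t expR (- (pi * t ^+ 2)) = 1.
Proof.
have d : dominated (@gauss_fun R).
  split; first exact: continuous_gauss_fun.
  exists 1 => t; rewrite mul1r ger0_norm ?gauss_fun_ge0// /gauss_fun /cauchy.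
  rewrite expRN lef_pV2 ?posrE ?expR_gt0 ?onesqr_gt0//.
  exact: expR_ge1Dx.
have s0 : Num.sqrt pi != 0 :> R by rewrite gt_eqF// sqrtr_gt0 pi_gt0.
have := integral_affine 0 s0 d.
under eq_Rintegral => t _ do rewrite addr0 /gauss_fun exprMn sqr_sqrtr ?pi_ge0//.
move=> ->; rewrite [X in _ * X](_ : _ = Num.sqrt pi); last first.
  by rewrite /Rintegral integralT_gauss.
rewrite gtr0_norm ?sqrtr_gt0 ?pi_gt0//.
by rewrite mulVf.
Qed.

Lemma integral_gaussR n : integral_Rn (@gaussR n) = 1.
Proof.
elim: n => [|n IHn] /=.
  by rewrite /gaussR /sqnorm /dotp big_ord0 mulr0 oppr0 expR0.
have E t (y : 'rV[R]_n) : gaussR (rV_cons t y) = expR (- (pi * t ^+ 2)) * gaussR y.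
  rewrite /gaussR -expRD -opprD -mulrDr /sqnorm /dotp big_ord_recl rV_cons0 -expr2.
  by under eq_bigr do rewrite rV_consS.
rewrite -[RHS]gauss_integral1; apply: eq_Rintegral => t _.
rewrite (_ : (fun _ => _) = fun y => expR (- (pi * t ^+ 2)) * gaussR y); last first.
  by apply/funext => y; exact: E.
rewrite integral_RnZ ?IHn ?mulr1//.
by have [] := schwartz_cdominated (schwartz_gaussC n).
Qed.

Lemma fourier_cD n (f : cfun R n) z i : schwartz f ->
  cdiff (fourier f) z /\
  cD i (fourier f) z = fourier (fun x => (- (2 * pi))%:C * 'i * cX i f x) z.
Proof.
move=> sf; rewrite !fourier_fourier2.
have [d D] := @fourier2_cD R 0 n f z sf; split; first exact: d.
have := D (rshift 0 i); rewrite /fourier2_deriv (unsplitK (inr i)).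
by have -> : rshift 0 i = i :> 'I_n by exact: val_inj.
Qed.

Lemma cX_fourier n (f : cfun R n) i : schwartz f ->
  cX i (fourier f) = fourier (fun z => ((2 * pi)%:C^-1 * - 'i) * cD i f z).
Proof.
move=> sf; rewrite !fourier_fourier2.
have := @cX_fourier2 R 0 n f i sf.
by have -> : rshift 0 i = i :> 'I_n by exact: val_inj.
Qed.

Lemma fourierZ n c (f : cfun R n) z : schwartz f ->
  fourier (fun x => c * f x) z = c * fourier f z.
Proof.
move=> sf; have [L _ _] := @schwartz_continuous_fourier R n.
have := L c f _ sf (@schwartz0 R n); move/(congr1 (fun g => g z)).
under [X in fourier X]eq_fun do rewrite addr0.
move=> ->; rewrite [X in _ + X](_ : _ = 0) ?addr0//.
by rewrite /fourier; under eq_fun do rewrite mulr0; rewrite cintegral0.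
Qed.

(** On each line through the origin, the quotient of [g] by the Gaussian has a
    vanishing derivative. *)
Lemma gauss_ode n (g : 'rV[R]_n -> R) : (forall x, differentiable g x) ->
  (forall i x, 'D_(delta_mx 0 i) g x = - (2 * pi * x 0 i) * g x) ->
  forall z, g z = g 0 * gaussR z.
Proof.
move=> dg Dg z.
pose s : R := pi * sqnorm z.
pose p (t : R) := g (0 + t *: z) * expR (s * (t * t)).
have dp (t : R) : is_derive t (1 : R) p 0.
  have d1 := is_derive_line 0 z t dg.
  apply: is_derive_eq; rewrite /GRing.scale /=.
  rewrite (_ : \sum_i _ = - (2 * s * t) * g (0 + t *: z)); first by ring.
  rewrite (eq_bigr (fun i => (- 2 * pi * t * g (0 + t *: z)) * (z 0 i * z 0 i))).
    by rewrite -mulr_sumr /s /sqnorm /dotp; ring.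
  by move=> i _; rewrite Dg !mxE; ring.
have : `|p 1 - p 0| <= 0.
  by rewrite -[leRHS](mul0r (1 - 0 : R)); apply: (mean_value_bound ler01 dp) => t _; rewrite normr0.
rewrite normr_le0 subr_eq0 => /eqP.
rewrite /p scale0r scale1r addr0 add0r !mulr0 expR0 !mulr1 => <-.
by rewrite -mulrA -expRD /gaussR -/s subrr expR0 mulr1.
Qed.

Lemma cintegral_gaussC n : cintegral (@gaussC n) = 1.
Proof.
rewrite /cintegral /= integral_gaussR.
have := @cintegral0 R n; rewrite /cintegral /= => /(congr1 (@complex.Im R)) /= ->.
by [].
Qed.

(** The Fourier transform exchanges derivatives and coordinates, hence the
    transform of the Gaussian solves the differential equation of [gauss_ode];
    its value at the origin is the integral of the Gaussian. *)
Lemma fourier_gaussC n : fourier (@gaussC n) = @gaussC n.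
Proof.
have sG := schwartz_gaussC n.
have D i (z : 'rV[R]_n) :
    cD i (fourier (@gaussC n)) z = (- (2 * pi * z 0 i))%:C * fourier (@gaussC n) z.
  have [_ ->] := fourier_cD z i sG.
  have sD := schwartz_cD i sG.
  rewrite (_ : (fun _ => _) = fun x => 'i * cD i (@gaussC n) x); last first.
    by apply/funext => x; rewrite cD_gaussC; ring.
  rewrite fourierZ//.
  have := congr1 (fun g => g z) (cX_fourier i sG) => /=.
  rewrite fourierZ// /cX => E.
  rewrite !(rmorphN, rmorphM (real_complex R)) /= -mulNr -mulrA E.
  have := @pi2_neq0 R; rewrite (rmorphM (real_complex R)) => pi20.
  move: (2%:C * pi%:C : R[i]) pi20 => k k0.
  rewrite [RHS](_ : _ = (k * k^-1) * ('i * fourier (cD i (@gaussC n)) z)); last by ring.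
  by rewrite divff// mul1r.
have d z : cdiff (fourier (@gaussC n)) z by have [] := schwartz_cdiff0 z (schwartz_fourier sG).
have F0 : fourier (@gaussC n) 0 = 1.
  rewrite -[RHS](cintegral_gaussC n); congr cintegral; apply/funext => x.
  have -> : dotp x 0 = 0 by rewrite /dotp big1// => i _; rewrite mxE mulr0.
  by rewrite mulr0 oppr0 expi0 mul1r.
apply/funext => z; rewrite [LHS]complexE.
have -> : Re (fourier (@gaussC n) z) = Re (fourier (@gaussC n) 0) * gaussR z.
  apply: (@gauss_ode n (fun x => Re (fourier (@gaussC n) x))) => [x|i x]; first by have [] := d x.
  by have := congr1 (@complex.Re R) (D i x); rewrite cReM /= mul0r subr0.
have -> : Im (fourier (@gaussC n) z) = Im (fourier (@gaussC n) 0) * gaussR z.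
  apply: (@gauss_ode n (fun x => Im (fourier (@gaussC n) x))) => [x|i x]; first by have [] := d x.
  by have := congr1 (@complex.Im R) (D i x); rewrite cImM /= mul0r addr0.
by rewrite F0 /= mul1r mul0r mulr0 addr0.
Qed.

Lemma gaussR_le1 n (x : 'rV[R]_n) : gaussR x <= 1.
Proof.
rewrite -expR0 ler_expR oppr_le0 mulr_ge0 ?pi_ge0//.
by apply: sumr_ge0 => i _; rewrite -expr2 sqr_ge0.
Qed.

Lemma schwartz_fourier_integrand n (f : cfun R n) w : schwartz f ->
  schwartz (fun x => expi (- (2 * pi * dotp x w)) * f x).
Proof.
move=> sf; apply: schwartz_chirp => //.
by have := quad_phase (- (2 * pi)) w; under eq_fun do rewrite mulNr.
Qed.

Lemma cdominatedM n (f g : cfun R n) M : (forall x, cdiff f x) ->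
  (forall x, normc (f x) <= M) -> schwartz g -> cdominated (fun x => f x * g x).
Proof.
move=> df fM sg; have [C HC] := schwartz_wtn sg.
apply: (@cdominated_intro _ _ _ (M * C)) => [x|y].
  by apply: cdiffM => //; exact: schwartz_cdiff0.
by rewrite Normc.normcM -mulrA ler_pM ?normc_ge0.
Qed.

(** Insert the factor [gaussC (e *: w)] into the integral of the transform.
    Exchanging the integrals and using [fourier_gaussC] turns it into the
    average of [f (e *: x)] against a Gaussian of mass 1, and both
    replacements have an error of order [e]. *)
Lemma cintegral_fourier n (f : cfun R n) : schwartz f -> cintegral (fourier f) = f 0.
Proof.
move=> sf; have sF := schwartz_fourier sf; have sG := schwartz_gaussC n.
have sGe (e : R) : 0 < e -> schwartz (fun w => @gaussC n (e *: w)).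
  by move=> e0; apply: schwartz_dilate; rewrite ?gt_eqF.
pose A (e : R) := cintegral (fun w => fourier f w * gaussC (e *: w)).
(* Integrating first over [w] gives the transform of a dilated Gaussian. *)
have A2 e : 0 < e -> A e = cintegral (fun x => f (e *: x) * gaussC x).
  move=> e0; have e0' : e != 0 by rewrite gt_eqF.
  pose h : cfun R (n + n) := fun z => expi (- (2 * pi) * dotp (rsubmx z) (lsubmx z)) *
    ctensor (fun w => gaussC (e *: w)) f z.
  have sh : schwartz h.
    apply: schwartz_chirp; last by apply: schwartz_tensor => //; exact: sGe.
    by apply: quadZ; apply: quad_dotp; affmap_tac.
  transitivity (cintegral (fun w => cintegral (fun x => h (row_mx w x)))).
    congr cintegral; apply/funext => w; rewrite mulrC /fourier -cintegralZ; last first.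
      exact/schwartz_cdominated/schwartz_fourier_integrand.
    congr cintegral; apply/funext => x.
    by rewrite /h /ctensor row_mxKl row_mxKr mulNr; ring.
  rewrite cintegral_swap; last exact: schwartz_cdominated.
  have E x : cintegral (fun w => h (row_mx w x)) =
      (((`|e|^-1) ^+ n)%:C * (f x * gaussC (e^-1 *: x))).
    pose F : cfun R n := fun w => expi (- (2 * pi * dotp w (e^-1 *: x))) * gaussC w.
    have sF' : schwartz F by exact: schwartz_fourier_integrand.
    have -> : gaussC (e^-1 *: x) = cintegral F by rewrite -[in LHS]fourier_gaussC.
    rewrite mulrCA -(cintegral_affine 0 e0' (schwartz_cdominated sF')) -cintegralZ; last first.
      apply: schwartz_cdominated; under eq_fun do rewrite addr0.
      exact: (schwartz_dilate e0' sF').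
    congr cintegral; apply/funext => w; rewrite /h /F /ctensor row_mxKl row_mxKr addr0.
    rewrite (_ : dotp (e *: w) (e^-1 *: x) = dotp x w); first by rewrite mulNr; ring.
    by apply: eq_bigr => i _; rewrite !mxE; field.
  have dg : cdominated (fun x => f (e *: x) * gaussC x).
    have sfe := schwartz_dilate e0' sf.
    have [M HM] := schwartz_bounded sfe.
    by apply: cdominatedM HM sG => x; exact: schwartz_cdiff0.
  under eq_fun do rewrite E.
  have ei0 : e^-1 != 0 by rewrite invr_eq0.
  have := cintegral_affine 0 ei0 dg.
  under eq_fun do rewrite addr0 scalerA divff// scale1r.
  rewrite normfV invrK => E2.
  have d2 : cdominated (fun x => f x * gaussC (e^-1 *: x)).
    have ei : 0 < e^-1 by rewrite invr_gt0.
    have [M HM] := schwartz_bounded sf.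
    by apply: cdominatedM HM (sGe _ ei) => x; exact: schwartz_cdiff0.
  rewrite cintegralZ// E2 mulrA -(rmorphM (real_complex R)) -exprMn mulVf ?expr1n ?mul1r//.
  by rewrite normr_eq0.
have [M1 H1] : exists M, forall x, weighted_deriv (4 * n).+2 [::] (fourier f) x <= M.
  by have [_ _] := sF; exact.
have [Mf Hf] := schwartz_bounded sf.
have [Ml Hl] := schwartz_lip 0 sf.
have [Mg Hg] : exists M, forall x, weighted_deriv (4 * n).+1 [::] (@gaussC n) x <= M.
  by have [_ _] := sG; exact.
have Mf0 : 0 <= Mf by apply: le_trans (Hf 0); exact: normc_ge0.
pose L := `|Ml| + 2 * Mf.
have L0 : 0 <= L by rewrite addr_ge0// mulr_ge0.
(* The Taylor bound covers increments of norm at most 1, and boundedness of [f]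
   the larger ones. *)
have fL h : normc (f h - f 0) <= L * `|h|.
  have [h1|h1] := leP `|h| 1.
    have := Hl 0 h h1; rewrite expr0 mul1r add0r => /le_trans; apply.
    by rewrite ler_wpM2r// (le_trans (ler_norm _))// lerDl mulr_ge0.
  apply: (@le_trans _ _ (2 * Mf)).
    rewrite mulr_natl mulr2n (le_trans (le_normcD _ _))// normcN; apply: lerD; exact: Hf.
  apply: (@le_trans _ _ (2 * Mf * `|h|)); first by rewrite ler_peMr ?mulr_ge0// ltW.
  by rewrite ler_wpM2r// lerDr.
apply/eqP; rewrite -subr_eq0; apply/eqP/normc_le0.
apply: (@le0_of_le_small R _ (2 * cauchy_mass ^+ n * (pi * n%:R * M1) +
  2 * cauchy_mass ^+ n * (L * Mg))) => e /andP[e0 e1].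
have -> : cintegral (fourier f) - f 0 = (cintegral (fourier f) - A e) + (A e - f 0).
  by rewrite addrA subrK.
rewrite mulrDl (le_trans (le_normcD _ _))//; apply: lerD.
  have dA : cdominated (fun w => fourier f w * gaussC (e *: w)).
    have [M HM] := schwartz_bounded sF.
    by apply: cdominatedM HM (sGe _ e0) => x; exact: schwartz_cdiff0.
  have dd : cdominated (fun w => fourier f w - fourier f w * gaussC (e *: w)).
    rewrite (_ : (fun _ => _) = fun w => (1 - gaussC (e *: w)) * fourier f w); last first.
      by apply/funext => w; ring.
    apply: (@cdominatedM _ _ _ 2) => // w.
      apply: cdiffD; first exact: cdiff_cst.
      under eq_fun do rewrite -mulN1r.
      by apply: cdiffM; [exact: cdiff_cst|exact/schwartz_cdiff0/sGe].
    rewrite (le_trans (le_normcD _ _))// normcN Normc.normc1 normc_real.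
    by rewrite (ger0_norm (expR_ge0 _)) (_ : 2 = 1 + 1)// lerD2l gaussR_le1.
  have -> : cintegral (fourier f) - A e =
      cintegral (fun w => fourier f w - fourier f w * gaussC (e *: w)).
    have := cintegral_lin (-1) dA (schwartz_cdominated sF).
    by under eq_fun do rewrite mulN1r addrC; rewrite mulN1r [X in _ = X -> _]addrC => ->.
  rewrite -mulrA; apply: norm_cintegral => // w.
  apply: weight_wtn; last exact: normc_ge0.
  have -> : fourier f w - fourier f w * gaussC (e *: w) =
     fourier f w * (1 - gaussR (e *: w))%:C.
    by rewrite /gaussC (rmorphB (real_complex R)) /=; ring.
  rewrite Normc.normcM normc_real ger0_norm ?subr_ge0 ?gaussR_le1//.
  (* [exp (- r) >= 1 - r]; the loss of two powers of the weight is paid by [H1]. *)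
  have g1 : 1 - gaussR (e *: w) <= pi * n%:R * e * (1 + `|w|) ^+ 2.
    rewrite lerBlDr -lerBlDl; apply: le_trans (expR_ge1Dx _).
    rewrite lerD2l lerN2.
    rewrite -!mulrA ler_wpM2l ?pi_ge0//.
    apply: (@le_trans _ _ (n%:R * (`|e *: w| * `|e *: w|))).
      by apply: le_trans (dotp_le _ _); rewrite ler_norm.
    rewrite ler_wpM2l// normrZ (gtr0_norm e0) -mulrA ler_wpM2l ?(ltW e0)//.
    rewrite mulrCA -[leRHS]mul1r; apply: ler_pM => //; rewrite ?mulr_ge0 ?(ltW e0)//.
    by rewrite expr2; apply: ler_pM => //; rewrite lerDr.
  rewrite mulrA.
  apply: (@le_trans _ _ ((1 + `|w|) ^+ (4 * n) * normc (fourier f w) *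
     (pi * n%:R * e * (1 + `|w|) ^+ 2))).
    by rewrite ler_wpM2l// mulr_ge0 ?normc_ge0// exprn_ge0// addr_ge0.
  have := H1 w; rewrite weighted_derivE -addn2 exprD => H1w.
  rewrite [leLHS](_ : _ = pi * n%:R * e *
     ((1 + `|w|) ^+ (4 * n) * (1 + `|w|) ^+ 2 * normc (fourier f w))); last by ring.
  rewrite [leRHS](_ : _ = pi * n%:R * e * M1); last by ring.
  by apply: ler_wpM2l => //; rewrite !mulr_ge0 ?pi_ge0// ltW.
rewrite A2//.
have dg : cdominated (fun x => (f (e *: x) - f 0) * gaussC x).
  apply: (@cdominatedM _ _ _ (2 * Mf)) => // x.
    apply: cdiffD; last exact: cdiff_cst.
    by apply/schwartz_cdiff0/schwartz_dilate; rewrite ?gt_eqF.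
  rewrite mulr_natl mulr2n (le_trans (le_normcD _ _))// normcN; apply: lerD; exact: Hf.
have -> : cintegral (fun x => f (e *: x) * gaussC x) - f 0 =
    cintegral (fun x => (f (e *: x) - f 0) * gaussC x).
  have := cintegral_lin (f 0) (schwartz_cdominated sG) dg.
  rewrite cintegral_gaussC mulr1.
  under eq_fun do rewrite mulrBl addrC subrK.
  by move=> ->; rewrite addrAC subrr add0r.
rewrite -mulrA; apply: norm_cintegral => // x.
apply: weight_wtn; last exact: normc_ge0.
rewrite Normc.normcM.
apply: (@le_trans _ _ ((1 + `|x|) ^+ (4 * n) * (L * e * (1 + `|x|) * normc (gaussC x)))).
  rewrite ler_wpM2l ?exprn_ge0 ?addr_ge0// ler_wpM2r ?normc_ge0//.
  apply: (le_trans (fL _)); rewrite normrZ (gtr0_norm e0) -!mulrA.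
  by rewrite !ler_wpM2l ?(ltW e0)// lerDr.
have := Hg x; rewrite weighted_derivE exprSr => Hgx.
rewrite [leLHS](_ : _ = L * e *
   ((1 + `|x|) ^+ (4 * n) * (1 + `|x|) * normc (gaussC x))); last by ring.
rewrite [leRHS](_ : _ = L * e * Mg); last by ring.
by apply: ler_wpM2l => //; rewrite mulr_ge0// ltW.
Qed.

Lemma fourier_translate n (f : cfun R n) a w : schwartz f ->
  fourier (fun x => f (x + a)) w = expi (2 * pi * dotp a w) * fourier f w.
Proof.
move=> sf; rewrite /fourier -cintegralZ; last first.
  exact/schwartz_cdominated/schwartz_fourier_integrand.
rewrite -[RHS](cintegral_shift a); last first.
  exact/schwartz_cdominated/schwartzZ/schwartz_fourier_integrand.
congr cintegral; apply/funext => x; rewrite mulrA -expiD; congr (expi _ * _).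
by rewrite (dotpC (x + a)) dotpDr !(dotpC w); ring.
Qed.

(** Inversion at [a] is inversion at 0 for the translate of [f]. *)
Lemma fourierK n (f : cfun R n) : schwartz f -> ifourier (fourier f) = f.
Proof.
move=> sf; apply/funext => a; rewrite -[in RHS](add0r a).
rewrite -[RHS](cintegral_fourier (schwartz_translate a sf)).
by congr cintegral; apply/funext => w; rewrite fourier_translate.
Qed.

Lemma ifourierK n (f : cfun R n) : schwartz f -> fourier (ifourier f) = f.
Proof.
move=> sf; apply/funext => x; rewrite -[in RHS](fourierK sf).
rewrite -[RHS](cintegral_opp 0); last first.
  apply: schwartz_cdominated; apply: schwartz_chirp; last exact: schwartz_fourier.
  by under eq_fun do rewrite dotpC; exact: quad_phase.
congr cintegral; apply/funext => w; rewrite sub0r ifourier_fourier.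
by rewrite dotpNr dotpC mulrN.
Qed.

End Inversion.

(** * Complex conjugation *)

Section Conjugation.
Context {R : realType}.

Definition cconj n (f : cfun R n) : cfun R n := fun x => (f x)^*%R.

Lemma conj_complexE (z : R[i]) : z^*%R = Re z -i* Im z.
Proof. by case: z. Qed.

Lemma cdiff_conj n (f : cfun R n) x : cdiff f x -> cdiff (cconj f) x.
Proof.
move=> [d1 d2]; split.
  by rewrite (_ : (fun y => _) = fun y => Re (f y))//; apply/funext => y; rewrite /cconj conj_complexE.
rewrite (_ : (fun y => _) = - (fun y => Im (f y))); first exact: differentiableN.
by apply/funext => y; rewrite /cconj conj_complexE.
Qed.

Lemma cD_conj n (f : cfun R n) i : (forall x, cdiff f x) -> cD i (cconj f) = cconj (cD i f).
Proof.
move=> df; apply/funext => x; have [_ d2] := df x.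
rewrite {2}/cconj conj_complexE /cD /cderive /=; congr (_ +i* _).
  by congr ('D_ _ _ _); apply/funext => y; rewrite /cconj conj_complexE.
rewrite (_ : (fun y => _) = - (fun y => Im (f y))).
  by rewrite deriveN//; exact: diff_derivable.
by apply/funext => y; rewrite /cconj conj_complexE.
Qed.

Lemma schwartz_conj n (f : cfun R n) : schwartz f -> schwartz (cconj f).
Proof.
move=> sf.
have E s : cDs s (cconj f) = cconj (cDs s f).
  by elim: s => //= i s ->; rewrite cD_conj// => x; exact: schwartz_cdiff.
apply: schwartzI => [s x|N s]; first by rewrite E; apply: cdiff_conj; exact: schwartz_cdiff.
have [_ _ /(_ N s)[M HM]] := sf; exists M => x.
move: (HM x); rewrite !weighted_derivE E /cconj conj_complexE.
by rewrite [in normc (_ -i* _)]/Normc.normc /= sqrrN; case: (cDs s f x).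
Qed.

Lemma cintegral_conj n (f : cfun R n) : cdominated f ->
  cintegral (cconj f) = (cintegral f)^*%R.
Proof.
move=> [d1 d2]; rewrite conj_complexE /cintegral /=; congr (_ +i* _).
  by congr integral_Rn; apply/funext => y; rewrite /cconj conj_complexE.
rewrite -mulN1r -integral_RnZ//.
by congr integral_Rn; apply/funext => y; rewrite /cconj conj_complexE mulN1r.
Qed.

End Conjugation.

(** * Unimodular linear maps *)

Section LinearMaps.
Context {R : realType}.

Definition unimodular n (L : 'rV[R]_n -> 'rV[R]_n) :=
  exists2 M, (forall x, L x = x *m M) & `|\det M| = 1.

Lemma lin1_mxE n (L : 'rV[R]_n -> 'rV[R]_n) M :
  (forall x, L x = x *m M) -> lin1_mx L = M.
Proof. by move=> LM; apply/matrixP => i j; rewrite mxE LM -rowE mxE. Qed.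

Lemma affmap_linear n m (L : 'rV[R]_n -> 'rV[R]_m) : affmap L -> L 0 = 0 ->
  exists M, forall x, L x = x *m M.
Proof.
move=> [M [b LM]] L0; exists M => x.
by have := LM 0; rewrite L0 mul0mx add0r LM => <-; rewrite addr0.
Qed.

Lemma unimodular_comp n (L1 L2 : 'rV[R]_n -> 'rV[R]_n) :
  unimodular L1 -> unimodular L2 -> unimodular (fun x => L2 (L1 x)).
Proof.
move=> [M1 E1 D1] [M2 E2 D2]; exists (M1 *m M2) => [x|]; first by rewrite E2 E1 mulmxA.
by rewrite det_mulmx normrM D1 D2 mulr1.
Qed.

Lemma mulmx_cancel n (L L' : 'rV[R]_n -> 'rV[R]_n) M M' : (forall x, L x = x *m M) ->
  (forall x, L' x = x *m M') -> cancel L L' -> M *m M' = 1%:M.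
Proof.
move=> LM LM' K; apply/row_matrixP => i.
by rewrite rowE mulmxA -LM -LM' K row1.
Qed.

(** The determinant of an involution has square 1. Factoring a map into
    involutions replaces the computation of its determinant. *)
Lemma unimodular_involutive n (L : 'rV[R]_n -> 'rV[R]_n) :
  affmap L -> L 0 = 0 -> involutive L -> unimodular L.
Proof.
move=> aL L0 K; have [M LM] := affmap_linear aL L0; exists M => //.
have := congr1 (fun A => `|\det A|) (mulmx_cancel LM LM K).
rewrite det_mulmx det1 normr1 normrM -expr2 => /eqP.
by rewrite sqrp_eq1// => /eqP.
Qed.

Lemma unimodular_cancel n (L L' : 'rV[R]_n -> 'rV[R]_n) : unimodular L ->
  affmap L' -> L' 0 = 0 -> cancel L L' -> unimodular L'.
Proof.
move=> [M LM D] aL L0 K; have [M' LM'] := affmap_linear aL L0; exists M' => //.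
have := congr1 (fun A => `|\det A|) (mulmx_cancel LM LM' K).
by rewrite det_mulmx det1 normr1 normrM D mul1r.
Qed.

Lemma distr_comp_unimodular n (T : distr R n) (L L' : 'rV[R]_n -> 'rV[R]_n) phi :
  unimodular L -> cancel L L' -> distr_comp T L phi = T (fun y => phi (L' y)).
Proof.
move=> [M LM D] K; rewrite /distr_comp (lin1_mxE LM) D invr1 mul1r.
congr T; apply/funext => y; congr phi.
have uM : M \in unitmx by rewrite unitmxE unitfE -normr_gt0 D.
by rewrite -[LHS]K LM mulmxKV.
Qed.

End LinearMaps.

(** * The linear maps of phase space *)

Section PhaseSpaceMaps.
Context {R : realType}.
Local Notation R4 d := 'rV[R]_((d + d) + (d + d)).

Lemma row2P m n (z : 'rV[R]_(m + n)) : exists x y, z = row_mx x y.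
Proof. by exists (lsubmx z), (rsubmx z); rewrite hsubmxK. Qed.

Lemma row4P d (z : R4 d) :
  exists x y u v, z = row_mx (row_mx x y) (row_mx u v).
Proof.
have [a [b ->]] := row2P z; have [x [y ->]] := row2P a; have [u [v ->]] := row2P b.
by exists x, y, u, v.
Qed.

Lemma wigner_mapE d tau (x t : 'rV[R]_d) :
  wigner_map tau (row_mx x t) = row_mx (x + tau *: t) (x - (1 - tau) *: t).
Proof. by rewrite /wigner_map row_mxKl row_mxKr. Qed.

Lemma op_mapE d tau (x y : 'rV[R]_d) :
  op_map tau (row_mx x y) = row_mx ((1 - tau) *: x + tau *: y) (x - y).
Proof. by rewrite /op_map row_mxKl row_mxKr. Qed.

Lemma affmap_wigner_map d tau : affmap (@wigner_map R d tau).
Proof. by rewrite /wigner_map; affmap_tac. Qed.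

Lemma affmap_op_map d tau : affmap (@op_map R d tau).
Proof. by rewrite /op_map; affmap_tac. Qed.

Lemma wigner_mapK d tau : cancel (@wigner_map R d tau) (op_map tau).
Proof.
move=> z; have [x [t ->]] := row2P z; rewrite wigner_mapE op_mapE.
by congr row_mx; row_ring.
Qed.

Lemma op_mapK d tau : cancel (@op_map R d tau) (wigner_map tau).
Proof.
move=> z; have [x [t ->]] := row2P z; rewrite op_mapE wigner_mapE.
by congr row_mx; row_ring.
Qed.

Ltac invol2 L := apply: unimodular_involutive;
  [ by rewrite /L; affmap_tac
  | rewrite /L !linear0 -row_mx0; congr row_mx; row_ring
  | move=> z; rewrite /L !(row_mxKl, row_mxKr) -[RHS]hsubmxK; congr row_mx; row_ring ].

Lemma unimodular_wigner_map d tau : unimodular (@wigner_map R d tau).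
Proof.
(* The shear of the first variable is an involution once the sign of the second
   one is changed; [L2] undoes the sign. *)
pose L1 (z : 'rV[R]_(d + d)) := row_mx (lsubmx z + tau *: rsubmx z) (- rsubmx z).
pose L2 (z : 'rV[R]_(d + d)) := row_mx (lsubmx z) (- rsubmx z).
pose L3 (z : 'rV[R]_(d + d)) := row_mx (lsubmx z) (lsubmx z - rsubmx z).
have -> : @wigner_map R d tau = fun z => L3 (L2 (L1 z)).
  apply/funext => z; rewrite /L3 /L2 /L1 !(row_mxKl, row_mxKr) /wigner_map.
  by congr row_mx; row_ring.
apply: (@unimodular_comp _ _ (fun z => L2 (L1 z))); first apply: unimodular_comp.
- by invol2 L1.
- by invol2 L2.
- by invol2 L3.
Qed.

Lemma unimodular_op_map d tau : unimodular (@op_map R d tau).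
Proof.
apply: (unimodular_cancel (unimodular_wigner_map d tau) (affmap_op_map d tau) _ (@wigner_mapK d tau)).
by rewrite /op_map !linear0 -row_mx0; congr row_mx; row_ring.
Qed.

(** The inverse of [A_inv], with [z] read as (r, y, rho, eta). *)
Definition A_map d tau (z : R4 d) : R4 d :=
  let r := lsubmx (lsubmx z) in let y := rsubmx (lsubmx z) in
  let rho := lsubmx (rsubmx z) in let eta := rsubmx (rsubmx z) in
  row_mx (row_mx (r + tau *: (y - r)) (tau *: rho - (1 - tau) *: eta))
         (row_mx (rho + eta) (y - r)).

Definition unshear d tau (z : R4 d) : R4 d :=
  let r := lsubmx (lsubmx z) in let rho := rsubmx (lsubmx z) in
  let u := lsubmx (rsubmx z) in let v := rsubmx (rsubmx z) in
  row_mx (row_mx (r + tau *: v) (rho - (1 - tau) *: u)) (row_mx u v).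

Lemma A_invK d tau : cancel (@A_inv R d tau) (A_map tau).
Proof.
move=> z; have [x [y [u [v ->]]]] := row4P z.
rewrite /A_inv /A_map !(row_mxKl, row_mxKr).
by congr (row_mx (row_mx _ _) (row_mx _ _)); row_ring.
Qed.

Lemma A_mapK d tau : cancel (@A_map d tau) (A_inv tau).
Proof.
move=> z; have [x [y [u [v ->]]]] := row4P z.
rewrite /A_inv /A_map !(row_mxKl, row_mxKr).
by congr (row_mx (row_mx _ _) (row_mx _ _)); row_ring.
Qed.

Lemma shearK d tau : cancel (@shear R d tau) (unshear tau).
Proof.
move=> z; have [x [y [u [v ->]]]] := row4P z.
rewrite /shear /unshear !(row_mxKl, row_mxKr).
by congr (row_mx (row_mx _ _) (row_mx _ _)); row_ring.
Qed.

Lemma swap_midK d : involutive (@swap_mid R d).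
Proof.
move=> z; have [x [y [u [v ->]]]] := row4P z.
by rewrite /swap_mid !(row_mxKl, row_mxKr).
Qed.

Lemma affmap_A_inv d tau : affmap (@A_inv R d tau).
Proof. by rewrite /A_inv; affmap_tac. Qed.

Lemma affmap_A_map d tau : affmap (@A_map d tau).
Proof. by rewrite /A_map; affmap_tac. Qed.

Lemma affmap_swap_mid d : affmap (@swap_mid R d).
Proof. by rewrite /swap_mid; affmap_tac. Qed.

Lemma unimodular_swap_mid d : unimodular (@swap_mid R d).
Proof.
apply: (unimodular_involutive (affmap_swap_mid d) _ (@swap_midK d)).
by rewrite /swap_mid !linear0 !row_mx0.
Qed.

Lemma unimodular_involutive4 d (L : R4 d -> R4 d) :
  affmap L -> L (row_mx (row_mx 0 0) (row_mx 0 0)) = row_mx (row_mx 0 0) (row_mx 0 0) ->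
  (forall x y u v, L (L (row_mx (row_mx x y) (row_mx u v))) = row_mx (row_mx x y) (row_mx u v)) ->
  unimodular L.
Proof.
move=> aL L0 LL; apply: unimodular_involutive => //; first by move: L0; rewrite !row_mx0.
by move=> z; have [x [y [u [v ->]]]] := row4P z.
Qed.

Ltac invol4 L := apply: unimodular_involutive4;
  [ by rewrite /L; affmap_tac
  | rewrite /L !(row_mxKl, row_mxKr); congr (row_mx (row_mx _ _) (row_mx _ _)); row_ring
  | move=> x y u v; rewrite /L !(row_mxKl, row_mxKr);
    congr (row_mx (row_mx _ _) (row_mx _ _)); row_ring ].

Lemma unimodular_A_inv d tau : unimodular (@A_inv R d tau).
Proof.
(* [L1] exchanges xi and v up to sign; the other factors act separately on the
   pairs (x, v) and (u, xi). *)
pose L1 (z : R4 d) := row_mx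
  (row_mx (lsubmx (lsubmx z)) (- rsubmx (rsubmx z)))
  (row_mx (lsubmx (rsubmx z)) (- rsubmx (lsubmx z))).
pose L2 (z : R4 d) := row_mx
  (row_mx (lsubmx (lsubmx z) + tau *: rsubmx (lsubmx z)) (- rsubmx (lsubmx z)))
  (row_mx (- lsubmx (rsubmx z)) (rsubmx (rsubmx z) + tau *: lsubmx (rsubmx z))).
pose L3 (z : R4 d) := row_mx
  (row_mx (lsubmx (lsubmx z)) (- rsubmx (lsubmx z)))
  (row_mx (lsubmx (rsubmx z)) (rsubmx (rsubmx z))).
pose L4 (z : R4 d) := row_mx
  (row_mx (lsubmx (lsubmx z)) (lsubmx (lsubmx z) - rsubmx (lsubmx z)))
  (row_mx (- lsubmx (rsubmx z) - rsubmx (rsubmx z)) (rsubmx (rsubmx z))).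
have -> : @A_inv R d tau = fun z => L4 (L3 (L2 (L1 z))).
  apply/funext => z; rewrite /L4 /L3 /L2 /L1 !(row_mxKl, row_mxKr) /A_inv.
  by congr (row_mx (row_mx _ _) (row_mx _ _)); row_ring.
apply: (@unimodular_comp _ _ (fun z => L3 (L2 (L1 z)))).
  apply: (@unimodular_comp _ _ (fun z => L2 (L1 z))).
    apply: unimodular_comp.
      by invol4 L1.
    by invol4 L2.
  by invol4 L3.
by invol4 L4.
Qed.

Lemma unimodular_shear d tau : unimodular (@shear R d tau).
Proof.
pose L1 (z : R4 d) := row_mx
  (row_mx (lsubmx (lsubmx z) - tau *: rsubmx (rsubmx z))
          (rsubmx (lsubmx z) + (1 - tau) *: lsubmx (rsubmx z)))
  (row_mx (- lsubmx (rsubmx z)) (- rsubmx (rsubmx z))).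
pose L2 (z : R4 d) := row_mx
  (row_mx (lsubmx (lsubmx z)) (rsubmx (lsubmx z)))
  (row_mx (- lsubmx (rsubmx z)) (- rsubmx (rsubmx z))).
have -> : @shear R d tau = fun z => L2 (L1 z).
  apply/funext => z; rewrite /L2 /L1 !(row_mxKl, row_mxKr) /shear.
  by congr (row_mx (row_mx _ _) (row_mx _ _)); row_ring.
apply: unimodular_comp; first by invol4 L1.
by invol4 L2.
Qed.

End PhaseSpaceMaps.

(** * Fourier multipliers as shears *)

Section PartialFourier.
Context {R : realType}.

Lemma dotpDl n (x y z : 'rV[R]_n) : dotp (x + y) z = dotp x z + dotp y z.
Proof. by rewrite dotpC dotpDr !(dotpC z). Qed.

Lemma dotpZr n c (x y : 'rV[R]_n) : dotp x (c *: y) = c * dotp x y.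
Proof. by rewrite /dotp mulr_sumr; apply: eq_bigr => i _; rewrite mxE; ring. Qed.

Lemma dotpZl n c (x y : 'rV[R]_n) : dotp (c *: x) y = c * dotp x y.
Proof. by rewrite dotpC dotpZr dotpC. Qed.

Lemma dotp_row m n (x u : 'rV[R]_m) (y v : 'rV[R]_n) :
  dotp (row_mx x y) (row_mx u v) = dotp x u + dotp y v.
Proof.
rewrite /dotp big_split_ord /=.
by congr (_ + _); apply: eq_bigr => i _; rewrite ?(row_mxEl, row_mxEr).
Qed.

Definition dotpE := (@dotpDl, @dotpDr, @dotpZl, @dotpZr, @dotpNl, @dotpNr).

Lemma schwartz_phase n (f : cfun R n) w : schwartz f ->
  schwartz (fun x => expi (2 * pi * dotp w x) * f x).
Proof.
by apply: schwartz_chirp; under eq_fun do rewrite dotpC; exact: quad_phase.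
Qed.

Lemma schwartz_ifourier n (f : cfun R n) : schwartz f -> schwartz (ifourier f).
Proof. by have [_ + _] := @schwartz_continuous_ifourier R n; apply. Qed.

Lemma schwartz_fourier2 m n (f : cfun R (m + n)) : schwartz f -> schwartz (fourier2 f).
Proof. by have [_ + _] := @schwartz_continuous_fourier2 R m n; apply. Qed.

Lemma schwartz_ifourier2 m n (f : cfun R (m + n)) : schwartz f -> schwartz (ifourier2 f).
Proof.
move=> sf.
pose B (z : 'rV[R]_(m + n)) := row_mx (lsubmx z) (- rsubmx z).
rewrite (_ : ifourier2 f = fun z => fourier2 f (B z)); last first.
  apply/funext => z; rewrite /ifourier2 /fourier2 /B row_mxKl row_mxKr.
  by rewrite ifourier_fourier.
apply: (@schwartz_pull _ _ _ B B); last exact: schwartz_fourier2.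
- by rewrite /B; affmap_tac.
- by rewrite /B; affmap_tac.
- by move=> z; rewrite /B row_mxKl row_mxKr opprK hsubmxK.
Qed.

Lemma fourier2_row m n (f : cfun R (m + n)) x w :
  fourier2 f (row_mx x w) = fourier (fun t => f (row_mx x t)) w.
Proof. by rewrite /fourier2 row_mxKl row_mxKr. Qed.

Lemma ifourier2_row m n (f : cfun R (m + n)) x w :
  ifourier2 f (row_mx x w) = ifourier (fun t => f (row_mx x t)) w.
Proof. by rewrite /ifourier2 row_mxKl row_mxKr. Qed.

Lemma cintegral_ifourier n (f : cfun R n) : schwartz f -> cintegral (ifourier f) = f 0.
Proof.
move=> sf; rewrite -(cintegral_fourier sf).
rewrite -[RHS](cintegral_opp 0); last exact/schwartz_cdominated/schwartz_fourier.
by congr cintegral; apply/funext => x; rewrite sub0r ifourier_fourier.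
Qed.

(** In the second block of variables the two inverse transforms compose to a
    reflection. *)
Lemma ifourier_ifourier2 m n (h : cfun R (m + n)) w1 w2 : schwartz h ->
  ifourier (ifourier2 h) (row_mx w1 w2) =
  cintegral (fun x => expi (2 * pi * dotp w1 x) * h (row_mx x (- w2))).
Proof.
move=> sh; rewrite {1}/ifourier cintegral_cat; congr cintegral; apply/funext => x.
have sx := schwartz_slice x sh.
under eq_fun do rewrite dotp_row mulrDr expiD -mulrA ifourier2_row.
rewrite cintegralZ; last exact/schwartz_cdominated/schwartz_phase/schwartz_ifourier.
congr (_ * _); transitivity (ifourier (ifourier (fun t => h (row_mx x t))) w2) => //.
by rewrite ifourier_fourier ifourierK.
Qed.

Lemma schwartz_slicel m n (f : cfun R (m + n)) y : schwartz f ->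
  schwartz (fun x : 'rV[R]_m => f (row_mx x y)).
Proof.
apply: (@schwartz_pull _ _ _ _ lsubmx); [by affmap_tac..|].
by move=> x; rewrite row_mxKl.
Qed.

Lemma schwartz_product m n p (B1 : 'rV[R]_p -> 'rV[R]_m) (B2 : 'rV[R]_p -> 'rV[R]_n)
    (B' : 'rV[R]_(m + n) -> 'rV[R]_p) (f : cfun R m) (g : cfun R n) :
  affmap B1 -> affmap B2 -> affmap B' -> (forall x, B' (row_mx (B1 x) (B2 x)) = x) ->
  schwartz f -> schwartz g -> schwartz (fun x => f (B1 x) * g (B2 x)).
Proof.
move=> a1 a2 a' K sf sg.
have := schwartz_pull (affmap_row a1 a2) a' K (schwartz_tensor sf sg).
by rewrite /ctensor; under eq_fun do rewrite row_mxKl row_mxKr.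
Qed.

(** The transpose, on test functions, of the metaplectic multipliers [mu_NT]
    and [mu_NinvT]. *)
Definition fmult n c (phi : cfun R (n + n)) : cfun R (n + n) :=
  fourier (fun w => N_mult c w * ifourier phi w).

Lemma quad_N_mult n c :
  quad (fun w : 'rV[R]_(n + n) => 2 * pi * c * dotp (lsubmx w) (rsubmx w)).
Proof. by apply: quadZ; apply: quad_dotp; affmap_tac. Qed.

Lemma schwartz_continuous_fmult n c : schwartz_continuous (@fmult n c).
Proof.
have h := schwartz_continuous_comp (schwartz_continuous_chirp (quad_N_mult n c))
  (@schwartz_continuous_fourier R (n + n)).
exact: (schwartz_continuous_comp (@schwartz_continuous_ifourier R (n + n)) h).
Qed.

Lemma fmult0 n (phi : cfun R (n + n)) : schwartz phi -> fmult 0 phi = phi.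
Proof.
move=> sphi; rewrite -[RHS]ifourierK//; congr fourier; apply/funext => w.
by rewrite /N_mult mulr0 mul0r expi0 mul1r.
Qed.

Definition shear2 n c (z : 'rV[R]_(n + n)) : 'rV[R]_(n + n) :=
  row_mx (lsubmx z + c *: rsubmx z) (rsubmx z).

Lemma schwartz_shear2 n c (h : cfun R (n + n)) : schwartz h ->
  schwartz (fun z => h (shear2 c z)).
Proof.
apply: (@schwartz_pull _ _ _ _ (shear2 (- c))); rewrite /shear2; [by affmap_tac..|].
move=> z; rewrite !(row_mxKl, row_mxKr) -[RHS]hsubmxK; congr row_mx; row_ring.
Qed.

(** In [ifourier_ifourier2] the phase of [N_mult c] combines with [expi (2 *
    pi * dotp w1 x)] and translates [x] by a multiple of [w2]: this is the
    shear, seen after a Fourier transform. *)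
Lemma fmult_ifourier2 n c (h : cfun R (n + n)) : schwartz h ->
  fmult c (ifourier2 h) = ifourier2 (fun z => h (shear2 c z)).
Proof.
move=> sh; have sh' := schwartz_shear2 c sh.
rewrite -[RHS]ifourierK; last exact: schwartz_ifourier2.
congr fourier; apply/funext => w; have [w1 [w2 ->]] := row2P w.
rewrite !ifourier_ifourier2// /N_mult row_mxKl row_mxKr.
have s1 := schwartz_slicel (- w2) sh.
rewrite -cintegralZ; last exact/schwartz_cdominated/schwartz_phase.
rewrite -[LHS](cintegral_shift (- (c *: w2))); last first.
  exact/schwartz_cdominated/schwartzZ/schwartz_phase.
congr cintegral; apply/funext => x; rewrite /shear2 row_mxKl row_mxKr mulrA -expiD.
rewrite scalerN; congr (expi _ * _).
by rewrite !dotpE; ring.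
Qed.

End PartialFourier.

(** * Covariance of the bilinear Wigner transform *)

Section Covariance.
Context {R : realType}.

(** Both sides are [2 ^+ n] times the integral of [H]. On the left, write
    [fourier g] as an integral over [t] and substitute [q = 2 y - 2 xi]; on
    the right, substitute [t = - v - s / 2]. *)
Lemma bwigner_fourier n (f g : cfun R n) (xi v : 'rV[R]_n) : schwartz f -> schwartz g ->
  cintegral (fun q => expi (2 * pi * dotp v q) *
    (f (xi + (1 / 2) *: q) * fourier g (xi - (1 - 1 / 2) *: q))) =
  cintegral (fun s => expi (2 * pi * dotp xi s) *
    (fourier f (- v + (1 / 2) *: s) * g (- v - (1 - 1 / 2) *: s))).
Proof.
move=> sf sg.
pose H : cfun R n := fun t => expi (- (2 * pi * dotp (2 *: xi) (t + v))) *
  (fourier f (- (t + 2 *: v)) * g t).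
have n2 : (2 : R) != 0 by [].
have sH : schwartz H.
  apply: schwartz_chirp.
    under eq_fun do rewrite -mulNr; apply: quadZ; apply: quad_dotp; affmap_tac.
  apply: (@schwartz_product _ _ _ _ _ id rsubmx) => //; [by affmap_tac..| |].
    by move=> x; rewrite row_mxKr.
  exact: schwartz_fourier.
transitivity ((2 ^+ n)%:C * cintegral H); last first.
  have m2 : - (1 / 2) != 0 :> R by rewrite oppr_eq0 div1r invr_eq0.
  have := cintegral_affine (- v) m2 (schwartz_cdominated sH).
  rewrite normrN ger0_norm// div1r invrK => <-; congr cintegral; apply/funext => s.
  rewrite /H; congr (expi _ * (fourier f _ * g _)); last 2 first.
  - by apply/rowP => i; rewrite !mxE; field.
  - by apply/rowP => i; rewrite !mxE; field.
  - by rewrite !dotpE; field.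
pose G : cfun R (n + n) := fun z =>
  expi (2 * pi * dotp v (lsubmx z) - 2 * pi * dotp (rsubmx z) (xi - (1 - 1 / 2) *: lsubmx z)) *
  (f (xi + (1 / 2) *: lsubmx z) * g (rsubmx z)).
have sG : schwartz G.
  apply: schwartz_chirp.
    apply: quadD; first by apply: quadZ; apply: quad_dotp; affmap_tac.
    by under eq_fun do rewrite -mulNr; apply: quadZ; apply: quad_dotp; affmap_tac.
  apply: (@schwartz_product _ _ _ _ _ _ (fun z => row_mx (2 *: (lsubmx z - xi)) (rsubmx z))) => //;
    [by affmap_tac..|].
  move=> z; rewrite row_mxKl row_mxKr -[RHS]hsubmxK; congr row_mx.
  by apply/rowP => i; rewrite !mxE; field.
transitivity (cintegral (fun q => cintegral (fun t => G (row_mx q t)))).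
  congr cintegral; apply/funext => q; rewrite mulrA /fourier -cintegralZ; last first.
    exact/schwartz_cdominated/schwartz_fourier_integrand.
  congr cintegral; apply/funext => t; rewrite /G row_mxKl row_mxKr expiD.
  by ring.
rewrite cintegral_swap; last exact: schwartz_cdominated.
rewrite -cintegralZ; last exact: schwartz_cdominated.
congr cintegral; apply/funext => t.
have sGt := schwartz_slicel t sG.
have := cintegral_affine (- (2 *: xi)) n2 (schwartz_cdominated sGt).
rewrite ger0_norm// => /(congr1 (fun c => (2 ^+ n)%:C * c)).
rewrite mulrA -(rmorphM (real_complex R)) -exprMn mulfV// expr1n mul1r => <-.
congr (_ * _); transitivity (expi (- (2 * pi * dotp (2 *: xi) (t + v))) * g t *
    fourier f (- (t + 2 *: v))); last by rewrite /H; ring.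
rewrite /fourier -cintegralZ; last exact/schwartz_cdominated/schwartz_fourier_integrand.
congr cintegral; apply/funext => y; rewrite /G row_mxKl row_mxKr.
rewrite (_ : xi + (1 / 2) *: (2 *: y - 2 *: xi) = y); last first.
  by apply/rowP => i; rewrite !mxE; field.
transitivity (expi (- (2 * pi * dotp (2 *: xi) (t + v)) +
  - (2 * pi * dotp y (- (t + 2 *: v)))) * (f y * g t)); last by rewrite expiD; ring.
congr (expi _ * _); rewrite !dotpE (dotpC t y) (dotpC v y) (dotpC t xi) (dotpC v xi); by field.
Qed.

(** A translation of the first variable reduces the map to [(s, t) -> (s, s -
    t)], a reflection in the second variable. *)
Lemma cintegral_wigner_map d tau (f : cfun R (d + d)) : schwartz f ->
  cintegral (fun z => f (wigner_map tau z)) = cintegral f.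
Proof.
move=> sf; have sw : schwartz (fun z => f (wigner_map tau z)).
  by apply: (schwartz_pull (affmap_wigner_map _ _) (affmap_op_map _ tau)) sf; exact: wigner_mapK.
pose B (z : 'rV[R]_(d + d)) := row_mx (lsubmx z) (lsubmx z - rsubmx z).
have sB : schwartz (fun z => f (B z)).
  apply: (@schwartz_pull _ _ _ _ B) sf; rewrite /B; [by affmap_tac..|].
  by move=> z; rewrite !(row_mxKl, row_mxKr) -[RHS]hsubmxK; congr row_mx; row_ring.
transitivity (cintegral (fun t => cintegral (fun s => f (B (row_mx s t))))).
  rewrite cintegral_cat (@cintegral_swap _ _ _ (fun z => f (wigner_map tau z))); last exact: schwartz_cdominated.
  congr cintegral; apply/funext => t.
  rewrite -[RHS](cintegral_shift (tau *: t)); last exact: (schwartz_cdominated (schwartz_slicel t sB)).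
  congr cintegral; apply/funext => s; rewrite wigner_mapE /B row_mxKl row_mxKr.
  by congr (f (row_mx _ _)); row_ring.
rewrite -(@cintegral_swap _ _ _ (fun z => f (B z))); last exact: schwartz_cdominated.
rewrite cintegral_cat; congr cintegral; apply/funext => s.
rewrite -[RHS](cintegral_opp s); last exact: (schwartz_cdominated (schwartz_slice s sf)).
by congr cintegral; apply/funext => t; rewrite /B row_mxKl row_mxKr.
Qed.

(** The cross-Wigner transform without conjugation and with the opposite sign
    of the frequency; for [tau = 1 / 2] it has the symplectic covariance of
    the Weyl quantization. *)
Definition bwigner n tau (f g : cfun R n) : cfun R (n + n) :=
  ifourier2 (fun z => ctensor f g (wigner_map tau z)).

Lemma schwartz_bwigner_arg n tau (f g : cfun R n) : schwartz f -> schwartz g ->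
  schwartz (fun z => ctensor f g (wigner_map tau z)).
Proof.
move=> sf sg; apply: (schwartz_pull (affmap_wigner_map _ _) (affmap_op_map _ tau)).
  exact: wigner_mapK.
exact: schwartz_tensor.
Qed.

Lemma bwignerE n tau (f g : cfun R n) x u : bwigner tau f g (row_mx x u) =
  cintegral (fun p => expi (2 * pi * dotp u p) *
    (f (x + tau *: p) * g (x - (1 - tau) *: p))).
Proof.
rewrite /bwigner ifourier2_row; congr cintegral; apply/funext => p.
by rewrite wigner_mapE /ctensor row_mxKl row_mxKr.
Qed.

(** The shear of [fmult_ifourier2] composed with [wigner_map tau] is
    [wigner_map (tau + c)]. *)
Lemma fmult_bwigner n c tau (f g : cfun R n) : schwartz f -> schwartz g ->
  fmult c (bwigner tau f g) = bwigner (tau + c) f g.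
Proof.
move=> sf sg; rewrite fmult_ifourier2; last exact: schwartz_bwigner_arg.
congr ifourier2; apply/funext => z; congr ctensor.
rewrite /wigner_map /shear2 row_mxKl row_mxKr.
by congr row_mx; row_ring.
Qed.

(** Covariance under a partial Fourier transform, which rotates the plane of a
    variable and its dual. *)
Lemma bwigner_fourier2 d (phi k : cfun R (d + d)) x xi u v : schwartz phi -> schwartz k ->
  bwigner (1 / 2) phi (fourier2 k) (row_mx (row_mx x xi) (row_mx u v)) =
  bwigner (1 / 2) (fourier2 phi) k (row_mx (row_mx x (- v)) (row_mx u xi)).
Proof.
move=> sp sk; rewrite !bwignerE !cintegral_cat; congr cintegral; apply/funext => p.
pose f := fun m => phi (row_mx (x + (1 / 2) *: p) m).
pose g := fun t => k (row_mx (x - (1 - 1 / 2) *: p) t).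
have sf : schwartz f by exact: schwartz_slice.
have sg : schwartz g by exact: schwartz_slice.
transitivity (expi (2 * pi * dotp u p) * cintegral (fun q => expi (2 * pi * dotp v q) *
    (f (xi + (1 / 2) *: q) * fourier g (xi - (1 - 1 / 2) *: q)))).
  rewrite -cintegralZ; last first.
    apply/schwartz_cdominated/schwartz_phase.
    have := schwartz_slice xi (schwartz_bwigner_arg (1 / 2) sf (schwartz_fourier sg)).
    by under eq_fun do rewrite wigner_mapE /ctensor row_mxKl row_mxKr.
  congr cintegral; apply/funext => q.
  rewrite !scale_row_mx opp_row_mx !add_row_mx fourier2_row dotp_row (mulrDr (2 * pi)) expiD.
  by rewrite -!mulrA.
rewrite bwigner_fourier// -cintegralZ; last first.
  apply/schwartz_cdominated/schwartz_phase.
  have := schwartz_slice (- v) (schwartz_bwigner_arg (1 / 2) (schwartz_fourier sf) sg).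
  by under eq_fun do rewrite wigner_mapE /ctensor row_mxKl row_mxKr.
congr cintegral; apply/funext => q.
rewrite !scale_row_mx opp_row_mx !add_row_mx fourier2_row dotp_row (mulrDr (2 * pi)) expiD.
by rewrite -!mulrA.
Qed.

(** Covariance under a linear change of variables, which acts on the dual
    variables by the inverse transpose. *)
Lemma bwigner_wigner_map d tau (f g : cfun R (d + d)) z u xi : schwartz f -> schwartz g ->
  bwigner (1 / 2) (fun z => f (wigner_map tau z)) (fun z => g (wigner_map tau z))
    (row_mx z (row_mx u xi)) =
  bwigner (1 / 2) f g (row_mx (wigner_map tau z)
    (row_mx (xi + (1 - tau) *: u) (- xi + tau *: u))).
Proof.
move=> sf sg; rewrite !bwignerE -[RHS](cintegral_wigner_map tau); last first.
  apply: schwartz_phase.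
  have := schwartz_slice (wigner_map tau z) (schwartz_bwigner_arg (1 / 2) sf sg).
  by under eq_fun do rewrite wigner_mapE /ctensor row_mxKl row_mxKr.
have [s [t ->]] := row2P z.
congr cintegral; apply/funext => w; have [p [q ->]] := row2P w.
rewrite !wigner_mapE !scale_row_mx !opp_row_mx !add_row_mx !wigner_mapE.
congr (expi _ * (f (row_mx _ _) * g (row_mx _ _))); last 4 first.
- by row_ring.
- by row_ring.
- by row_ring.
- by row_ring.
by rewrite !dotp_row !dotpE; ring.
Qed.

(** The integral over [eta] is a Fourier inversion: it evaluates at 0 the
    variable dual to [eta]. *)
Lemma cintegral_ifourier2 d (h : cfun R ((d + d) + (d + d))) r rho : schwartz h ->
  cintegral (fun w => ifourier2 h (row_mx (row_mx r (lsubmx w)) (row_mx rho (rsubmx w)))) =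
  cintegral (fun t => expi (2 * pi * dotp rho t) *
    cintegral (fun y => h (row_mx (row_mx r y) (row_mx t 0)))).
Proof.
move=> sh; rewrite cintegral_cat.
transitivity (cintegral (fun y => cintegral (fun t => expi (2 * pi * dotp rho t) *
    h (row_mx (row_mx r y) (row_mx t 0))))).
  congr cintegral; apply/funext => y; under eq_fun do rewrite row_mxKl row_mxKr.
  pose k : cfun R (d + d) := fun w => h (row_mx (row_mx r y) w).
  have sk : schwartz k by exact: schwartz_slice.
  pose X : cfun R (d + d) := fun z =>
    expi (2 * pi * dotp rho (lsubmx z)) * ifourier2 k z.
  have sX : schwartz X.
    apply: schwartz_chirp; last exact: schwartz_ifourier2.
    by apply: quadZ; apply: quad_dotp; affmap_tac.
  transitivity (cintegral (fun eta => cintegral (fun t => X (row_mx t eta)))).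
    congr cintegral; apply/funext => eta; rewrite ifourier2_row {1}/ifourier cintegral_cat.
    congr cintegral; apply/funext => t; rewrite /X row_mxKl ifourier2_row.
    rewrite /ifourier -cintegralZ; last first.
      exact/schwartz_cdominated/schwartz_phase/schwartz_slice.
    by congr cintegral; apply/funext => s; rewrite dotp_row mulrDr expiD mulrA.
  rewrite -cintegral_swap; last exact: schwartz_cdominated.
  congr cintegral; apply/funext => t; rewrite /X; under eq_fun do rewrite row_mxKl ifourier2_row.
  rewrite cintegralZ; last exact/schwartz_cdominated/schwartz_ifourier/schwartz_slice.
  by congr (_ * _); rewrite cintegral_ifourier//; exact: schwartz_slice.
pose Y : cfun R (d + d) := fun z => expi (2 * pi * dotp rho (rsubmx z)) *
  h (row_mx (row_mx r (lsubmx z)) (row_mx (rsubmx z) 0)).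
have sY : schwartz Y.
  apply: schwartz_chirp.
    by apply: quadZ; apply: quad_dotp; affmap_tac.
  apply: (@schwartz_pull _ _ _ _
    (fun z => row_mx (rsubmx (lsubmx z)) (lsubmx (rsubmx z)))) sh; [by affmap_tac..|].
  by move=> z; rewrite !(row_mxKl, row_mxKr) hsubmxK.
transitivity (cintegral (fun y => cintegral (fun t => Y (row_mx y t)))).
  by congr cintegral; apply/funext => y; congr cintegral; apply/funext => t; rewrite /Y row_mxKl row_mxKr.
rewrite cintegral_swap; last exact: schwartz_cdominated.
congr cintegral; apply/funext => t; rewrite -cintegralZ.
  by congr cintegral; apply/funext => y; rewrite /Y row_mxKl row_mxKr.
exact: schwartz_cdominated (schwartz_slice r (schwartz_slicel (row_mx t 0) sh)).
Qed.

End Covariance.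

(** * The intertwining relation *)

Section Quantization.
Context {R : realType}.

Lemma tempered_comp n m (a : distr R m) (T : cfun R n -> cfun R m) :
  tempered a -> schwartz_continuous T -> tempered (fun phi => a (T phi)).
Proof.
move=> [lin [N [C aC]]] [linT sT cT]; split=> [c phi psi sp ss|].
  by rewrite linT// lin//; exact: sT.
have [N' [C' [C'0 bT]]] := cT N; exists N', (`|C| * C') => phi sp.
apply: (le_trans (aC _ (sT _ sp))).
apply: (@le_trans _ _ (`|C| * schwartz_norm N (T phi))).
  by rewrite ler_wpM2r ?ler_norm//; apply: schwartz_norm_ge0; exact: sT.
by rewrite -mulrA ler_wpM2l//; exact: bT.
Qed.

Lemma OpE n tau (sigma : distr R (n + n)) F phi :
  Op tau sigma F phi = sigma (bwigner tau phi F).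
Proof.
by rewrite /Op /op_kernel (distr_comp_unimodular _ _ (unimodular_op_map n tau) (@op_mapK _ n tau)).
Qed.

(** The transpose of [sigma_of]: test functions are integrated over the
    variables (y, eta) of the constant factor; the factor 1 is the density of
    [distr1]. *)
Definition integral_out d (chi : cfun R ((d + d) + (d + d))) : cfun R (d + d) :=
  fun z => cintegral (fun w => 1 * chi (swap_mid (row_mx z w))).

Lemma sigma_ofE d (a : distr R (d + d)) chi :
  sigma_of a chi = a (integral_out chi).
Proof.
by rewrite /sigma_of (distr_comp_unimodular _ _ (unimodular_swap_mid d) (@swap_midK _ d)).
Qed.

(** An integral over the last variables is a partial Fourier transform at
    frequency 0. *)
Lemma schwartz_continuous_integral_out d : schwartz_continuous (@integral_out d).
Proof.
rewrite (_ : @integral_out d =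
    fun chi => pull (fun z => row_mx z 0) (fourier2 (pull (@swap_mid R d) chi))); last first.
  apply/funext => chi; apply/funext => z.
  rewrite /pull fourier2_row; congr cintegral; apply/funext => w.
  by rewrite -[X in dotp w X](scale0r 0) dotpZr mul0r mulr0 oppr0 expi0.
have s1 : schwartz_continuous (pull (@swap_mid R d)).
  exact: (schwartz_continuous_pull (affmap_swap_mid d) (affmap_swap_mid d) (@swap_midK R d)).
have s2 : schwartz_continuous (pull (fun z : 'rV[R]_(d + d) => row_mx z (0 : 'rV[R]_(d + d)))).
  apply: (@schwartz_continuous_pull _ _ _ _ lsubmx); [by affmap_tac..|].
  by move=> z; rewrite row_mxKl.
have s3 := @schwartz_continuous_fourier2 R (d + d) (d + d).
exact: (schwartz_continuous_comp s1 (schwartz_continuous_comp s3 s2)).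
Qed.

(** The transpose of the linear map that sends a to [symbol_b tau1 tau2 a]. *)
Definition symbol_transpose d tau1 tau2 (phi : cfun R ((d + d) + (d + d))) : cfun R (d + d) :=
  integral_out (fmult (tau2 - 1 / 2)
    (pull (A_map tau1) (fmult (- (tau2 - 1 / 2)) phi))).

Lemma symbol_bE d tau1 tau2 (a : distr R (d + d)) phi :
  symbol_b tau1 tau2 a phi = a (symbol_transpose tau1 tau2 phi).
Proof.
rewrite /symbol_transpose -sigma_ofE /symbol_b /mu_NT /distr_ifourier /distr_mul /distr_fourier.
by rewrite (distr_comp_unimodular _ _ (unimodular_A_inv d tau1) (@A_invK _ d tau1)).
Qed.

Lemma schwartz_continuous_symbol_transpose d tau1 tau2 :
  schwartz_continuous (@symbol_transpose d tau1 tau2).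
Proof.
have s1 := @schwartz_continuous_fmult R (d + d) (- (tau2 - 1 / 2)).
have s2 := schwartz_continuous_pull (@affmap_A_map R d tau1) (affmap_A_inv d tau1) (@A_mapK R d tau1).
have s3 := @schwartz_continuous_fmult R (d + d) (tau2 - 1 / 2).
have s4 := schwartz_continuous_comp s3 (schwartz_continuous_integral_out d).
exact: (schwartz_continuous_comp s1 (schwartz_continuous_comp s2 s4)).
Qed.

Lemma tempered_symbol_b d tau1 tau2 (a : distr R (d + d)) :
  tempered a -> tempered (symbol_b tau1 tau2 a).
Proof.
move=> ta; rewrite (_ : symbol_b _ _ _ = fun phi => a (symbol_transpose tau1 tau2 phi)).
  exact: (@tempered_comp _ _ a (symbol_transpose tau1 tau2) ta (schwartz_continuous_symbol_transpose _ _ _)).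
by apply/funext => phi; rewrite symbol_bE.
Qed.

Lemma wigner_fourier2 d tau (f g : cfun R d) :
  wigner tau f g = fourier2 (fun z => ctensor f (cconj g) (wigner_map tau z)).
Proof.
apply/funext => z; congr cintegral; apply/funext => t.
by rewrite wigner_mapE /ctensor row_mxKl row_mxKr -mulrA.
Qed.

(** [A_inv tau] is the composition of the phase-space maps of
    [bwigner_fourier2] and [bwigner_wigner_map]. *)
Lemma bwigner_A_inv d tau (phi K : cfun R (d + d)) z : schwartz phi -> schwartz K ->
  bwigner (1 / 2) phi (fourier2 (fun z => K (wigner_map tau z))) z =
  bwigner (1 / 2) (fun z => fourier2 phi (op_map tau z)) K (A_inv tau z).
Proof.
move=> sp sK; have [x [xi [u [v ->]]]] := row4P z.
have sk : schwartz (fun z => K (wigner_map tau z)).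
  exact: (schwartz_pull (affmap_wigner_map _ _) (affmap_op_map _ tau) (@wigner_mapK _ _ tau)).
have sP : schwartz (fun z => fourier2 phi (op_map tau z)).
  apply: (schwartz_pull (affmap_op_map _ _) (affmap_wigner_map _ tau) (@op_mapK _ _ tau)).
  exact: schwartz_fourier2.
rewrite bwigner_fourier2//.
have := @bwigner_wigner_map R d tau _ K (row_mx x (- v)) u xi sP sK.
under [X in bwigner _ X _ _ = _ -> _]eq_fun do rewrite wigner_mapK.
by move=> ->; rewrite wigner_mapE /A_inv !(row_mxKl, row_mxKr) !scalerN opprK.
Qed.

(** The conjugate distribution of [g], applied in the second variable of
    [Psi]. *)
Definition pair_out d (g : cfun R d) (Psi : cfun R (d + d)) : cfun R d :=
  fun x => (cintegral (fun y => g y * (Psi (row_mx x y))^*%R))^*%R.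

Lemma distr_wignerE d tau (T : distr R d) (g : cfun R d) phi :
  distr_wigner tau T (distr_of_fun g) phi =
  T (pair_out g (fun z => fourier2 phi (op_map tau z))).
Proof.
by rewrite /distr_wigner /distr_fourier2
  (distr_comp_unimodular _ _ (unimodular_wigner_map d tau) (@wigner_mapK _ d tau)).
Qed.

Lemma conjM_conj (a b : R[i]) : (a * b^*%R)^*%R = b * a^*%R.
Proof.
rewrite !conj_complexE; case: a => a a'; case: b => b b'; apply/eqP.
by rewrite eq_complex /=; apply/andP; split; apply/eqP; ring.
Qed.

Lemma pair_outE d (g : cfun R d) (Psi : cfun R (d + d)) x : schwartz g -> schwartz Psi ->
  pair_out g Psi x = cintegral (fun y => Psi (row_mx x y) * (g y)^*%R).
Proof.
move=> sg sP; have sx := schwartz_slice x sP.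
rewrite /pair_out -cintegral_conj.
  by congr cintegral; apply/funext => y; rewrite /cconj conjM_conj.
apply: schwartz_cdominated.
apply: (@schwartz_product _ _ _ _ id id lsubmx g (cconj (fun y => Psi (row_mx x y)))) => //;
  [by affmap_tac..| |exact: schwartz_conj].
by move=> y; rewrite row_mxKl.
Qed.

(** The first multiplier changes the parameter from [tau2] to [1 / 2], where
    the covariance [bwigner_A_inv] cancels the change of variables [A_map];
    the second one restores [tau2]; the integration over (y, eta) then pairs
    the conjugate of [g] with the partial transform of [phi]. *)
Lemma symbol_transpose_bwigner d tau1 tau2 (f g : cfun R d) phi :
  schwartz f -> schwartz g -> schwartz phi ->
  symbol_transpose tau1 tau2 (bwigner tau2 phi (wigner tau1 f g)) =
  bwigner tau2 (pair_out g (fun z => fourier2 phi (op_map tau1 z))) f.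
Proof.
move=> sf sg sp; pose K := ctensor f (cconj g).
have sK : schwartz K by apply: schwartz_tensor => //; exact: schwartz_conj.
pose Psi z := fourier2 phi (op_map tau1 z).
have sP : schwartz Psi.
  apply: (schwartz_pull (affmap_op_map _ _) (affmap_wigner_map _ tau1) (@op_mapK _ _ tau1)).
  exact: schwartz_fourier2.
have sW : schwartz (wigner tau1 f g).
  rewrite wigner_fourier2; apply: schwartz_fourier2.
  exact: (schwartz_pull (affmap_wigner_map _ _) (affmap_op_map _ tau1) (@wigner_mapK _ _ tau1)).
rewrite /symbol_transpose fmult_bwigner//.
rewrite (_ : tau2 + - (tau2 - 1 / 2) = 1 / 2); last by ring.
rewrite (_ : pull _ _ = bwigner (1 / 2) Psi K); last first.
  apply/funext => z; rewrite /pull wigner_fourier2.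
  by have := @bwigner_A_inv d tau1 phi K (A_map tau1 z) sp sK; rewrite A_mapK.
rewrite fmult_bwigner// (_ : 1 / 2 + (tau2 - 1 / 2) = tau2); last by ring.
apply/funext => z; have [r [rho ->]] := row2P z; rewrite bwignerE.
transitivity (cintegral (fun w =>
    bwigner tau2 Psi K (row_mx (row_mx r (lsubmx w)) (row_mx rho (rsubmx w))))).
  by congr cintegral; apply/funext => w; rewrite mul1r /swap_mid !(row_mxKl, row_mxKr).
rewrite cintegral_ifourier2; last exact: schwartz_bwigner_arg.
congr cintegral; apply/funext => t; congr (_ * _).
rewrite pair_outE// [RHS]mulrC -cintegralZ; last first.
  apply: schwartz_cdominated.
  have sx := schwartz_slice (r + tau2 *: t) sP.
  apply: (@schwartz_product _ _ _ _ id id lsubmx _ (cconj g) _ _ _ _ sx) => //;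
    [by affmap_tac..| |exact: schwartz_conj].
  by move=> y; rewrite row_mxKl.
congr cintegral; apply/funext => y.
rewrite wigner_mapE !scale_row_mx !opp_row_mx !add_row_mx !scaler0 oppr0 !addr0.
by rewrite /ctensor /K /ctensor !(row_mxKl, row_mxKr) /Psi /cconj; ring.
Qed.

Lemma distr_wigner_Op d tau1 tau2 (a : distr R (d + d)) (f g : cfun R d) :
  schwartz f -> schwartz g ->
  eq_distr (distr_wigner tau1 (Op tau2 a f) (distr_of_fun g))
           (Op tau2 (symbol_b tau1 tau2 a) (wigner tau1 f g)).
Proof.
move=> sf sg phi sp.
by rewrite distr_wignerE !OpE symbol_bE symbol_transpose_bwigner.
Qed.

(** For the parameter [1 / 2] both multipliers have phase 0. *)
Lemma symbol_b_weyl d tau1 (a : distr R (d + d)) :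
  eq_distr (symbol_b tau1 (1 / 2) a) (distr_comp (sigma_of a) (@A_inv R d tau1)).
Proof.
move=> phi sp; rewrite symbol_bE.
rewrite (distr_comp_unimodular _ _ (unimodular_A_inv d tau1) (@A_invK _ d tau1)) sigma_ofE.
congr (a (integral_out _)); rewrite subrr oppr0 (fmult0 sp) fmult0//.
exact: (schwartz_pull (affmap_A_map _ _) (affmap_A_inv _ tau1) (@A_mapK _ _ tau1)).
Qed.

(** The substitution [y = v + r], [eta = u - rho] turns [A_map] into the
    inverse of [shear]. *)
Lemma sigma_A_inv_sheared d tau (a : distr R (d + d)) :
  eq_distr (distr_comp (sigma_of a) (@A_inv R d tau)) (a_sheared tau a).
Proof.
move=> phi sp.
rewrite (distr_comp_unimodular _ _ (unimodular_A_inv d tau) (@A_invK _ d tau)) sigma_ofE.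
rewrite /a_sheared (distr_comp_unimodular _ _ (unimodular_shear d tau) (@shearK _ d tau)).
congr a; apply/funext => z; have [r [rho ->]] := row2P z.
have sA : schwartz (fun z => phi (A_map tau z)).
  exact: (schwartz_pull (affmap_A_map _ _) (affmap_A_inv _ tau) (@A_mapK _ _ tau)).
pose X : cfun R (d + d) := fun w =>
  phi (A_map tau (row_mx (row_mx r (lsubmx w)) (row_mx rho (rsubmx w)))).
have sX : schwartz X.
  apply: (@schwartz_pull _ _ _ _
    (fun z => row_mx (rsubmx (lsubmx z)) (rsubmx (rsubmx z)))) sA; [by affmap_tac..|].
  by move=> w; rewrite !(row_mxKl, row_mxKr) hsubmxK.
pose Y : cfun R (d + d) := fun w => X (w + row_mx r (- rho)).
have sY : schwartz Y by exact: schwartz_translate.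
transitivity (cintegral Y).
  rewrite cintegral_shift; last exact: schwartz_cdominated.
  by congr cintegral; apply/funext => w; rewrite mul1r /swap_mid /X !(row_mxKl, row_mxKr).
rewrite /distr1 /distr_of_fun !cintegral_cat cintegral_swap; last exact: schwartz_cdominated.
congr cintegral; apply/funext => u; congr cintegral; apply/funext => v.
rewrite mul1r /Y /X /A_map /unshear add_row_mx !(row_mxKl, row_mxKr); congr phi.
by congr (row_mx (row_mx _ _) (row_mx _ _)); row_ring.
Qed.

End Quantization.

Theorem theorem4p3 (R : realType) (d : nat) (a : distr R (d + d))
    (tau1 tau2 : R) :
  tempered a ->
  0 <= tau1 <= 1 ->
  0 <= tau2 <= 1 ->
  (let b := symbol_b tau1 tau2 a in
   tempered b /\
   forall f g : cfun R d, schwartz f -> schwartz g ->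
     eq_distr (distr_wigner tau1 (Op tau2 a f) (distr_of_fun g))
              (Op tau2 b (wigner tau1 f g))) /\
  (let b := symbol_b tau1 (1 / 2) a in
   [/\ forall f g : cfun R d, schwartz f -> schwartz g ->
         eq_distr (distr_wigner tau1 (Op (1 / 2) a f) (distr_of_fun g))
                  (Op (1 / 2) b (wigner tau1 f g)),
       eq_distr b (distr_comp (sigma_of a) (@A_inv R d tau1)) &
       eq_distr (distr_comp (sigma_of a) (@A_inv R d tau1))
                (a_sheared tau1 a)]).
Proof.
move=> ta _ _; split; first split.
- exact: tempered_symbol_b.
- by move=> f g sf sg; exact: distr_wigner_Op.
split.
- by move=> f g sf sg; exact: distr_wigner_Op.
- exact: symbol_b_weyl.
- exact: sigma_A_inv_sheared.
Qed.
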